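(* Let $M$ be a complex manifold and $\mathfrak g$ a Lie algebra of holomorphic vector fields on $M$. If $D=\{f_\alpha\}$ is a $\mathfrak g$-invariant divisor on $M$ and $\lambda=\{\lambda_\alpha\}$ is the corresponding weight, then the lift $\mathfrak g^\lambda$ of $\mathfrak g$ to the line bundle $[D]$ defined by $\lambda$ is transversal.
   Context: A divisor $D=\{f_\alpha\}$ on $M$ is a collection of meromorphic functions $f_\alpha$ (not identically zero) on the members of an open cover $\{U_\alpha\}$ of $M$ such that $f_\alpha/f_\beta$ is a nonvanishing holomorphic function on $U_\alpha\cap U_\beta$. It is $\mathfrak g$-invariant if for each $\alpha$ there is a linear map $\lambda_\alpha\colon\mathfrak g\to\mathcal O(U_\alpha)$ ($\mathcal O$ = holomorphic functions) with $X(f_\alpha)=\lambda_\alpha(X)f_\alpha$ for all $X\in\mathfrak g$; the collection $\lambda=\{\lambda_\alpha\}$ is the weight of $D$. The line bundle $[D]\to M$ has transition functions $g_{\alpha\beta}=f_\alpha/f_\beta$, so linear fiber coordinates over $U_\alpha$, $U_\beta$ satisfy $u_\alpha=g_{\alpha\beta}u_\beta$. A lift of $\mathfrak g$ to a holomorphic line bundle $\pi\colon L\to M$ is a Lie algebra $\hat{\mathfrak g}$ of holomorphic projectable vector fields on $L$ commuting with the vertical field $u\partial_u$ ($u$ a linear fiber coordinate) such that $d\pi\colon\hat{\mathfrak g}\to\mathfrak g$ is a Lie algebra isomorphism. The lift $\mathfrak g^\lambda$ to $[D]$ is given over $U_\alpha$ by $\{X+\lambda_\alpha(X)u_\alpha\partial_{u_\alpha}:X\in\mathfrak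 g\}$. A lift $\hat{\mathfrak g}$ is called transversal if generic $\hat{\mathfrak g}$-orbits on $L$ project biholomorphically by $\pi$ (to $\mathfrak g$-orbits on $M$). *)

(* Defs.v *)
From HB Require Import structures.
From mathcomp Require Import all_boot all_order all_algebra.
From mathcomp Require Import all_classical all_reals all_analysis.
From mathcomp Require Import complex.

Set Implicit Arguments.
Unset Strict Implicit.
Unset Printing Implicit Defensive.

Import Order.TTheory GRing.Theory Num.Theory numFieldNormedType.Exports.
Local Open Scope classical_set_scope.
Local Open Scope ring_scope.

(* R[i] seen as a numClosedFieldType, so that it receives the norm, the topology
   and the (complex) Frechet differential of MathComp-Analysis. *)
Definition Cplx (R : realType) : numClosedFieldType := R[i].

(* A complex manifold modelled on E; the charts are total functions which are
   only meaningful on [cm_dom i] (resp. on the image of [cm_dom i] for the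
   inverse chart).  The dimension-n case is E = 'rV[Cplx R]_n; total spaces of
   line bundles over it are modelled on 'rV[Cplx R]_n * Cplx R. *)
Record cmanifold (R : realType) (E : normedModType (Cplx R)) := CManifold {
  cm_space :> topologicalType ;
  cm_hausdorff : hausdorff_space cm_space ;
  cm_countable : @second_countable cm_space ;
  cm_index : Type ;
  cm_dom : cm_index -> set cm_space ;
  cm_chart : cm_index -> cm_space -> E ;
  cm_inv : cm_index -> E -> cm_space ;
  cm_dom_open : forall i, open (cm_dom i) ;
  cm_cover : forall x, exists i, cm_dom i x ;
  cm_codom_open : forall i, open (cm_chart i @` cm_dom i) ;
  cm_chartK : forall i x, cm_dom i x -> cm_inv i (cm_chart i x) = x ;
  cm_chart_continuous : forall i x, cm_dom i x -> {for x, continuous (cm_chart i)} ;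
  cm_inv_continuous : forall i x,
    cm_dom i x -> {for cm_chart i x, continuous (cm_inv i)} ;
  cm_transition : forall i j x, cm_dom i x -> cm_dom j x ->
    differentiable (cm_chart j \o cm_inv i) (cm_chart i x) }.

Arguments cm_dom {R E} M i : rename.
Arguments cm_chart {R E} M i : rename.
Arguments cm_inv {R E} M i : rename.

Section Holomorphic.
Variable R : realType.
Local Notation C := (Cplx R).

(* Complex differentiability at a point; holomorphy on an open set is
   differentiability at each of its points. *)
Definition holo_fun_at (E : normedModType C) (M : cmanifold E) (f : M -> C)
    (x : M) :=
  forall i, cm_dom M i x -> differentiable (f \o cm_inv M i) (cm_chart M i x).

Definition holo_param_at (F E : normedModType C) (M : cmanifold E) (h : F -> M)
    (z : F) :=
  {for z, continuous h} /\
  forall j, cm_dom M j (h z) -> differentiable (cm_chart M j \o h) z.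

Definition holo_map (E F : normedModType C) (M : cmanifold E) (N : cmanifold F)
    (f : M -> N) :=
  forall x i, cm_dom M i x -> holo_param_at (f \o cm_inv M i) (cm_chart M i x).

Definition biholomorphism (E F : normedModType C) (M : cmanifold E)
    (N : cmanifold F) (f : M -> N) :=
  holo_map f /\ exists f' : N -> M, [/\ cancel f f', cancel f' f & holo_map f'].

Definition diff_in_charts (E F : normedModType C) (M : cmanifold E)
    (N : cmanifold F) (f : M -> N) (i : cm_index M) (j : cm_index N) (x : M) :
    E -> F :=
  'd (cm_chart N j \o f \o cm_inv M i) (cm_chart M i x).

(* Initial submanifold (an immersed submanifold such that maps into it are
   holomorphic as soon as they are holomorphic into the ambient manifold).  A
   subset carries at most one such structure up to biholomorphism over the
   ambient manifold, and the orbits of a Lie algebra of holomorphic vector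
   fields carry one: it is their structure of complex manifold. *)
Definition initial_submanifold (E : normedModType C) (M : cmanifold E)
    (O : set M) (k : nat) (N : cmanifold 'rV[C]_k) (iota : N -> M) :=
  [/\ holo_map iota,
      injective iota,
      range iota = O,
      (forall x i j, cm_dom N i x -> cm_dom M j (iota x) ->
         injective (diff_in_charts iota i j x)) &
      forall (m : nat) (P : cmanifold 'rV[C]_m) (h : P -> N),
        holo_map (iota \o h) -> holo_map h].

End Holomorphic.

Section VectorFields.
Variable R : realType.
Local Notation C := (Cplx R).
Variables (E : normedModType C) (M : cmanifold E).

(* [X i x] is the component, in the chart i, of the tangent vector at x.  It is
   set to 0 off the domain of the chart, so that equality of vector fields is
   Leibniz equality and their module structure is the pointwise one. *)
Definition vfield := cm_index M -> M -> E.

Definition holo_vfield (X : vfield) :=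
  [/\ forall i x, ~ cm_dom M i x -> X i x = 0,
      forall i x, cm_dom M i x ->
        differentiable (X i \o cm_inv M i) (cm_chart M i x) &
      forall i j x, cm_dom M i x -> cm_dom M j x ->
        X j x = 'd (cm_chart M j \o cm_inv M i) (cm_chart M i x) (X i x)].

(* c = (X f)(x) *)
Definition vderiv_at (X : vfield) (f : M -> C) (x : M) (c : C) :=
  forall i, cm_dom M i x -> 'd (f \o cm_inv M i) (cm_chart M i x) (X i x) = c.

Definition lie_bracket (X Y : vfield) : vfield := fun i x =>
  if x \in cm_dom M i then
    'd (Y i \o cm_inv M i) (cm_chart M i x) (X i x) -
    'd (X i \o cm_inv M i) (cm_chart M i x) (Y i x)
  else 0.

Definition lie_algebra (g : set vfield) :=
  [/\ forall X, g X -> holo_vfield X,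
      g 0,
      forall (c : C) X Y, g X -> g Y -> g (c *: X + Y) &
      forall X Y, g X -> g Y -> g (lie_bracket X Y)].

Definition integral_curve (X : vfield) (Omega : set C) (gamma : C -> M) :=
  forall t : C, Omega t -> holo_param_at gamma t /\
    forall i, cm_dom M i (gamma t) ->
      'd (cm_chart M i \o gamma) t 1 = X i (gamma t).

(* The points reached from x by successive (complex time) local flows of fields
   of g. *)
Inductive orbit (g : set vfield) (x : M) : set M :=
| orbit_refl : orbit g x x
| orbit_step X Omega gamma s t : g X -> open Omega -> connected Omega ->
    integral_curve X Omega gamma -> Omega s -> Omega t ->
    orbit g x (gamma s) -> orbit g x (gamma t).

End VectorFields.

Definition pushes_to (R : realType) (E F : normedModType (Cplx R))
    (M : cmanifold E) (N : cmanifold F) (f : M -> N) (V : vfield M)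
    (X : vfield N) :=
  forall y i j, cm_dom M i y -> cm_dom N j (f y) ->
    diff_in_charts f i j y (V i y) = X j (f y).

Section Divisors.
Variable R : realType.
Local Notation C := (Cplx R).
Variables (E : normedModType C) (M : cmanifold E).

Definition nowhere_identically_zero (U : set M) (f : M -> C) :=
  forall V, open V -> V `<=` U -> V !=set0 -> exists2 x, V x & f x != 0.

(* A meromorphic function on U: a holomorphic function on a dense open subset
   of U which is near each point of U a quotient of holomorphic functions.
   Values outside [mero_dom] are meaningless. *)
Record meromorphic (U : set M) := Meromorphic {
  mero_dom : set M ;
  mero_fun :> M -> C ;
  mero_dom_open : open mero_dom ;
  mero_dom_sub : mero_dom `<=` U ;
  mero_dom_dense : forall V, open V -> V `<=` U -> V !=set0 ->
    V `&` mero_dom !=set0 ;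
  mero_holo : forall x, mero_dom x -> holo_fun_at mero_fun x ;
  mero_quotient : forall x, U x -> exists (V : set M) (a b : M -> C),
    [/\ open V /\ V `<=` U, V x,
        forall y, V y -> holo_fun_at a y /\ holo_fun_at b y,
        nowhere_identically_zero V b &
        forall y, V y -> mero_dom y -> b y * mero_fun y = a y] }.

(* [dv_trans a b] is the nonvanishing holomorphic function f_a / f_b on
   U_a `&` U_b; it is determined there by the last field, by density. *)
Record divisor := Divisor {
  dv_index : Type ;
  dv_open : dv_index -> set M ;
  dv_fun : forall a, meromorphic (dv_open a) ;
  dv_trans : dv_index -> dv_index -> M -> C ;
  dv_open_open : forall a, open (dv_open a) ;
  dv_cover : forall x, exists a, dv_open a x ;
  dv_fun_neq0 : forall a, nowhere_identically_zero (mero_dom (dv_fun a)) (dv_fun a) ;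
  dv_trans_holo : forall a b x, dv_open a x -> dv_open b x ->
    holo_fun_at (dv_trans a b) x /\ dv_trans a b x != 0 ;
  dv_transE : forall a b x, mero_dom (dv_fun a) x -> mero_dom (dv_fun b) x ->
    dv_fun a x = dv_trans a b x * dv_fun b x }.

(* [lambda a X] is the function lambda_a(X), meaningful on U_a. *)
Definition is_weight (g : set (vfield M)) (D : divisor)
    (lambda : dv_index D -> vfield M -> M -> C) :=
  forall a : dv_index D,
    [/\ forall X, g X -> forall x, dv_open a x -> holo_fun_at (lambda a X) x,
        forall (c : C) X Y, g X -> g Y -> forall x, dv_open a x ->
          lambda a (c *: X + Y) x = c * lambda a X x + lambda a Y x &
        forall X, g X -> forall x, mero_dom (dv_fun a) x ->
          vderiv_at X (dv_fun a) x (lambda a X x * dv_fun a x)].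

End Divisors.

(* Holomorphic line bundle over M trivialized over the open cover U, with fiber
   coordinates u_a = [lb_coord a] related by u_a = t a b * u_b.  The inverse of
   the trivialization (pi, u_a) is [lb_sec a]. *)
Record line_bundle (R : realType) (E : normedModType (Cplx R)) (M : cmanifold E)
    (A : Type) (U : A -> set M) (t : A -> A -> M -> Cplx R) := LineBundle {
  lb_total :> cmanifold (E * Cplx R)%type ;
  lb_proj : lb_total -> M ;
  lb_coord : A -> lb_total -> Cplx R ;
  lb_sec : A -> M -> Cplx R -> lb_total ;
  lb_proj_holo : holo_map lb_proj ;
  lb_coord_holo : forall a y, U a (lb_proj y) -> holo_fun_at (lb_coord a) y ;
  lb_sec_proj : forall a x u, U a x -> lb_proj (lb_sec a x u) = x ;
  lb_sec_coord : forall a x u, U a x -> lb_coord a (lb_sec a x u) = u ;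
  lb_secK : forall a y, U a (lb_proj y) ->
    lb_sec a (lb_proj y) (lb_coord a y) = y ;
  lb_triv_holo : forall a j x (u : Cplx R), U a x -> cm_dom M j x ->
    holo_param_at (fun z : E * Cplx R => lb_sec a (cm_inv M j z.1) z.2)
        (cm_chart M j x, u) ;
  lb_coord_trans : forall a b y, U a (lb_proj y) -> U b (lb_proj y) ->
    lb_coord a y = t a b (lb_proj y) * lb_coord b y }.

(* The inverse of the trivialization (pi, u_a), read in the chart j of M. *)
Definition lb_triv (R : realType) (E : normedModType (Cplx R)) (M : cmanifold E)
    (A : Type) (U : A -> set M) (t : A -> A -> M -> Cplx R)
    (L : line_bundle U t) (a : A) (j : cm_index M) (z : E * Cplx R) : L :=
  lb_sec L a (cm_inv M j z.1) z.2.

(* The line bundle [D]. *)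
Definition divisor_bundle (R : realType) (E : normedModType (Cplx R))
    (M : cmanifold E) (D : divisor M) :=
  line_bundle (@dv_open _ _ _ D) (@dv_trans _ _ _ D).

Section Lifts.
Variable R : realType.
Local Notation C := (Cplx R).
Variables (E : normedModType C) (M : cmanifold E) (A : Type) (U : A -> set M).
Variables (t : A -> A -> M -> C) (L : line_bundle U t).
Local Notation pi := (@lb_proj _ _ _ _ _ _ L).
Local Notation u := (@lb_coord _ _ _ _ _ _ L).

(* Over U_a, V = X + h u_a d/du_a in the trivialization (pi, u_a). *)
Definition trivialized_as (a : A) (V : vfield L) (X : vfield M) (h : M -> C) :=
  forall y i j, U a (pi y) -> cm_dom L i y -> cm_dom M j (pi y) ->
    V i y = 'd (cm_chart L i \o lb_triv L a j) (cm_chart M j (pi y), u a y)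
              (X j (pi y), h (pi y) * u a y).

(* The vertical field u d/du *)
Definition euler_field (V : vfield L) :=
  holo_vfield V /\ forall a, trivialized_as a V 0 (fun=> 1).

Definition is_lift (g : set (vfield M)) (ghat : set (vfield L)) :=
  [/\ lie_algebra ghat,
      exists2 e, euler_field e & forall V, ghat V -> lie_bracket V e = 0 &
      exists dpi : vfield L -> vfield M,
        [/\ forall V, ghat V -> pushes_to pi V (dpi V),
            set_bij ghat g dpi,
            forall (c : C) V W, ghat V -> ghat W ->
              dpi (c *: V + W) = c *: dpi V + dpi W &
            forall V W, ghat V -> ghat W ->
              dpi (lie_bracket V W) = lie_bracket (dpi V) (dpi W)]].

(* The projection maps the ghat-orbit of y biholomorphically onto the g-orbit of
   pi y, for the structures of complex manifold of these orbits. *)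
Definition orbit_projects_biholomorphically (g : set (vfield M))
    (ghat : set (vfield L)) (y : L) :=
  set_bij (orbit ghat y) (orbit g (pi y)) pi /\
  forall (k' k : nat) (N' : cmanifold 'rV[C]_k') (N : cmanifold 'rV[C]_k)
      (iota' : N' -> L) (iota : N -> M),
    initial_submanifold (orbit ghat y) iota' ->
    initial_submanifold (orbit g (pi y)) iota ->
    exists2 phi : N' -> N, biholomorphism phi & pi \o iota' = iota \o phi.

(* Generic orbits are those through the points of some dense open subset. *)
Definition transversal_lift (g : set (vfield M)) (ghat : set (vfield L)) :=
  is_lift g ghat /\
  exists W : set L, [/\ open W, dense W &
    forall y, W y -> orbit_projects_biholomorphically g ghat y].

End Lifts.

Definition weight_lift (R : realType) (E : normedModType (Cplx R))
    (M : cmanifold E) (D : divisor M) (L : divisor_bundle D)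
    (g : set (vfield M)) (lambda : dv_index D -> vfield M -> M -> Cplx R) :
    set (vfield L) :=
  [set V | holo_vfield V /\
    exists2 X, g X & forall a, trivialized_as (L := L) a V X (lambda a X)].

Arguments weight_lift {R E M D} L g lambda.

(* Main.v *)
Require Import Defs.
From HB Require Import structures.
From mathcomp Require Import all_boot all_order all_algebra.
From mathcomp Require Import all_classical all_reals all_analysis.
From mathcomp Require Import complex.
From mathcomp Require Import ring lra.

(** On the total space of [D], the points with u_a = c f_a(x), for a fixed
    constant c, form a well defined multiple of the tautological meromorphic
    section, because f_a / f_b is the transition function; and this graph is
    tangent to the lifted fields, because X f_a = lambda_a(X) f_a.  Call a point
    of M regular if f_a extends near it to a nonvanishing holomorphic function.
    Over regular points the graphs are holomorphic sections which fill the
    bundle, so the orbit of a point over a regular point stays in one of them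
    and the section is a holomorphic inverse of the projection.  The regular
    points form a dense open set, and the points of the bundle above it are the
    generic ones.

    That the fields X + lambda_a(X) u_a d/du_a fit together to a lift of g
    follows from two identities satisfied by the weight,
    X t_ab = (lambda_a(X) - lambda_b(X)) t_ab and
    lambda_a([X, Y]) = X lambda_a(Y) - Y lambda_a(X) ([weight_cocycle],
    [weight_bracket]).  Both hold where f_a is holomorphic and nonzero, and
    extend by density ([eq_dense]).

    The heart of the proof is that orbits do not leave the set of regular points
    ([regular_curve]); a priori a point where f_a has a zero, a pole or an
    indeterminacy could be reached by the flow.  Near such a point p write
    f_a = A / B.  The weight condition becomes X(A) B - A X(B) = l A B with
    l = lambda_a(X), hence along the flow phi_s of X
    A(z) B(phi_s z) k_s(z) = A(phi_s z) B(z), where k_s is the exponential of the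
    integral of l along the flow line.  If the point phi_s(p) is regular, with
    extension F0 of f_a, then F0(phi_s z) / k_s(z) extends f_a near p
    ([quotient_transport]).  So the set of times at which an integral curve is
    at a regular point is open and closed.

    This uses the holomorphic flow of a holomorphic vector field, the identity
    theorem, and the symmetry of second derivatives (for brackets), where
    holomorphic only means complex differentiable.  They are derived from
    Goursat's theorem on rectangles, through Cauchy's formula on a square
    contour, quadratic Taylor estimates ([taylor]) and the theorem that uniform
    limits of differentiable functions are differentiable ([weierstrass]); the
    flow is obtained by Picard iteration ([flow]). *)

Set Implicit Arguments.
Unset Strict Implicit.
Unset Printing Implicit Defensive.
Import Order.TTheory GRing.Theory Num.Theory numFieldNormedType.Exports.
Local Open Scope classical_set_scope.
Local Open Scope ring_scope.

(** * A real-valued norm and differentiability in epsilon-delta form *)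

Section RealNorm.
Variable R : realType.
Local Notation C := (Cplx R).

Definition rc (x : R) : C := real_complex R x.

Lemma rcD x y : rc (x + y) = rc x + rc y. Proof. exact: (rmorphD (real_complex R)). Qed.
Lemma rcB x y : rc (x - y) = rc x - rc y. Proof. exact: (rmorphB (real_complex R)). Qed.
Lemma rcN x : rc (- x) = - rc x. Proof. exact: (rmorphN (real_complex R)). Qed.
Lemma rcM x y : rc (x * y) = rc x * rc y. Proof. exact: (rmorphM (real_complex R)). Qed.
Lemma rcV x : rc (x^-1) = (rc x)^-1. Proof. exact: (fmorphV (real_complex R)). Qed.
Lemma rc0 : rc 0 = 0. Proof. by []. Qed.
Lemma rc1 : rc 1 = 1. Proof. by []. Qed.
Lemma rcX x n : rc (x ^+ n) = rc x ^+ n. Proof. exact: (rmorphXn (real_complex R)). Qed.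
Lemma rc_nat n : rc n%:R = n%:R. Proof. exact: (rmorph_nat (real_complex R)). Qed.
Lemma rc_le x y : (rc x <= rc y) = (x <= y). Proof. exact: lecR. Qed.
Lemma rc_lt x y : (rc x < rc y) = (x < y). Proof. exact: ltcR. Qed.
Lemma rc_inj : injective rc. Proof. by move=> x y []. Qed.

Lemma rc_pos (e : C) : 0 < e -> exists2 d : R, 0 < d & e = rc d.
Proof.
case: e => a b; rewrite ltcE /= => /andP[/eqP b0 a0].
by exists a => //; rewrite /rc /= /real_complex_def b0.
Qed.

Section Norm.
Variable V : normedModType C.
Implicit Types x y v w : V.

(** The norm is valued in [Cplx R], which is only partially ordered; its real
    part is the same number in the ordered field [R]. *)
Definition nr v : R := complex.Re `|v|.

Lemma nrE v : `|v| = rc (nr v).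
Proof. by rewrite /rc /nr; apply/esym/RRe_real/normr_real. Qed.

Lemma nr_ge0 v : 0 <= nr v.
Proof. by rewrite -rc_le -nrE rc0 normr_ge0. Qed.

Lemma nr_lt v (e : R) : (`|v| < rc e) = (nr v < e).
Proof. by rewrite nrE rc_lt. Qed.

Lemma nrD v w : nr (v + w) <= nr v + nr w.
Proof. by rewrite -rc_le rcD -!nrE ler_normD. Qed.

Lemma nrN v : nr (- v) = nr v.
Proof. by rewrite /nr normrN. Qed.

Lemma nrB v w : nr (v - w) <= nr v + nr w.
Proof. by rewrite -[in X in _ <= X](nrN w) nrD. Qed.

Lemma nrBC v w : nr (v - w) = nr (w - v).
Proof. by rewrite -nrN opprB. Qed.

Lemma nr0 : nr (0 : V) = 0.
Proof. by rewrite /nr normr0. Qed.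

Lemma nr_eq0 v : nr v = 0 -> v = 0.
Proof. by move=> h; apply/eqP; rewrite -normr_eq0 nrE h. Qed.

Lemma nr_gt0 v : (0 < nr v) = (v != 0).
Proof. by rewrite -rc_lt -nrE rc0 normr_gt0. Qed.

Lemma nrZ (k : C) v : nr (k *: v) = complex.Re `|k| * nr v.
Proof. by apply: rc_inj; rewrite rcM -nrE normrZ nrE; congr (_ * _); rewrite /rc RRe_real // normr_real. Qed.

Lemma nr_tri u v w : nr (u - w) <= nr (u - v) + nr (v - w).
Proof. by rewrite -(subrKA v) nrD. Qed.

Lemma nr_sum (I : Type) (s : seq I) (P : pred I) (f : I -> V) :
  nr (\sum_(i <- s | P i) f i) <= \sum_(i <- s | P i) nr (f i).
Proof.
elim/big_rec2: _; first by rewrite nr0.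
by move=> i a b _ h; apply: le_trans (nrD _ _) _; rewrite lerD2l.
Qed.

Lemma nbhs_nr x (A : set V) :
  nbhs x A <-> exists2 e : R, 0 < e & forall y, nr (y - x) < e -> A y.
Proof.
split.
  move/nbhs_ballP => [e /= /rc_pos [d d0 ->] h].
  exists d => // y yx; apply: h; rewrite -ball_normE /= nr_lt nrBC //.
move=> [e e0 h]; apply/nbhs_ballP; exists (rc e) => /=.
  by rewrite -rc0 rc_lt.
by move=> y; rewrite -ball_normE /= nr_lt nrBC => /h.
Qed.

Lemma near_nr x (P : V -> Prop) :
  (\forall y \near x, P y) <-> exists2 e : R, 0 < e & forall y, nr (y - x) < e -> P y.
Proof. exact: (nbhs_nr x P). Qed.

Lemma nr_small v (A : R) : (forall e, 0 < e -> nr v <= A * e) -> v = 0.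
Proof.
move=> h; apply: nr_eq0; apply/eqP; rewrite eq_le nr_ge0 andbT leNgt; apply/negP => v0.
have A0 : 0 < A by have := h 1 ltr01; rewrite mulr1; apply: lt_le_trans.
have /h : 0 < nr v / (2 * A) by rewrite divr_gt0 // mulr_gt0.
rewrite [X in _ <= X](_ : _ = nr v / 2); last first.
  by field; rewrite gt_eqF.
lra.
Qed.

End Norm.

Lemma nrM (z w : C) : nr (z * w) = nr z * nr w.
Proof. exact: nrZ. Qed.

Lemma nrZ' (V : normedModType C) (z : C) (v : V) : nr (z *: v) = nr z * nr v.
Proof. exact: nrZ. Qed.

Lemma nr_rc (x : R) : nr (rc x : C) = `|x|.
Proof.
apply: rc_inj; rewrite -nrE /rc normc_def /= expr0n addr0 sqrtr_sqr //.
Qed.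

Lemma nr1 : nr (1 : C) = 1.
Proof. by rewrite -rc1 nr_rc normr1. Qed.

Lemma nrV (z : C) : nr (z^-1) = (nr z)^-1.
Proof. by apply: rc_inj; rewrite -nrE normfV nrE rcV. Qed.

Lemma nrX (z : C) n : nr (z ^+ n) = nr z ^+ n.
Proof. by apply: rc_inj; rewrite -nrE normrX nrE rcX. Qed.

Lemma nr_Re (z : C) : `|complex.Re z| <= nr z.
Proof. by rewrite -rc_le -nrE; exact: normc_ge_Re. Qed.

Lemma nr_Im (z : C) : `|complex.Im z| <= nr z.
Proof.
rewrite -rc_le -nrE /rc normc_def lecR -sqrtr_sqr ler_wsqrtr // lerDr sqr_ge0 //.
Qed.

Lemma nr_ReIm (z : C) : nr z <= `|complex.Re z| + `|complex.Im z|.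
Proof.
rewrite {1}[z]complexE; apply: le_trans (nrD _ _) _; rewrite nrM (nr_rc (complex.Re z)) (nr_rc (complex.Im z)).
suff -> : nr ('i%C : C) = 1 by rewrite mul1r.
by apply: rc_inj; rewrite -nrE /rc normc_def /= expr0n expr1n add0r sqrtr1.
Qed.

Lemma nr_pair (V W : normedModType C) (p : V * W) : nr p = Num.max (nr p.1) (nr p.2).
Proof.
apply: rc_inj; rewrite -nrE prod_normE /= !nrE.
by rewrite /Order.max rc_lt; case: ifP.
Qed.

Lemma nr_fst (V W : normedModType C) (p : V * W) : nr p.1 <= nr p.
Proof. by rewrite nr_pair le_max lexx. Qed.
Lemma nr_snd (V W : normedModType C) (p : V * W) : nr p.2 <= nr p.
Proof. by rewrite nr_pair le_max lexx orbT. Qed.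
Section EpsDelta.
Variables V W : normedModType C.
Implicit Types (f : V -> W).

Lemma cont_nr f x : {for x, continuous f} <->
  forall e : R, 0 < e -> exists2 d : R, 0 < d & forall y, nr (y - x) < d -> nr (f y - f x) < e.
Proof.
split.
  move=> h e e0.
  have /h : nbhs (f x) [set w | nr (w - f x) < e] by apply/nbhs_nr; exists e.
  by move=> /nbhs_nr.
move=> h A /nbhs_nr [e e0 hA].
have [d d0 hd] := h e e0.
by apply/nbhs_nr; exists d => // y /hd /hA.
Qed.

Lemma linear_bound (L : {linear V -> W}) : continuous L ->
  exists2 k : R, 0 < k & forall v, nr (L v) <= k * nr v.
Proof.
move=> /linear_lipschitz [k /rc_pos [d d0 ->]] h; exists d => // v.
by rewrite -rc_le rcM -!nrE h.
Qed.

Lemma diff_eps f x : differentiable f x -> forall e : R, 0 < e ->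
  exists2 d : R, 0 < d & forall h, nr h < d -> nr (f (x + h) - f x - 'd f x h) <= e * nr h.
Proof.
move=> df e e0.
have /eqaddoP ho := diff_locally df.
have /ho : 0 < rc e by rewrite -rc0 rc_lt.
move=> /nbhs_nr [d d0 hd]; exists d => // h hh.
have := hd h; rewrite subr0 => /(_ hh) /=.
by rewrite !nrE -rcM rc_le /= !fctE opprD addrA (addrC h).
Qed.

(** The differential is chosen by the library among candidates; this criterion
    identifies it with an explicit linear map. *)
Lemma is_diff_of_eps f x (L : {linear V -> W}) (k : R) :
  (forall v, nr (L v) <= k * nr v) ->
  (forall e : R, 0 < e ->
    exists2 d : R, 0 < d & forall h, nr h < d -> nr (f (x + h) - f x - L h) <= e * nr h) ->
  is_diff x f L.
Proof.
move=> hk hL.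
have cL : continuous L.
  move=> v; apply/cont_nr => e e0.
  exists (e / (`|k| + 1)); first by rewrite divr_gt0 // ltr_wpDl.
  move=> y; rewrite ltr_pdivlMr ?ltr_wpDl // -linearB => hy.
  apply: le_lt_trans (hk _) _; apply: le_lt_trans hy.
  rewrite mulrC ler_wpM2l ?nr_ge0 // ler_wpDr //; exact: ler_norm.
have hf : f \o shift x = cst (f x) + L +o_ 0 id.
  apply/eqaddoP => _ /posnumP[ee].
  have /rc_pos[e e0 ->] : 0 < ee%:num by [].
  have [d d0 hd] := hL e e0.
  apply/nbhs_nr; exists d => // h; rewrite subr0 => /hd.
  by rewrite !nrE -rcM rc_le /= !fctE opprD addrA (addrC h).
have dL := diff_unique cL hf.
split => //; apply/diff_locallyP; rewrite dL; split => //.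
Qed.

Lemma is_diff_of_eps_fun f x (L : V -> W) (k : R) :
  linear L ->
  (forall v, nr (L v) <= k * nr v) ->
  (forall e : R, 0 < e ->
    exists2 d : R, 0 < d & forall h, nr h < d -> nr (f (x + h) - f x - L h) <= e * nr h) ->
  is_diff x f L.
Proof.
move=> linL.
pose LM := GRing.isLinear.Build _ _ _ _ _ linL.
pose L' : {linear V -> W} := HB.pack L LM.
exact: (@is_diff_of_eps f x L' k).
Qed.

Lemma is_diff_near f g x (L : V -> W) :
  (\forall y \near x, f y = g y) -> is_diff x f L -> is_diff x g L.
Proof.
move=> /near_nr[r r0 hr] df.
have dfx : differentiable f x by exact: ex_diff.
have [k k0 hk] := linear_bound (diff_continuous dfx).
rewrite -(diff_val (is_diff_def := df)).
apply: (is_diff_of_eps hk) => e e0.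
have [d d0 hd] := diff_eps dfx e0.
exists (Num.min d r); first by rewrite lt_min d0.
move=> h; rewrite lt_min => /andP[h1 h2].
rewrite -!hr ?subrr ?nr0 //; first exact: hd.
by rewrite addrAC subrr add0r.
Qed.

End EpsDelta.
End RealNorm.

(** * Integrals of complex functions over real segments *)

Section Cint.
Variable R : realType.
Local Notation C := (Cplx R).
Local Notation mu := (@lebesgue_measure R).
Implicit Types (h k : R -> C) (a b c : R).

(** Continuity on the segment [a, b]: only the values of [h] there matter. *)
Definition ccont h a b := forall x, a <= x <= b -> forall e, 0 < e ->
  exists2 d, 0 < d & forall y, a <= y <= b -> `|y - x| < d -> nr (h y - h x) < e.

Definition cint h a b : C :=
  Complex (\int[mu]_(x in `[a, b]) complex.Re (h x)) (\int[mu]_(x in `[a, b]) complex.Im (h x)).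

Lemma cReB (z w : C) : complex.Re (z - w) = complex.Re z - complex.Re w.
Proof. by case: z; case: w. Qed.
Lemma cImB (z w : C) : complex.Im (z - w) = complex.Im z - complex.Im w.
Proof. by case: z; case: w. Qed.
Lemma cReD (z w : C) : complex.Re (z + w) = complex.Re z + complex.Re w.
Proof. by case: z; case: w. Qed.
Lemma cImD (z w : C) : complex.Im (z + w) = complex.Im z + complex.Im w.
Proof. by case: z; case: w. Qed.

Lemma Cext (z w : C) : complex.Re z = complex.Re w -> complex.Im z = complex.Im w -> z = w.
Proof. by case: z w => a b [c d] /= -> ->. Qed.

Lemma cReM (z w : C) : complex.Re (z * w) =
  complex.Re z * complex.Re w - complex.Im z * complex.Im w.
Proof. by case: z; case: w. Qed.
Lemma cImM (z w : C) : complex.Im (z * w) =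
  complex.Re z * complex.Im w + complex.Im z * complex.Re w.
Proof. by case: z; case: w. Qed.

Lemma ccont_within (p : C -> R) h a b :
  (forall z w, `|p z - p w| <= nr (z - w)) ->
  ccont h a b -> {within `[a, b], continuous (fun x => p (h x))}.
Proof.
move=> hp hc; apply/subspace_continuousP => x; rewrite /= in_itv /= => xab.
apply/cvgrPdist_lt => e e0.
have [d d0 hd] := hc x xab e e0.
rewrite near_withinE; apply/nbhs_ballP; exists d => //= y; rewrite /ball /= distrC => yx.
rewrite /= in_itv /= => yab; rewrite distrC; apply: le_lt_trans (hp _ _) _.
exact: hd.
Qed.

Lemma ccont_Re h a b : ccont h a b -> {within `[a, b], continuous (fun x => complex.Re (h x))}.
Proof. by apply: ccont_within => z w; rewrite -cReB nr_Re. Qed.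
Lemma ccont_Im h a b : ccont h a b -> {within `[a, b], continuous (fun x => complex.Im (h x))}.
Proof. by apply: ccont_within => z w; rewrite -cImB nr_Im. Qed.

Lemma within_int (f : R -> R) a b : {within `[a, b], continuous f} ->
  mu.-integrable `[a, b] (EFin \o f).
Proof. by move=> cf; apply: continuous_compact_integrable => //; exact: segment_compact. Qed.

Lemma ccont_cst (z : C) a b : ccont (fun=> z) a b.
Proof. by move=> ? _ e' e'0; exists 1 => // ? _ _; rewrite subrr nr0. Qed.

Lemma ccontD h k a b : ccont h a b -> ccont k a b -> ccont (fun z => h z + k z) a b.
Proof.
move=> ch1 ch2 z zI e' e'0; have e2 : 0 < e' / 2 by rewrite divr_gt0.
have [u1 u10 hu1] := ch1 z zI _ e2; have [u2 u20 hu2] := ch2 z zI _ e2.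
exists (Num.min u1 u2); first by rewrite lt_min u10.
move=> w wI; rewrite lt_min => /andP[w1 w2]; rewrite opprD addrACA.
apply: le_lt_trans (nrD _ _) _; have := hu1 w wI w1; have := hu2 w wI w2; lra.
Qed.

Lemma ccontZ (c : C) h a b : ccont h a b -> ccont (fun z => c * h z) a b.
Proof.
move=> ch1 z zI e e0; have p : 0 < nr c + 1 by rewrite ltr_wpDl ?nr_ge0.
have [|u u0 hu] := ch1 z zI (e / (nr c + 1)); first by rewrite divr_gt0.
exists u => // w wI wz; rewrite -mulrBr nrM.
have := hu w wI wz; rewrite ltr_pdivlMr // mulrDr mulr1 mulrC => H.
by apply: le_lt_trans H; rewrite lerDl nr_ge0.
Qed.

Lemma Rint_split (f : R -> R) a b c : a <= c -> c <= b -> {within `[a, b], continuous f} ->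
  \int[mu]_(x in `[a, b]) f x = \int[mu]_(x in `[a, c]) f x + \int[mu]_(x in `[c, b]) f x.
Proof.
move=> ac cb cf; have int_ab := within_int cf.
have := @Rintegral_itvB _ f (BLeft a) (BRight b) c int_ab.
rewrite !bnd_simp => /(_ ac cb) /eqP; rewrite subr_eq => /eqP ->.
rewrite addrC; congr (_ + _).
apply: Rintegral_itv_obnd_cbnd.
apply: integrableS int_ab => //= x /=; rewrite !in_itv /= => /andP[h ->].
by rewrite andbT (le_trans ac (ltW h)).
Qed.

Lemma cint_split h a b c : a <= c -> c <= b -> ccont h a b ->
  cint h a b = cint h a c + cint h c b.
Proof.
move=> ac cb hc; rewrite /cint (Rint_split ac cb (ccont_Re hc)) (Rint_split ac cb (ccont_Im hc)).
by [].
Qed.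

Lemma eq_cint h k a b : (forall x, a <= x <= b -> h x = k x) -> cint h a b = cint k a b.
Proof.
move=> hk; rewrite /cint; congr Complex; apply: eq_Rintegral => x;
  by rewrite inE /= in_itv /= => /hk ->.
Qed.

Lemma cintD h k a b : ccont h a b -> ccont k a b ->
  cint (fun x => h x + k x) a b = cint h a b + cint k a b.
Proof.
move=> hc kc; rewrite /cint.
have h1 := within_int (ccont_Re hc); have h2 := within_int (ccont_Im hc).
have k1 := within_int (ccont_Re kc); have k2 := within_int (ccont_Im kc).
by apply: Cext; rewrite ?cReD ?cImD /= -RintegralD //; apply: eq_Rintegral => x _; rewrite ?cReD ?cImD.
Qed.

Lemma cintZ (z : C) h a b : ccont h a b ->
  cint (fun x => z * h x) a b = z * cint h a b.
Proof.
move=> hc; case: z => u v; rewrite /cint.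
have h1 := within_int (ccont_Re hc); have h2 := within_int (ccont_Im hc).
have uh1 : mu.-integrable `[a, b] (EFin \o (fun x => u * complex.Re (h x))).
  apply: within_int => x; apply: cvgM; [exact: cvg_cst|exact: ccont_Re hc x].
have vh1 : mu.-integrable `[a, b] (EFin \o (fun x => v * complex.Re (h x))).
  apply: within_int => x; apply: cvgM; [exact: cvg_cst|exact: ccont_Re hc x].
have uh2 : mu.-integrable `[a, b] (EFin \o (fun x => u * complex.Im (h x))).
  apply: within_int => x; apply: cvgM; [exact: cvg_cst|exact: ccont_Im hc x].
have vh2 : mu.-integrable `[a, b] (EFin \o (fun x => v * complex.Im (h x))).
  apply: within_int => x; apply: cvgM; [exact: cvg_cst|exact: ccont_Im hc x].
by apply: Cext; rewrite ?cReM ?cImM /= -!RintegralZl // -?RintegralD // -?RintegralB //;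
  apply: eq_Rintegral => x _; rewrite ?cReM ?cImM.
Qed.

Lemma cint_cst (z : C) a b : a <= b -> cint (fun=> z) a b = rc (b - a) * z.
Proof.
move=> ab; have m : fine (mu `[a, b]) = b - a.
  rewrite lebesgue_measure_itv /= lte_fin; case: ltP => h //=.
  by have -> : a = b by [apply/eqP; rewrite eq_le ab h]; rewrite subrr.
case: z => u v; rewrite /cint !Rintegral_cst //= m.
by apply: Cext; rewrite ?cReM ?cImM /= mul0r ?subr0 ?addr0 mulrC.
Qed.

Lemma Rint_bound (f : R -> R) a b M : a <= b -> {within `[a, b], continuous f} ->
  (forall x, a <= x <= b -> `|f x| <= M) -> `|\int[mu]_(x in `[a, b]) f x| <= M * (b - a).
Proof.
move=> ab cf hM; have int_f := within_int cf.
apply: le_trans (le_normr_Rintegral _ int_f) _ => //.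
have -> : M * (b - a) = \int[mu]_(x in `[a, b]) M.
  rewrite Rintegral_cst //= lebesgue_measure_itv /= lte_fin; case: ltP => h //=.
  by have -> : a = b by [apply/eqP; rewrite eq_le ab h]; rewrite subrr.
apply: le_Rintegral => //.
  have := integrable_abse int_f; by [].
apply: within_int; apply: continuous_subspaceT => x; exact: cst_continuous.
Qed.

Lemma Rint_lower (f : R -> R) a b m : a <= b -> {within `[a, b], continuous f} ->
  (forall x, a <= x <= b -> m <= f x) -> m * (b - a) <= \int[mu]_(x in `[a, b]) f x.
Proof.
move=> ab cf hm; have int_f := within_int cf.
have -> : m * (b - a) = \int[mu]_(x in `[a, b]) m.
  rewrite Rintegral_cst //= lebesgue_measure_itv /= lte_fin; case: ltP => h //=.
  by have -> : a = b by [apply/eqP; rewrite eq_le ab h]; rewrite subrr.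
apply: le_Rintegral => //.
apply: within_int; apply: continuous_subspaceT => x; exact: cst_continuous.
Qed.

(** The factor 2 comes from bounding the real and imaginary parts separately. *)
Lemma cint_bound h a b M : a <= b -> ccont h a b ->
  (forall x, a <= x <= b -> nr (h x) <= M) -> nr (cint h a b) <= 2 * M * (b - a).
Proof.
move=> ab hc hM; apply: le_trans (nr_ReIm _) _.
have -> : 2 * M * (b - a) = M * (b - a) + M * (b - a) by ring.
apply: lerD; apply: Rint_bound => //.
- exact: ccont_Re.
- by move=> x /hM; apply: le_trans; exact: nr_Re.
- exact: ccont_Im.
- by move=> x /hM; apply: le_trans; exact: nr_Im.
Qed.

Lemma real_derive (p : C -> R) (g : C -> C) (t : R) :
  (forall z w, p (z + w) = p z + p w) -> (forall z, `|p z| <= nr z) ->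
  (forall (x : R) z, p (rc x * z) = x * p z) ->
  differentiable g (rc t : C) ->
  is_derive t 1 (fun x => p (g (rc x))) (p ('d g (rc t : C) 1)).
Proof.
move=> pD pn pZ dg.
suff H : (fun x : R => x^-1 *: (((fun x => p (g (rc x))) \o shift t) (x *: 1) - p (g (rc t))))
   @ 0^' --> p ('d g (rc t : C) 1).
  split; first by apply/cvg_ex; eexists; exact: H.
  by apply/cvg_lim.
have pB z w : p (z - w) = p z - p w.
  rewrite pD; congr (_ + _); rewrite -[- w]mulN1r -rc1 -rcN pZ.
  by rewrite mulN1r.
apply/cvgrPdist_le => e e0.
have [d d0 hd] := diff_eps dg e0.
rewrite near_withinE; apply/nbhs_ballP; exists d => //= x; rewrite /ball /= sub0r normrN => xd x0.
have := hd (rc x); rewrite nr_rc => /(_ xd) hx.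
rewrite [x *: 1]mulr1 /= -(ler_pM2l (_ : 0 < `|x|)) ?normr_gt0 // -normrM.
rewrite [X in `|X|](_ : _ = p (- (g (rc t + rc x) - g (rc t) - 'd g (rc t : C) (rc x)))).
  by apply: le_trans (pn _) _; rewrite nrN mulrC.
have -> : 'd g (rc t : C) (rc x) = rc x * 'd g (rc t : C) 1.
  transitivity ('d g (rc t : C) (rc x *: (1 : C))); last by rewrite linearZ.
  by rewrite -[rc x *: _]/(_ * _) mulr1.
rewrite opprB !pB pZ rcD [rc x + rc t]addrC mulrBr; congr (_ - _).
by rewrite -[_ *: _]/(_ * _) mulrA mulfV // mul1r.
Qed.

Lemma Re_derive (g : C -> C) (t : R) : differentiable g (rc t : C) ->
  is_derive t 1 (fun x => complex.Re (g (rc x))) (complex.Re ('d g (rc t : C) 1)).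
Proof.
apply: (@real_derive (@complex.Re R)); [exact: cReD|exact: nr_Re|].
by move=> x z; rewrite cReM /= mul0r subr0.
Qed.

Lemma Im_derive (g : C -> C) (t : R) : differentiable g (rc t : C) ->
  is_derive t 1 (fun x => complex.Im (g (rc x))) (complex.Im ('d g (rc t : C) 1)).
Proof.
apply: (@real_derive (@complex.Im R)); [exact: cImD|exact: nr_Im|].
by move=> x z; rewrite cImM /= mul0r addr0.
Qed.

Lemma derive_within (f df : R -> R) a b : (forall x, a <= x <= b -> is_derive x 1 f (df x)) ->
  {within `[a, b], continuous f}.
Proof.
move=> hf; apply: derivable_within_continuous => x; rewrite in_itv /= => /hf h.
exact: ex_derive.
Qed.

(** The mean value theorem fails for complex values; it is applied to the real and
    imaginary parts, at different points, whence the factor 2. *)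
Lemma mean_value01 (g : C -> C) M :
  (forall t : R, 0 <= t <= 1 -> differentiable g (rc t : C)) ->
  (forall t : R, 0 <= t <= 1 -> nr ('d g (rc t : C) 1) <= M) ->
  nr (g 1 - g 0) <= 2 * M.
Proof.
move=> dg hM; apply: le_trans (nr_ReIm _) _.
have hr (x : R) : 0 <= x <= 1 -> is_derive x 1 (fun x => complex.Re (g (rc x))) (complex.Re ('d g (rc x : C) 1)).
  by move=> /dg; exact: Re_derive.
have hi (x : R) : 0 <= x <= 1 -> is_derive x 1 (fun x => complex.Im (g (rc x))) (complex.Im ('d g (rc x : C) 1)).
  by move=> /dg; exact: Im_derive.
have oo (x : R) : x \in `]0, 1[ -> (0 : R) <= x <= 1.
  by rewrite in_itv /= => /andP[? ?]; rewrite !ltW.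
have [c1 /oo c1I e1] := MVT ltr01 (fun x xI => hr x (oo x xI)) (derive_within hr).
have [c2 /oo c2I e2] := MVT ltr01 (fun x xI => hi x (oo x xI)) (derive_within hi).
rewrite cReB cImB -[1]rc1 -[0]rc0 e1 e2 subr0 !mulr1.
have -> : 2 * M = M + M by ring.
by apply: lerD; [apply: le_trans (nr_Re _) _|apply: le_trans (nr_Im _) _]; apply: hM.
Qed.

Lemma cint_ftc (g : C -> C) :
  (forall t : R, 0 <= t <= 1 -> differentiable g (rc t : C)) ->
  ccont (fun t => 'd g (rc t : C) 1) 0 1 ->
  cint (fun t => 'd g (rc t : C) 1) 0 1 = g 1 - g 0.
Proof.
move=> dg hc.
have key (p : C -> R) : (forall x : R, 0 <= x <= 1 ->
      is_derive x 1 (fun x => p (g (rc x))) (p ('d g (rc x : C) 1))) ->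
    {within `[0, 1], continuous (fun x : R => p ('d g (rc x : C) 1))} ->
    \int[mu]_(x in `[0, 1]) p ('d g (rc x : C) 1) = p (g 1) - p (g 0).
  move=> hr cr; rewrite /Rintegral (@continuous_FTC2 _ _ (fun x => p (g (rc x)))) //=.
  have cc := derive_within hr.
  have [c1 c2 c3] := (continuous_within_itvP (fun x : R => p (g (rc x))) (ltr01 : (0:R) < 1)).1 cc.
    split => // x; rewrite in_itv /= => /andP[x0 x1].
    by have := hr x; rewrite !ltW // => /(_ isT) h; exact: ex_derive.
  move=> x; rewrite in_itv /= => /andP[x0 x1]; rewrite derive1E.
  by have := hr x; rewrite !ltW // => /(_ isT) h; exact: derive_val.
apply: Cext; rewrite ?cReB ?cImB /=; apply: key.
- by move=> x /dg; exact: Re_derive.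
- exact: ccont_Re.
- by move=> x /dg; exact: Im_derive.
- exact: ccont_Im.
Qed.

End Cint.

(** * Goursat's theorem on rectangles *)

Section Goursat.
Variable R : realType.
Local Notation C := (Cplx R).

Lemma nested_itv (u v : nat -> R) :
  (forall n, u n <= u n.+1) -> (forall n, v n.+1 <= v n) -> (forall n, u n <= v n) ->
  exists x, forall n, u n <= x <= v n.
Proof.
move=> hu hv uv.
have mu m n : (m <= n)%N -> u m <= u n.
  move=> mn; elim: n mn => [|n IH]; first by rewrite leqn0 => /eqP ->.
  rewrite leq_eqVlt => /orP[/eqP -> //|]; rewrite ltnS => /IH h; exact: le_trans h (hu n).
have mv m n : (m <= n)%N -> v n <= v m.
  move=> mn; elim: n mn => [|n IH]; first by rewrite leqn0 => /eqP ->.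
  rewrite leq_eqVlt => /orP[/eqP -> //|]; rewrite ltnS => /IH; exact: le_trans (hv n).
have uvmn m n : u m <= v n.
  apply: le_trans (mu _ _ (leq_maxl m n)) _; apply: le_trans (uv _) (mv _ _ (leq_maxr m n)).
exists (sup (range u)) => n; apply/andP; split.
  apply: ub_le_sup; last by exists n.
  by exists (v 0%N) => _ [m _ <-].
apply: ge_sup; first by exists (u 0%N), 0%N.
by move=> _ [m _ <-].
Qed.

Variables P Q : C * C -> C.

Definition rpt (t th : R) : C * C := (rc t, rc th).

(** The integral of P dt + Q dth along the boundary of [a, b] x [c, d]. *)
Definition bdry (a b c d : R) : C :=
  cint (fun th => Q (rpt b th)) c d - cint (fun th => Q (rpt a th)) c d
  - cint (fun t => P (rpt t d)) a b + cint (fun t => P (rpt t c)) a b.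

(** The 1-form P dt + Q dth is closed on the rectangle. *)
Definition closed_on (a b c d : R) := forall t th, a <= t <= b -> c <= th <= d ->
  [/\ differentiable P (rpt t th), differentiable Q (rpt t th) &
      'd P (rpt t th) (0, 1) = 'd Q (rpt t th) (1, 0)].

Lemma rpt_nr t th t' th' : nr (rpt t th - rpt t' th') <= `|t - t'| + `|th - th'|.
Proof.
by rewrite nr_pair /= -!rcB !nr_rc ge_max lerDl lerDr !normr_ge0.
Qed.

Lemma ccont_row (F : C * C -> C) a b th :
  (forall t, a <= t <= b -> differentiable F (rpt t th)) -> ccont (fun t => F (rpt t th)) a b.
Proof.
move=> dF t tab e e0.
have /cont_nr /(_ e e0)[d d0 hd] := differentiable_continuous (dF t tab).
exists d => // y yab yt; apply: hd; apply: le_lt_trans (rpt_nr _ _ _ _) _.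
by rewrite subrr normr0 addr0.
Qed.

Lemma ccont_col (F : C * C -> C) a b t :
  (forall th, a <= th <= b -> differentiable F (rpt t th)) -> ccont (fun th => F (rpt t th)) a b.
Proof.
move=> dF th tab e e0.
have /cont_nr /(_ e e0)[d d0 hd] := differentiable_continuous (dF th tab).
exists d => // y yab yt; apply: hd; apply: le_lt_trans (rpt_nr _ _ _ _) _.
by rewrite subrr normr0 add0r.
Qed.

Lemma closed_onS a b c d a' b' c' d' : a <= a' -> b' <= b -> c <= c' -> d' <= d ->
  closed_on a b c d -> closed_on a' b' c' d'.
Proof.
move=> aa bb cc dd h t th /andP[t1 t2] /andP[th1 th2]; apply: h.
  by rewrite (le_trans aa t1) (le_trans t2 bb).
by rewrite (le_trans cc th1) (le_trans th2 dd).
Qed.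

Lemma closed_ccont a b c d : closed_on a b c d ->
  (forall th, c <= th <= d -> ccont (fun t => P (rpt t th)) a b) /\
  (forall t, a <= t <= b -> ccont (fun th => Q (rpt t th)) c d).
Proof.
move=> h; split=> [th thcd|t tab].
  by apply: ccont_row => t tab; have [] := h t th tab thcd.
by apply: ccont_col => th thcd; have [] := h t th tab thcd.
Qed.

Lemma bdry_split a m b c k d : a <= m -> m <= b -> c <= k -> k <= d -> closed_on a b c d ->
  bdry a b c d = bdry a m c k + bdry m b c k + bdry a m k d + bdry m b k d.
Proof.
move=> am mb ck kd /closed_ccont [hP hQ]; have ab := le_trans am mb; have cd := le_trans ck kd.
rewrite /bdry.
rewrite (cint_split ck kd (hQ a _)) ?lexx ?ab // (cint_split ck kd (hQ b _)) ?lexx ?ab //.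
rewrite (cint_split am mb (hP c _)) ?lexx ?cd // (cint_split am mb (hP d _)) ?lexx ?cd //.
ring.
Qed.

(** The affine parts of [P] and [Q] at a point contribute nothing to the boundary
    integral, because the form is closed there; what remains is negligible before
    the square of the perimeter. *)
Lemma bdry_local a b c d t th e : a <= t <= b -> c <= th <= d -> closed_on a b c d -> 0 < e ->
  exists2 r : R, 0 < r & forall a' b' c' d', a <= a' -> b' <= b -> c <= c' -> d' <= d ->
    a' <= t <= b' -> c' <= th <= d' -> (b' - a') + (d' - c') < r ->
    nr (bdry a' b' c' d') <= 4 * e * ((b' - a') + (d' - c')) ^+ 2.
Proof.
move=> tab thcd h e0; have [dP dQ PQ] := h t th tab thcd.
have [r1 r10 h1] := diff_eps dP e0; have [r2 r20 h2] := diff_eps dQ e0.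
exists (Num.min r1 r2); first by rewrite lt_min r10.
move=> a' b' c' d' aa bb cc dd /andP[t1 t2] /andP[th1 th2]; rewrite lt_min => /andP[l1 l2].
have h' := closed_onS aa bb cc dd h.
have [hP hQ] := closed_ccont h'.
have ab' := le_trans t1 t2; have cd' := le_trans th1 th2.
set l := b' - a' + (d' - c').
have near x y : a' <= x <= b' -> c' <= y <= d' -> nr (rpt x y - rpt t th) <= l.
  move=> /andP[x1 x2] /andP[y1 y2]; apply: le_trans (rpt_nr _ _ _ _) _.
  by apply: lerD; rewrite ler_norml; apply/andP; split; lra.
have eP x y : a' <= x <= b' -> c' <= y <= d' ->
    nr (P (rpt x y) - P (rpt t th) - 'd P (rpt t th) (rpt x y - rpt t th)) <= e * l.
  move=> hx hy; have n1 := near x y hx hy.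
  have := h1 (rpt x y - rpt t th) (le_lt_trans n1 l1); rewrite subrKC => H.
  by apply: le_trans H _; rewrite ler_pM2l.
have eQ x y : a' <= x <= b' -> c' <= y <= d' ->
    nr (Q (rpt x y) - Q (rpt t th) - 'd Q (rpt t th) (rpt x y - rpt t th)) <= e * l.
  move=> hx hy; have n1 := near x y hx hy.
  have := h2 (rpt x y - rpt t th) (le_lt_trans n1 l2); rewrite subrKC => H.
  by apply: le_trans H _; rewrite ler_pM2l.
have a'I : a' <= a' <= b' by rewrite lexx.
have b'I : a' <= b' <= b' by rewrite lexx ab'.
have c'I : c' <= c' <= d' by rewrite lexx.
have d'I : c' <= d' <= d' by rewrite lexx cd'.
pose D := 'd Q (rpt t th) (1, 0).
pose FQ th' := Q (rpt b' th') + - 1 * Q (rpt a' th') + (- (rc (b' - a') * D)).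
pose FP t' := P (rpt t' d') + - 1 * P (rpt t' c') + (- (rc (d' - c') * D)).
have -> : bdry a' b' c' d' = cint FQ c' d' - cint FP a' b'.
  have Q1 := hQ b' b'I; have Q2 := ccontZ (-1) (hQ a' a'I).
  have P1 := hP d' d'I; have P2 := ccontZ (-1) (hP c' c'I).
  have ccs := @ccont_cst R.
  rewrite /FQ /FP (cintD (ccontD Q1 Q2) (ccs _ _ _)) (cintD (ccontD P1 P2) (ccs _ _ _)).
  rewrite (cintD Q1 Q2) (cintD P1 P2) (cintZ _ (hQ a' a'I)) (cintZ _ (hP c' c'I)) !cint_cst //.
  by rewrite /bdry; ring.
have cFQ := ccontD (ccontD (hQ b' b'I) (ccontZ (-1) (hQ a' a'I))) (@ccont_cst R (- (rc (b' - a') * D)) c' d').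
have cFP := ccontD (ccontD (hP d' d'I) (ccontZ (-1) (hP c' c'I))) (@ccont_cst R (- (rc (d' - c') * D)) a' b').
have bQ x : c' <= x <= d' -> nr (FQ x) <= 2 * (e * l).
  move=> xI; rewrite (_ : FQ x =
    (Q (rpt b' x) - Q (rpt t th) - 'd Q (rpt t th) (rpt b' x - rpt t th)) -
    (Q (rpt a' x) - Q (rpt t th) - 'd Q (rpt t th) (rpt a' x - rpt t th))).
    apply: le_trans (nrB _ _) _; have := eQ b' x b'I xI; have := eQ a' x a'I xI; lra.
  rewrite /FQ; have <- : 'd Q (rpt t th) (rpt b' x - rpt t th) - 'd Q (rpt t th) (rpt a' x - rpt t th) = rc (b' - a') * D.
    rewrite -linearB /= [X in 'd Q _ X](_ : _ = rc (b' - a') *: ((1 : C), (0 : C))).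
      by rewrite linearZ.
    rewrite /rpt; congr (_, _); rewrite /= ?scaler0 -?[_ *: 1]/(_ * 1) ?mulr1 ?rcB /=; ring.
  ring.
have bP x : a' <= x <= b' -> nr (FP x) <= 2 * (e * l).
  move=> xI; rewrite (_ : FP x =
    (P (rpt x d') - P (rpt t th) - 'd P (rpt t th) (rpt x d' - rpt t th)) -
    (P (rpt x c') - P (rpt t th) - 'd P (rpt t th) (rpt x c' - rpt t th))).
    apply: le_trans (nrB _ _) _; have := eP x d' xI d'I; have := eP x c' xI c'I; lra.
  rewrite /FP; have <- : 'd P (rpt t th) (rpt x d' - rpt t th) - 'd P (rpt t th) (rpt x c' - rpt t th) = rc (d' - c') * D.
    rewrite -linearB /= [X in 'd P _ X](_ : _ = rc (d' - c') *: ((0 : C), (1 : C))).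
      by rewrite linearZ /= PQ.
    rewrite /rpt; congr (_, _); rewrite /= ?scaler0 -?[_ *: 1]/(_ * 1) ?mulr1 ?rcB /=; ring.
  ring.
apply: le_trans (nrB _ _) _.
have i1 := @cint_bound _ FQ _ _ _ cd' cFQ bQ; have i2 := @cint_bound _ FP _ _ _ ab' cFP bP.
apply: le_trans (lerD i1 i2) _; rewrite -mulrDr (_ : d' - c' + (b' - a') = l); last by rewrite /l addrC.
by rewrite le_eqVlt; apply/orP; left; apply/eqP; ring.
Qed.

(** Goursat's argument: among the four quarters of a rectangle, one carries at
    least a quarter of the boundary integral.  Iterating leads to a point where
    [bdry_local] contradicts a nonzero integral.  This does not
    presuppose that the partial derivatives are continuous, which for complex
    differentiable functions is a consequence. *)
Theorem goursat a b c d : a <= b -> c <= d -> closed_on a b c d -> bdry a b c d = 0.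
Proof.
move=> ab cd h.
pose rect := ((R * R) * (R * R))%type.
pose J (r : rect) := nr (bdry r.1.1 r.1.2 r.2.1 r.2.2).
pose half (r r' : R * R) := [/\ r.1 <= r'.1, r'.2 <= r.2, r'.1 <= r'.2 & r'.2 - r'.1 = (r.2 - r.1) / 2].
have step (r : rect) : exists r' : rect, r.1.1 <= r.1.2 -> r.2.1 <= r.2.2 ->
    closed_on r.1.1 r.1.2 r.2.1 r.2.2 ->
    [/\ half r.1 r'.1, half r.2 r'.2 & J r <= 4 * J r'].
  have [/and3P[/asboolP r1 /asboolP r2 /asboolP r3]|no] := boolP [&& `[< r.1.1 <= r.1.2 >],
     `[< r.2.1 <= r.2.2 >] & `[< closed_on r.1.1 r.1.2 r.2.1 r.2.2 >]]; last first.
    exists r => r1 r2 r3; exfalso; move/negP: no; apply.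
    by apply/and3P; split; apply/asboolP.
  pose m := (r.1.1 + r.1.2) / 2; pose k := (r.2.1 + r.2.2) / 2.
  have m1 : r.1.1 <= m by rewrite /m; lra.
  have m2 : m <= r.1.2 by rewrite /m; lra.
  have k1 : r.2.1 <= k by rewrite /k; lra.
  have k2 : k <= r.2.2 by rewrite /k; lra.
  have l1 : half r.1 (r.1.1, m) by split => //=; rewrite /m; lra.
  have l2 : half r.1 (m, r.1.2) by split => //=; rewrite /m; lra.
  have l3 : half r.2 (r.2.1, k) by split => //=; rewrite /k; lra.
  have l4 : half r.2 (k, r.2.2) by split => //=; rewrite /k; lra.
  have E : J r <= J ((r.1.1, m), (r.2.1, k)) + J ((m, r.1.2), (r.2.1, k))
     + J ((r.1.1, m), (k, r.2.2)) + J ((m, r.1.2), (k, r.2.2)).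
    rewrite /J (bdry_split m1 m2 k1 k2 r3) /=.
    by do 3! (apply: le_trans (nrD _ _) _; rewrite lerD2r).
  have [q1|q1] := lerP (J r) (4 * J ((r.1.1, m), (r.2.1, k))); first by exists ((r.1.1, m), (r.2.1, k)); split.
  have [q2|q2] := lerP (J r) (4 * J ((m, r.1.2), (r.2.1, k))); first by exists ((m, r.1.2), (r.2.1, k)); split.
  have [q3|q3] := lerP (J r) (4 * J ((r.1.1, m), (k, r.2.2))); first by exists ((r.1.1, m), (k, r.2.2)); split.
  have [q4|q4] := lerP (J r) (4 * J ((m, r.1.2), (k, r.2.2))); first by exists ((m, r.1.2), (k, r.2.2)); split.
  exfalso; lra.
have [f hf] := choice step.
pose rn n := iter n f ((a, b), (c, d)).
have inv n : [/\ a <= (rn n).1.1, (rn n).1.2 <= b, c <= (rn n).2.1 & (rn n).2.2 <= d] /\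
    [/\ (rn n).1.1 <= (rn n).1.2, (rn n).2.1 <= (rn n).2.2,
     (rn n).1.2 - (rn n).1.1 = (b - a) / 2 ^+ n, (rn n).2.2 - (rn n).2.1 = (d - c) / 2 ^+ n &
     J ((a, b), (c, d)) <= 4 ^+ n * J (rn n)].
  elim: n => [|n [[i1 i2 i3 i4] [i5 i6 i7 i8 i9]]].
    by split; split; rewrite //= ?expr0 ?divr1 ?mul1r.
  have [//|//|//|[s1 s2 s3 s4] [s5 s6 s7 s8] s9] := hf (rn n); first exact: closed_onS h.
  rewrite /rn iterS -/(rn n); split; split => //.
  - exact: le_trans s1.
  - exact: le_trans s2 _.
  - exact: le_trans s5.
  - exact: le_trans s6 _.
  - by rewrite s4 i7 exprSr invfM mulrA.
  - by rewrite s8 i8 exprSr invfM mulrA.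
  - apply: le_trans i9 _; rewrite exprSr -mulrA ler_pM2l // exprn_gt0 //.
have stp n : half (rn n).1 (rn n.+1).1 /\ half (rn n).2 (rn n.+1).2.
  have [[i1 i2 i3 i4] [i5 i6 i7 i8 i9]] := inv n.
  have [//|//|//|? ? ?] := hf (rn n); first exact: closed_onS h.
  by [].
have [t ht] : exists t, forall n, (rn n).1.1 <= t <= (rn n).1.2.
  apply: nested_itv => n; first by have [[]] := stp n.
    by have [[]] := stp n.
  by have [_ []] := inv n.
have [th hth] : exists t, forall n, (rn n).2.1 <= t <= (rn n).2.2.
  apply: nested_itv => n; first by have [_ []] := stp n.
    by have [_ []] := stp n.
  by have [_ []] := inv n.
(* The rectangles shrink like 2^(-n) and their boundary integrals decrease at most
   like 4^(-n), which is no faster than the square of the perimeter. *)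
apply: (@nr_small _ _ _ (4 * (b - a + (d - c)) ^+ 2)) => e e0.
have [r r0 hr] := bdry_local (ht 0%N) (hth 0%N) h e0.
set L := b - a + (d - c).
have L0 : 0 <= L by rewrite /L addr_ge0 // subr_ge0.
have [n hn] : exists n, L / 2 ^+ n < r.
  have [n hn] : exists n : nat, L / r < n%:R.
    exists (Num.truncn (L / r)).+1; exact: truncnS_gt.
  exists n; rewrite ltr_pdivrMr ?exprn_gt0 // mulrC -ltr_pdivrMr //.
  apply: lt_le_trans hn _; rewrite -natrX ler_nat ltnW // ltn_expl //.
have [[i1 i2 i3 i4] [i5 i6 i7 i8 i9]] := inv n.
have E : (rn n).1.2 - (rn n).1.1 + ((rn n).2.2 - (rn n).2.1) = L / 2 ^+ n.
  by rewrite i7 i8 -mulrDl.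
have := hr _ _ _ _ i1 i2 i3 i4 (ht n) (hth n); rewrite E => /(_ hn) H.
apply: le_trans i9 _; apply: le_trans (ler_wpM2l _ H) _; first by rewrite exprn_ge0.
rewrite expr_div_n -exprM mulnC exprM (_ : 2 ^+ 2 = 4 :> R); last by rewrite -natrX.
rewrite le_eqVlt; apply/orP; left; apply/eqP; field.
by rewrite expf_neq0.
Qed.

End Goursat.

(** * Calculus of differentials *)

Section DiffCalc.
Variable R : realType.
Local Notation C := (Cplx R).
Implicit Types V W U : normedModType C.

(** The [isd_] lemmas state the rules of calculus for functions written pointwise,
    so that the differential of an expression is computed by composing proof
    terms. *)
Lemma isd_ext V W (f g : V -> W) df dg x : is_diff x f df -> f =1 g -> df =1 dg -> is_diff x g dg.
Proof. by move=> h /funext <- /funext <-. Qed.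

Lemma isd_uniq V W (f : V -> W) df dg x : is_diff x f df -> is_diff x f dg -> df =1 dg.
Proof. by move=> [_ h] [_ h'] v; rewrite -h -h'. Qed.

Lemma isdE V W (f : V -> W) df x : is_diff x f df -> forall v, 'd f x v = df v.
Proof. by move=> [_ <-]. Qed.

Lemma isd_ex V W (f : V -> W) df x : is_diff x f df -> differentiable f x.
Proof. by case. Qed.

Lemma isd_of V W (f : V -> W) x : differentiable f x -> is_diff x f ('d f x).
Proof. exact: differentiableP. Qed.

Lemma isd_cst V W (c : W) (x : V) : is_diff x (fun _ => c) (fun _ => 0).
Proof. exact: is_diff_cst. Qed.

Lemma isd_id V (x : V) : is_diff x (fun y => y) (fun y => y).
Proof. exact: is_diff_id. Qed.

Lemma isd_add V W (f g : V -> W) df dg x : is_diff x f df -> is_diff x g dg ->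
  is_diff x (fun y => f y + g y) (fun h => df h + dg h).
Proof. by move=> a b; exact: is_diffD. Qed.

Lemma isd_sub V W (f g : V -> W) df dg x : is_diff x f df -> is_diff x g dg ->
  is_diff x (fun y => f y - g y) (fun h => df h - dg h).
Proof. by move=> a b; exact: is_diffB. Qed.

Lemma isd_mul V (f g : V -> C) df dg x : is_diff x f df -> is_diff x g dg ->
  is_diff x (fun y => f y * g y) (fun h => f x * dg h + g x * df h).
Proof. by move=> a b; exact: is_diffM. Qed.

Lemma isd_comp U V W (f : U -> V) (g : V -> W) df dg x : is_diff x f df -> is_diff (f x) g dg ->
  is_diff x (fun y => g (f y)) (fun h => dg (df h)).
Proof. by move=> a b; exact: is_diff_comp. Qed.

Lemma isd_inv V (f : V -> C) df x : is_diff x f df -> f x != 0 ->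
  is_diff x (fun y => (f y)^-1) (fun h => - (f x) ^- 2 * df h).
Proof.
move=> a b; have b' : is_diff (f x) (GRing.inv : C -> C) (fun h => - (f x) ^- 2 * h).
  by split; [exact: differentiable_Rinv|exact: diff_Rinv].
exact: isd_comp a b'.
Qed.

Lemma isd_pair U V W (f : U -> V) (g : U -> W) df dg x : is_diff x f df -> is_diff x g dg ->
  is_diff x (fun y => (f y, g y)) (fun h => (df h, dg h)).
Proof. by move=> a b; exact: is_diff_pair. Qed.

Lemma isd_scalev V W (k : V -> C) (w : W) dk x : is_diff x k dk ->
  is_diff x (fun y => k y *: w) (fun h => dk h *: w).
Proof. by move=> h; have := isd_comp h (is_diff_scalel (k x) w). Qed.

Lemma isd_scalek V W (c : C) (f : V -> W) df x : is_diff x f df ->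
  is_diff x (fun y => c *: f y) (fun h => c *: df h).
Proof. by move=> h; exact: is_diffZ. Qed.

Lemma isd_lin V W (f : V -> W) x (k : R) : linear f -> (forall v, nr (f v) <= k * nr v) ->
  is_diff x f f.
Proof.
move=> lin hk; apply: (is_diff_of_eps_fun lin hk) => e e0; exists 1 => // h _.
have -> : f (x + h) - f x - f h = 0.
  by have := lin 1 h x; rewrite !scale1r (addrC x h) => ->; rewrite addrK subrr.
by rewrite nr0 mulr_ge0 ?nr_ge0 // ltW.
Qed.

Lemma isd_fst V W (x : V * W) : is_diff x (fun p => p.1) (fun p => p.1).
Proof. by apply: (@isd_lin _ _ _ _ 1) => // v; rewrite mul1r nr_fst. Qed.

Lemma isd_snd V W (x : V * W) : is_diff x (fun p => p.2) (fun p => p.2).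
Proof. by apply: (@isd_lin _ _ _ _ 1) => // v; rewrite mul1r nr_snd. Qed.

Lemma isd_sum V W (I : Type) (s : seq I) (f : I -> V -> W) (df : I -> V -> W) x :
  (forall i, is_diff x (f i) (df i)) ->
  is_diff x (fun y => \sum_(i <- s) f i y) (fun h => \sum_(i <- s) df i h).
Proof.
move=> h; elim: s => [|i s IH].
  by apply: isd_ext (isd_cst 0 x) _ _ => ?; rewrite big_nil.
by apply: isd_ext (isd_add (h i) IH) _ _ => ?; rewrite big_cons.
Qed.

Lemma isd_line V (p v : V) (t : C) : is_diff t (fun s => p + s *: v) (fun s => s *: v).
Proof.
apply: isd_ext (isd_add (isd_cst p t) (isd_scalev v (isd_id t))) _ _ => // h; exact: add0r.
Qed.

Lemma diff_C (f : C -> C) (z h : C) : 'd f z h = h * 'd f z 1.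
Proof. by rewrite -[in LHS](mulr1 h) -[h * 1]/(h *: 1) linearZ. Qed.

Lemma isd_C (f : C -> C) df (z : C) : is_diff z f df -> is_diff z f (fun h => h * df 1).
Proof.
by move=> h; apply: (isd_ext h) => // c; rewrite -(isdE h) diff_C (isdE h).
Qed.

Lemma ccont_diff (f : C -> C) (a b : R) :
  (forall t, a <= t <= b -> differentiable f (rc t : C)) -> ccont (fun t => f (rc t)) a b.
Proof.
move=> df t tab e e0.
have /cont_nr /(_ e e0)[d d0 hd] := differentiable_continuous (df t tab).
by exists d => // y yab yt; apply: hd; rewrite -rcB nr_rc.
Qed.

End DiffCalc.

(** * Cauchy's formula on a square contour *)

Section Cauchy.
Variable R : realType.
Local Notation C := (Cplx R).

Definition ci : C := Complex 0 1.
(** The contour is the square with corners r, ir, -r, -ir, whose [k]-th side is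
    parametrized by [0, 1].  Compared with a circle it avoids the exponential;
    it lies in the annulus r / 2 <= |w| <= r. *)
Definition side (r : R) (k : nat) (x : C) : C := rc r * ci ^+ k * (1 + x * (ci - 1)).
Definition side_vec (r : R) (k : nat) : C := rc r * ci ^+ k * (ci - 1).
(** The integral of F(w) dw along the square contour. *)
Definition oint (r : R) (F : C -> C) : C :=
  \sum_(k < 4) cint (fun th => F (side r k (rc th)) * side_vec r k) 0 1.
Definition diff_annulus (r : R) (F : C -> C) := forall w, r / 2 <= nr w <= r -> differentiable F w.

Lemma ci4 : ci ^+ 4 = 1.
Proof.
have ci2 : ci ^+ 2 = -1 by rewrite expr2; apply: Cext; rewrite /= ?mul0r ?mulr0 ?mul1r ?sub0r ?addr0 ?oppr0.
by rewrite (exprM ci 2 2) ci2 sqrrN expr1n.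
Qed.

Lemma nr_ci : nr ci = 1.
Proof.
by apply: rc_inj; rewrite -nrE /rc normc_def /= expr0n expr1n add0r sqrtr1.
Qed.

Lemma chord_nr (th : R) : 0 <= th <= 1 -> 1 / 2 <= nr (1 + rc th * (ci - 1)) <= 1.
Proof.
move=> /andP[t0 t1]; set v := 1 + _.
have Rv : complex.Re v = 1 - th by rewrite /v cReD cReM cReB cImB /=; ring.
have Iv : complex.Im v = th by rewrite /v cImD cImM cReB cImB /=; ring.
have n1 := nr_Re v; have n2 := nr_Im v; have n3 := nr_ReIm v.
rewrite Rv ger0_norm ?subr_ge0 // in n1 n3; rewrite Iv ger0_norm // in n2 n3.
by apply/andP; split; lra.
Qed.

Lemma side_nr r k (th : R) : 0 < r -> 0 <= th <= 1 -> r / 2 <= nr (side r k (rc th)) <= r.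
Proof.
move=> r0 /chord_nr /andP[h1 h2].
rewrite /side !nrM nrX nr_ci expr1n nr_rc gtr0_norm // mulr1.
apply/andP; split; last by rewrite -[X in _ <= X]mulr1 ler_pM2l.
by rewrite ler_pM2l //; lra.
Qed.

Lemma side_vec_nr r k : 0 < r -> nr (side_vec r k) <= 2 * r.
Proof.
move=> r0; rewrite /side_vec !nrM nrX nr_ci expr1n nr_rc gtr0_norm // mulr1 mulrC ler_pM2r //.
by apply: le_trans (nrB _ _) _; rewrite nr_ci nr1; lra.
Qed.

Lemma isd_side r k (x : C) : is_diff x (side r k) (fun h => h * side_vec r k).
Proof.
apply: (isd_ext (isd_mul (isd_cst (rc r * ci ^+ k) x)
  (isd_add (isd_cst (1 : C) x) (isd_mul (isd_id x) (isd_cst (ci - 1) x))))) => // h.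
by rewrite /side_vec; ring.
Qed.

Lemma side_end r k : side r k 1 = side r k.+1 0.
Proof. by rewrite /side exprSr; ring. Qed.

(** The sides close up: the end of each one is the beginning of the next. *)
Lemma sum_corners (f : C -> C) r : \sum_(k < 4) (f (side r k 1) - f (side r k 0)) = 0.
Proof.
rewrite !big_ord_recr big_ord0 /= !side_end.
have -> : side r 4 0 = side r 0 0 by rewrite /side ci4 expr0.
by ring.
Qed.

Section OneContour.
Variable r : R.
Hypothesis r0 : 0 < r.

Lemma oint_ccont F k : diff_annulus r F -> ccont (fun th => F (side r k (rc th)) * side_vec r k) 0 1.
Proof.
move=> hF; apply: (@ccont_diff _ (fun x => F (side r k x) * side_vec r k)) => t tI.
have dF := isd_of (hF _ (side_nr k r0 tI)).
exact: isd_ex (isd_mul (isd_comp (isd_side r k (rc t)) dF) (isd_cst (side_vec r k) (rc t : C))).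
Qed.

Lemma ointD F G : diff_annulus r F -> diff_annulus r G -> oint r (fun w => F w + G w) = oint r F + oint r G.
Proof.
move=> hF hG; rewrite /oint -big_split /=; apply: eq_bigr => k _.
rewrite -cintD; [|exact: oint_ccont..].
by apply: eq_cint => x _; rewrite mulrDl.
Qed.

Lemma ointZ c F : diff_annulus r F -> oint r (fun w => c * F w) = c * oint r F.
Proof.
move=> hF; rewrite /oint mulr_sumr; apply: eq_bigr => k _.
rewrite -cintZ; [|exact: oint_ccont].
by apply: eq_cint => x _; rewrite mulrA.
Qed.

Lemma eq_oint F G : (forall w, r / 2 <= nr w <= r -> F w = G w) -> oint r F = oint r G.
Proof.
move=> h; apply: eq_bigr => k _; apply: eq_cint => x xI; rewrite h //; exact: side_nr.
Qed.

Lemma oint_bound F M : diff_annulus r F -> (forall w, r / 2 <= nr w <= r -> nr (F w) <= M) ->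
  nr (oint r F) <= 16 * r * M.
Proof.
move=> hF hM; apply: le_trans (nr_sum _ _ _) _.
have -> : 16 * r * M = \sum_(k < 4) 2 * (M * (2 * r)) * (1 - 0).
  rewrite !big_ord_recr big_ord0 /=; ring.
apply: ler_sum => k _; apply: cint_bound; rewrite ?ler01 //; first exact: oint_ccont.
move=> x xI; rewrite nrM; apply: ler_pM; rewrite ?nr_ge0 ?side_vec_nr //.
by apply: hM; exact: side_nr.
Qed.

End OneContour.

Lemma pole_far (r : R) (s w : C) : nr s < r / 4 -> r / 2 <= nr w -> r / 4 <= nr (w - s).
Proof.
move=> hs hw; have := nr_tri w s 0; rewrite !subr0; have := nr_ge0 s; lra.
Qed.

Lemma nr_neq0 (z : C) a : 0 < a -> a <= nr z -> z != 0.
Proof. by move=> a0 az; rewrite -nr_gt0; apply: lt_le_trans az. Qed.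

Lemma isd_shrink (s w0 : C) (r : R) k (x : C * C) :
  is_diff x (fun x => s + x.1 * (side r k x.2 - s))
   (fun h => h.1 * (side r k x.2 - s) + x.1 * (h.2 * side_vec r k)).
Proof.
have dw := isd_comp (isd_snd x) (isd_side r k x.2).
apply: (isd_ext (isd_add (isd_cst s x) (isd_mul (isd_fst x) (isd_sub dw (isd_cst s x))))) => // h.
by rewrite /=; ring.
Qed.

Lemma closed_alg (t W q D G : C) : t != 0 -> W != 0 ->
  G * (- t ^- 2 * 0) + t^-1 * ((0 * W + t * (1 * q)) * D - 0) =
  G / W * 0 + q * (G * (- W ^- 2 * (0 * q - 0)) + W^-1 * ((1 * W + t * (0 * q)) * D - 0)).
Proof. by move=> t0 W0; field; rewrite t0 W0. Qed.

(** Contract the contour to [s] by w |-> s + t (w - s).  The integral does not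
    depend on [t], by [goursat] on each side, the contributions of the corners
    cancelling; and it tends to 0 with [t], because [g] is continuous at [s]. *)
Lemma oint_diff_quotient (g : C -> C) (s : C) (r rho : R) : 0 < r -> r < rho -> nr s < r / 4 ->
  (forall z, nr z < rho -> differentiable g z) ->
  oint r (fun w => (g w - g s) / (w - s)) = 0.
Proof.
move=> r0 rr hs dg.
have inball (t : R) w : 0 <= t <= 1 -> nr w <= r -> nr (s + rc t * (w - s)) < rho.
  move=> /andP[t0 t1] wr; have -> : s + rc t * (w - s) = rc (1 - t) * s + rc t * w.
    by rewrite rcB; ring.
  apply: le_lt_trans (nrD _ _) _; rewrite !nrM !nr_rc !ger0_norm ?subr_ge0 //.
  have := ler_wpM2l t0 wr; have : (1 - t) * nr s <= (1 - t) * r.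
    by apply: ler_wpM2l; rewrite ?subr_ge0 //; lra.
  lra.
pose Q k (x : C * C) := (g (s + x.1 * (side r k x.2 - s)) - g s) / (side r k x.2 - s) * side_vec r k.
(* With x = (t, th), [P] dt + [Q] dth is the pull-back of (g(z) - g(s)) dz / (z - s)
   by the homotopy z = s + t (w - s). *)
pose P k (x : C * C) := (g (s + x.1 * (side r k x.2 - s)) - g s) / x.1.
have wz k (th : R) : 0 <= th <= 1 -> side r k (rc th) - s != 0.
  by move=> /(side_nr k r0) /andP[w1 w2]; apply: (@nr_neq0 _ (r / 4));
    [rewrite divr_gt0 // | apply: pole_far].
have cl k e : 0 < e -> closed_on (P k) (Q k) e 1 0 1.
  move=> e0 t th /andP[te t1] thI; have t0 : 0 < t := lt_le_trans e0 te.
  have tI : 0 <= t <= 1 by rewrite ltW.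
  have tz : rc t != 0 by apply/eqP => /(congr1 (@complex.Re R)) /= /eqP; rewrite gt_eqF.
  pose x := rpt t th.
  have dG : is_diff x (fun x => g (s + x.1 * (side r k x.2 - s)) - g s) _ :=
    isd_sub (isd_comp (isd_shrink s 0 r k x) (isd_C (isd_of (dg _ (inball t _ tI (proj2 (andP (side_nr k r0 thI)))))))) (isd_cst (g s) x).
  have dw := isd_sub (isd_comp (isd_snd x) (isd_side r k x.2)) (isd_cst s x).
  have dP : is_diff x (P k) _ := isd_mul dG (isd_inv (isd_fst x) tz).
  have dQ : is_diff x (Q k) _ :=
    isd_mul (isd_mul dG (isd_inv dw (wz k th thI))) (isd_cst (side_vec r k) x).
  have EP := isdE dP (0, 1); have EQ := isdE dQ (1, 0).
  split; [exact: isd_ex dP|exact: isd_ex dQ|].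
  apply: (etrans EP); apply: (etrans _ (esym EQ)).
  exact: closed_alg tz (wz k th thI).
have cst_int (e : R) : 0 < e <= 1 ->
   \sum_(k < 4) cint (fun th => Q k (rpt 1 th)) 0 1 = \sum_(k < 4) cint (fun th => Q k (rpt e th)) 0 1.
  move=> /andP[e0 e1]; apply/eqP; rewrite -subr_eq0 -sumrB; apply/eqP.
  have E (k : 'I_4) : cint (fun th => Q k (rpt 1 th)) 0 1 - cint (fun th => Q k (rpt e th)) 0 1 =
      cint (fun t => P k (rpt t 1)) e 1 - cint (fun t => P k (rpt t 0)) e 1.
    have := goursat e1 ler01 (cl k e e0); rewrite /bdry => /eqP.
    by rewrite addr_eq0 subr_eq => /eqP ->; rewrite addrC.
  rewrite (eq_bigr _ (fun k _ => E k)).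
  pose f (w : C) := cint (fun t => (g (s + rc t * (w - s)) - g s) / rc t) e 1.
  exact: (sum_corners f r).
have I1 : oint r (fun w => (g w - g s) / (w - s)) = \sum_(k < 4) cint (fun th => Q k (rpt 1 th)) 0 1.
  apply: eq_bigr => k _; apply: eq_cint => x _; rewrite /Q /rpt /= rc1 mul1r.
  by rewrite (addrC s) subrK.
rewrite I1; apply: (@nr_small _ _ _ 64) => eta eta0.
have sb : nr s < rho by lra.
have /cont_nr /(_ eta eta0)[d d0 hd] := differentiable_continuous (dg s sb).
pose e := Num.min 1 (d / (4 * r)).
have e0 : 0 < e by rewrite lt_min ltr01 divr_gt0 // mulr_gt0.
have e1 : e <= 1 by rewrite ge_min lexx.
have e2 : e * (2 * r) < d.
  have : e <= d / (4 * r) by rewrite ge_min lexx orbT.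
  rewrite ler_pdivlMr ?mulr_gt0 //; lra.
rewrite (cst_int e); last by rewrite e0.
apply: le_trans (nr_sum _ _ _) _.
have -> : 64 * eta = \sum_(k < 4) 2 * (eta / (r / 4) * (2 * r)) * (1 - 0).
  rewrite !big_ord_recr big_ord0 /=; field; exact: lt0r_neq0.
apply: ler_sum => k _; apply: cint_bound; rewrite ?ler01 //.
  have [_ hQ] := closed_ccont (cl k e e0).
  by apply: hQ; rewrite lexx.
move=> x xI; rewrite /Q nrM; have /andP[w1 w2] := side_nr k r0 xI.
apply: ler_pM; rewrite ?nr_ge0 ?side_vec_nr //.
rewrite nrM nrV; apply: ler_pM; rewrite ?nr_ge0 ?invr_ge0 ?nr_ge0 //.
  apply/ltW/hd; rewrite /= addrC addKr nrM nr_rc gtr0_norm //.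
  apply: le_lt_trans e2; rewrite ler_pM2l //; apply: le_trans (nrB _ _) _; lra.
have := pole_far hs w1 => h4; rewrite lef_pV2 // posrE; first by apply: lt_le_trans h4; rewrite divr_gt0.
by rewrite divr_gt0.
Qed.

Lemma kernel_annulus (s : C) (r : R) : 0 < r -> nr s < r / 4 -> diff_annulus r (fun w => (w - s)^-1).
Proof.
move=> r0 hs w /andP[w1 w2].
apply: isd_ex (isd_inv (isd_sub (isd_id w) (isd_cst s w)) _).
by apply: (@nr_neq0 _ (r / 4)); [rewrite divr_gt0|apply: pole_far].
Qed.

(** The pole is moved from 0 to [s] along t s; the form remains closed on each
    side, so that [goursat] applies as before. *)
Lemma oint_kernel (s : C) (r : R) : 0 < r -> nr s < r / 4 ->
  oint r (fun w => (w - s)^-1) = oint r (fun w => w^-1).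
Proof.
move=> r0 hs.
pose Q k (x : C * C) := (side r k x.2 - x.1 * s)^-1 * side_vec r k.
pose P k (x : C * C) := - s * (side r k x.2 - x.1 * s)^-1.
have cl k : closed_on (P k) (Q k) 0 1 0 1.
  move=> t th tI thI.
  have wz : side r k (rc th) - rc t * s != 0.
    have /andP[w1 w2] := side_nr k r0 thI; apply: (@nr_neq0 _ (r / 4)); first by rewrite divr_gt0.
    apply: pole_far => //; rewrite nrM nr_rc; case/andP: tI => t0 t1; rewrite ger0_norm //.
    apply: le_lt_trans hs; rewrite ler_piMl ?nr_ge0 //.
  pose x := rpt t th.
  have dw := isd_inv (isd_sub (isd_comp (isd_snd x) (isd_side r k x.2)) (isd_mul (isd_fst x) (isd_cst s x))) wz.
  have dP : is_diff x (P k) _ := isd_mul (isd_cst (- s) x) dw.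
  have dQ : is_diff x (Q k) _ := isd_mul dw (isd_cst (side_vec r k) x).
  have EP := isdE dP (0, 1); have EQ := isdE dQ (1, 0).
  split; [exact: isd_ex dP|exact: isd_ex dQ|].
  apply: (etrans EP); apply: (etrans _ (esym EQ)).
  cbn [fst snd]; generalize (side r k x.2 - x.1 * s) (side r k x.2) x.1 (side_vec r k) => a1 a2 a3 a4; ring.
have E (k : 'I_4) : cint (fun th => Q k (rpt 1 th)) 0 1 - cint (fun th => Q k (rpt 0 th)) 0 1 =
    cint (fun t => P k (rpt t 1)) 0 1 - cint (fun t => P k (rpt t 0)) 0 1.
  have := goursat ler01 ler01 (cl k); rewrite /bdry => /eqP.
  by rewrite addr_eq0 subr_eq => /eqP ->; rewrite addrC.
have I1 : oint r (fun w => (w - s)^-1) = \sum_(k < 4) cint (fun th => Q k (rpt 1 th)) 0 1.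
  by apply: eq_bigr => k _; apply: eq_cint => x _; rewrite /Q /rpt /= rc1 mul1r.
have I0 : oint r (fun w => w^-1) = \sum_(k < 4) cint (fun th => Q k (rpt 0 th)) 0 1.
  by apply: eq_bigr => k _; apply: eq_cint => x _; rewrite /Q /rpt /= rc0 mul0r subr0.
apply/eqP; rewrite -subr_eq0 I1 I0 -sumrB; apply/eqP.
rewrite (eq_bigr _ (fun k _ => E k)).
pose f (w : C) := cint (fun t => - s * (w - rc t * s)^-1) 0 1.
exact: (sum_corners f r).
Qed.

(** This number is 2 i pi; a lower bound of its norm is all that dividing by it
    requires. *)
Definition oint_inv : C := oint 1 (fun w => w^-1).

Lemma oint_inv_radius (r : R) : 0 < r -> oint r (fun w => w^-1) = oint_inv.
Proof.
move=> r0; apply: eq_bigr => k _; apply: eq_cint => x xI.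
have /andP[b1 _] := chord_nr xI.
have b0 : 1 + rc x * (ci - 1) != 0 by apply: nr_neq0 b1; rewrite divr_gt0.
have c0 : ci ^+ k != 0 by rewrite expf_neq0 // -nr_gt0 nr_ci.
have rz : rc r != 0 by rewrite -nr_gt0 nr_rc normr_gt0 gt_eqF.
by rewrite /side /side_vec rc1; field; rewrite b0 c0 rz.
Qed.

(** The four sides contribute equally, and on each the imaginary part of the
    integrand is at least 1. *)
Lemma oint_inv_ge4 : 4 <= nr oint_inv.
Proof.
pose h (x : R) : C := (ci - 1) / (1 + rc x * (ci - 1)).
have hc : ccont h 0 1.
  apply: (@ccont_diff _ (fun x => (ci - 1) / (1 + x * (ci - 1)))) => x xI.
  have /andP[b1 _] := chord_nr xI.
  have b0 : 1 + rc x * (ci - 1) != 0 by apply: nr_neq0 b1; rewrite divr_gt0.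
  exact: isd_ex (isd_mul (isd_cst (ci - 1) (rc x : C)) (isd_inv (isd_add (isd_cst (1 : C) (rc x : C))
   (isd_mul (isd_id (rc x : C)) (isd_cst (ci - 1) (rc x : C)))) b0)).
have -> : oint_inv = 4 * cint h 0 1.
  rewrite /oint_inv /oint (eq_bigr (fun=> cint h 0 1)).
    by rewrite sumr_const card_ord mulr_natl.
  move=> k _; apply: eq_cint => x xI; have /andP[b1 _] := chord_nr xI.
  have b0 : 1 + rc x * (ci - 1) != 0 by apply: nr_neq0 b1; rewrite divr_gt0.
  have c0 : ci ^+ k != 0 by rewrite expf_neq0 // -nr_gt0 nr_ci.
  by rewrite /side /side_vec rc1 /h; field; rewrite b0 c0.
rewrite nrM -rc_nat nr_rc ger0_norm // ler_peMr //.
apply: le_trans (nr_Im _); apply: le_trans (ler_norm _).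
have := @Rint_lower _ (fun x => complex.Im (h x)) 0 1 1 ler01 (ccont_Im hc).
rewrite subr0 mulr1; apply => x xI; case/andP: (xI) => x0 x1.
pose n := (1 - x) ^+ 2 + x ^+ 2.
have n0 : 0 < n by rewrite /n; nra.
have -> : h x = Complex (- (1 - x) + x) 1 / rc n.
  have /andP[b1 _] := chord_nr xI.
  have b0 : 1 + rc x * (ci - 1) != 0 by apply: nr_neq0 b1; rewrite divr_gt0.
  have nz : rc n != 0 by rewrite -nr_gt0 nr_rc normr_gt0 gt_eqF.
  apply/eqP; rewrite /h eqr_div //; apply/eqP; apply: Cext;
    rewrite ?(cReM, cImM, cReD, cImD, cReB, cImB) /n /=; ring.
rewrite -rcV cImM /= mulr0 add0r mul1r invf_ge1 // /n; nra.
Qed.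

Lemma cauchy_formula (g : C -> C) (s : C) (r rho : R) : 0 < r -> r < rho -> nr s < r / 4 ->
  (forall z, nr z < rho -> differentiable g z) ->
  oint r (fun w => g w / (w - s)) = oint_inv * g s.
Proof.
move=> r0 rr hs dg.
have hk := kernel_annulus r0 hs.
have dgs : diff_annulus r g by move=> w /andP[_ w2]; apply: dg; lra.
have h1 : diff_annulus r (fun w => (g w - g s) / (w - s)).
  move=> w wI; exact: isd_ex (isd_mul (isd_sub (isd_of (dgs w wI)) (isd_cst (g s) w)) (isd_of (hk w wI))).
have h2 : diff_annulus r (fun w => g s * (w - s)^-1).
  move=> w wI; exact: isd_ex (isd_mul (isd_cst (g s) w) (isd_of (hk w wI))).
rewrite (_ : oint r _ = oint r (fun w => (g w - g s) / (w - s) + g s * (w - s)^-1)); last first.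
  by apply: eq_oint => // w _; ring.
by rewrite ointD // (oint_diff_quotient r0 rr hs dg) add0r ointZ // oint_kernel // oint_inv_radius // mulrC.
Qed.

(** The maximum principle up to a constant, read off Cauchy's formula. *)
Lemma maximum_weak (g : C -> C) (s : C) (r rho M : R) : 0 < r -> r < rho -> nr s < r / 4 ->
  (forall z, nr z < rho -> differentiable g z) ->
  (forall w, r / 2 <= nr w <= r -> nr (g w) <= M) -> nr (g s) <= 16 * M.
Proof.
move=> r0 rr hs dg hM.
have K4 := oint_inv_ge4; have f := cauchy_formula r0 rr hs dg.
have hk := kernel_annulus r0 hs.
have dgs : diff_annulus r g by move=> w /andP[_ w2]; apply: dg; lra.
have h1 : diff_annulus r (fun w => g w / (w - s)).
  move=> w wI; exact: isd_ex (isd_mul (isd_of (dgs w wI)) (isd_of (hk w wI))).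
have B := @oint_bound r r0 _ (M / (r / 4)) h1.
have : nr (oint_inv * g s) <= 16 * r * (M / (r / 4)).
  rewrite -f; apply: B => w wI; rewrite nrM nrV; apply: ler_pM; rewrite ?nr_ge0 ?invr_ge0 ?nr_ge0 //; first exact: hM.
  case/andP: (wI) => w1 w2; have h4 := pole_far hs w1; rewrite lef_pV2 // posrE; first by apply: lt_le_trans h4; rewrite divr_gt0.
  by rewrite divr_gt0.
have -> : 16 * r * (M / (r / 4)) = 64 * M by field; exact: lt0r_neq0.
rewrite nrM => H; have : 4 * nr (g s) <= nr oint_inv * nr (g s) by rewrite ler_wpM2r ?nr_ge0.
lra.
Qed.

(** By Cauchy's formula the quadratic remainder is, up to the factor 2 i pi, the
    integral of g(w) s^2 / (w^2 (w - s)).  The candidate for the derivative is, up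
    to the same factor, the integral of g(w) / w^2, and the remainder estimate shows
    that it is the derivative. *)
Lemma taylor_disc (g : C -> C) (rho M : R) : 0 < rho ->
  (forall z, nr z < rho -> differentiable g z) ->
  (forall z, nr z < rho -> nr (g z) <= M) ->
  nr ('d g 0 1) <= 32 * M / rho /\
  forall s, nr s < rho / 8 -> nr (g s - g 0 - s * 'd g 0 1) <= 256 * M / rho ^+ 2 * nr s ^+ 2.
Proof.
move=> rho0 dg hM; pose r := rho / 2.
have r0 : 0 < r by rewrite divr_gt0.
have rr : r < rho by rewrite /r; lra.
have M0 : 0 <= M by apply: le_trans (hM 0 _); rewrite ?nr_ge0 ?nr0.
have dgs : diff_annulus r g by move=> w /andP[_ w2]; apply: dg; lra.
have wz (w : C) : r / 2 <= nr w <= r -> w != 0.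
  by move=> /andP[w1 _]; apply: nr_neq0 w1; rewrite divr_gt0.
have hk2 : diff_annulus r (fun w => g w / w ^+ 2).
  move=> w wI; have w2 : w * w != 0 by rewrite mulf_neq0 ?wz.
  exact: isd_ex (isd_mul (isd_of (dgs w wI)) (isd_inv (isd_mul (isd_id w) (isd_id w)) w2)).
have K4 := oint_inv_ge4.
have Kz : oint_inv != 0 by apply: nr_neq0 K4.
pose c := oint_inv^-1 * oint r (fun w => g w / w ^+ 2).
have Kinv : nr oint_inv^-1 <= 4^-1.
  by rewrite nrV lef_pV2 // posrE //; apply: lt_le_trans K4.
(* 1 / (w - s) - 1 / w - s / w^2 = s^2 / (w^2 (w - s)). *)
have rem s : nr s < rho / 8 -> nr (g s - g 0 - s * c) <= 256 * M / rho ^+ 2 * nr s ^+ 2.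
  move=> hs; have hs' : nr s < r / 4 by rewrite /r; lra.
  have h0 : nr (0 : C) < r / 4 by rewrite nr0 divr_gt0.
  have hk := kernel_annulus r0 hs'.
  have hks : diff_annulus r (fun w => g w / (w - s)).
    move=> w wI; exact: isd_ex (isd_mul (isd_of (dgs w wI)) (isd_of (hk w wI))).
  have hk0 : diff_annulus r (fun w => - 1 * (g w / (w - 0))).
    move=> w wI; exact: isd_ex (isd_mul (isd_cst (-1 : C) w) (isd_mul (isd_of (dgs w wI)) (isd_of (kernel_annulus r0 h0 wI)))).
  have hks2 : diff_annulus r (fun w => - s * (g w / w ^+ 2)).
    move=> w wI; exact: isd_ex (isd_mul (isd_cst (-s) w) (isd_of (hk2 w wI))).
  have hk0' : diff_annulus r (fun w => g w / (w - 0)).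
    move=> w wI; exact: isd_ex (isd_mul (isd_of (dgs w wI)) (isd_of (kernel_annulus r0 h0 wI))).
  have hF : diff_annulus r (fun w => (g w / (w - s) + - 1 * (g w / (w - 0))) + - s * (g w / w ^+ 2)).
    move=> w wI; exact: isd_ex (isd_add (isd_add (isd_of (hks w wI)) (isd_of (hk0 w wI))) (isd_of (hks2 w wI))).
  have hF1 : diff_annulus r (fun w => (g w / (w - s) + - 1 * (g w / (w - 0)))).
    move=> w wI; exact: isd_ex (isd_add (isd_of (hks w wI)) (isd_of (hk0 w wI))).
  have -> : g s - g 0 - s * c = oint_inv^-1 * oint r (fun w => (g w / (w - s) + - 1 * (g w / (w - 0))) + - s * (g w / w ^+ 2)).
    rewrite ointD // ointD // ointZ // ointZ // (cauchy_formula r0 rr hs' dg) (cauchy_formula r0 rr h0 dg).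
    by rewrite /c; field.
  rewrite nrM; apply: (@le_trans _ _ (4^-1 * (16 * r * (M * nr s ^+ 2 / (r ^+ 3 / 16))))); last first.
    rewrite le_eqVlt; apply/orP; left; apply/eqP; rewrite /r; field; exact: lt0r_neq0.
  apply: ler_pM; rewrite ?nr_ge0 //; apply: oint_bound => // w wI.
  have w0 := wz w wI; case/andP: (wI) => w1 w2; have h4 := pole_far hs' w1.
  have ws : w - s != 0 by apply: nr_neq0 h4; rewrite divr_gt0.
  have -> : g w / (w - s) + -1 * (g w / (w - 0)) + - s * (g w / w ^+ 2) =
     g w * s ^+ 2 / (w ^+ 2 * (w - s)) by rewrite subr0; field; rewrite w0 ws.
  rewrite nrM nrV 2!nrM !nrX; apply: ler_pM.
  - by rewrite mulr_ge0 ?nr_ge0 ?exprn_ge0 ?nr_ge0.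
  - by rewrite invr_ge0 mulr_ge0 ?nr_ge0 ?exprn_ge0 ?nr_ge0.
  - by rewrite ler_wpM2r ?exprn_ge0 ?nr_ge0 // hM //; lra.
  have q : r ^+ 3 / 16 <= nr w ^+ 2 * nr (w - s).
    have -> : r ^+ 3 / 16 = (r / 2) ^+ 2 * (r / 4) by field.
    have r2 : 0 <= r / 2 by lra.
    have r4 : 0 <= r / 4 by lra.
    apply: ler_pM => //; first exact: exprn_ge0.
    by rewrite ler_sqr ?nnegrE ?nr_ge0.
  have p : 0 < r ^+ 3 / 16 by rewrite divr_gt0 ?exprn_gt0.
  by rewrite lef_pV2 ?posrE //; apply: lt_le_trans q.
have dc : is_diff (0 : C) g (fun h => h * c).
  apply: (is_diff_of_eps_fun (k := nr c)).
  - by move=> a u v; rewrite mulrDl -scalerAl.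
  - by move=> v; rewrite nrM mulrC.
  move=> e e0; pose B := 256 * M / rho ^+ 2.
  have B0 : 0 <= B by apply: divr_ge0; [apply: mulr_ge0 (ler0n _ _) M0|exact: sqr_ge0].
  exists (Num.min (rho / 8) (e / (B + 1))).
    by rewrite lt_min !divr_gt0 // ltr_wpDl.
  move=> h; rewrite lt_min => /andP[h1 h2]; rewrite add0r.
  apply: le_trans (rem h h1) _; rewrite -/B expr2 mulrA ler_wpM2r ?nr_ge0 //.
  move: h2; rewrite ltr_pdivlMr ?ltr_wpDl // => h2; apply: le_trans (ltW h2).
  by rewrite mulrC ler_wpM2l ?nr_ge0 // lerDl.
have -> : 'd g 0 1 = c by rewrite (isdE dc) mul1r.
split; last exact: rem.
rewrite /c nrM; apply: (@le_trans _ _ (4^-1 * (16 * r * (M / (r ^+ 2 / 4))))); last first.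
  rewrite le_eqVlt; apply/orP; left; apply/eqP; rewrite /r; field; exact: lt0r_neq0.
apply: ler_pM; rewrite ?nr_ge0 //; apply: oint_bound => // w wI.
case/andP: (wI) => w1 w2.
rewrite nrM nrV nrX; apply: ler_pM; rewrite ?nr_ge0 ?invr_ge0 ?exprn_ge0 ?nr_ge0 //.
  by apply: hM; lra.
have q : r ^+ 2 / 4 <= nr w ^+ 2.
  have -> : r ^+ 2 / 4 = (r / 2) ^+ 2 by field.
  have r2 : 0 <= r / 2 by lra.
  by rewrite ler_sqr ?nnegrE ?nr_ge0.
have p : 0 < r ^+ 2 / 4 by rewrite divr_gt0 ?exprn_gt0.
by rewrite lef_pV2 ?posrE //; apply: lt_le_trans q.
Qed.

End Cauchy.

(** * Taylor estimates, uniform limits and second derivatives *)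

Section Several.
Variable R : realType.
Local Notation C := (Cplx R).
Implicit Types E F : normedModType C.

Lemma le_eps (x y A : R) : (forall e, 0 < e -> x <= y + A * e) -> x <= y.
Proof.
move=> h; apply/ler_addgt0Pr => e e0.
have A1 : 0 < `|A| + 1 by rewrite ltr_wpDl.
apply: le_trans (h (e / (`|A| + 1)) _) _; first by rewrite divr_gt0.
have -> : A * (e / (`|A| + 1)) = A / (`|A| + 1) * e by ring.
rewrite lerD2l; apply: ler_piMl; first exact: ltW.
rewrite ler_pdivrMr // mul1r.
by apply: le_trans (ler_norm A) _; rewrite lerDl ler01.
Qed.

Lemma nr_eq E (x y : E) (A : R) : (forall e, 0 < e -> nr (x - y) <= A * e) -> x = y.
Proof. by move=> /nr_small; exact: subr0_eq. Qed.

(** On the complex line through [p] and [p + h] this is [taylor_disc]. *)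
Lemma taylor E (f : E -> C) p (r M : R) : 0 < r ->
  (forall z, nr (z - p) < r -> differentiable f z) ->
  (forall z, nr (z - p) < r -> nr (f z) <= M) ->
  forall h, nr ('d f p h) <= 32 * M / r * nr h /\
   (nr h < r / 8 -> nr (f (p + h) - f p - 'd f p h) <= 256 * M / r ^+ 2 * nr h ^+ 2).
Proof.
move=> r0 df hM h; have [->|hz] := eqVneq h 0.
  have -> : 'd f p 0 = 0 by exact: linear0.
  have n0 : nr (0 : E) = 0 := nr0 E; have m0 : nr (0 : C) = 0 := nr0 C.
  have -> : p + 0 = p by exact: addr0.
  rewrite subrr.
  rewrite subr0.
  rewrite m0.
  rewrite n0.
  split; first by rewrite mulr0.
  by move=> _; rewrite expr0n mulr0.
have h0 : 0 < nr h by rewrite nr_gt0.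
pose g (s : C) := f (p + s *: h).
have inb (s : C) : nr s < r / nr h -> nr (p + s *: h - p) < r.
  by rewrite ltr_pdivlMr // addrC addKr nrZ'.
have dg (s : C) : nr s < r / nr h -> is_diff s g (fun k => 'd f (p + s *: h) (k *: h)).
  by move=> /inb /df /isd_of d; have := isd_comp (isd_line p h s) d.
have [|||t1 t2] := @taylor_disc _ g (r / nr h) M; first by rewrite divr_gt0.
- by move=> z /dg; exact: isd_ex.
- by move=> z /inb /hM.
have E0 : 'd g 0 1 = 'd f p h.
  by rewrite (isdE (dg 0 _)) ?nr0 ?divr_gt0 // scale0r addr0 scale1r.
split.
  by rewrite -E0; apply: le_trans t1 _; rewrite invfM invrK mulrA.
move=> h8; have := t2 1; rewrite nr1 E0 mul1r /g scale0r scale1r addr0 => H.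
apply: le_trans (H _) _; first by rewrite mulrAC ltr_pdivlMr // mul1r.
by rewrite expr1n mulr1 expr_div_n invfM invrK mulrA.
Qed.

(** Completeness for families indexed by an arbitrary type, [e i] being the
    precision of [u i]; the limit is the supremum of lower estimates. *)
Lemma C_complete (I : Type) (P : set I) (u : I -> C) (e : I -> R) : P !=set0 ->
  (forall i j, P i -> P j -> nr (u i - u j) <= e i + e j) ->
  exists l, forall i, P i -> nr (u i - l) <= 2 * e i.
Proof.
move=> [i0 Pi0] h.
have key (p : C -> R) : (forall z w, `|p z - p w| <= nr (z - w)) ->
    exists l, forall i, P i -> `|p (u i) - l| <= e i.
  move=> hp; have hij i j : P i -> P j -> p (u i) - e i <= p (u j) + e j.
    move=> Pi Pj; have := le_trans (hp (u i) (u j)) (h i j Pi Pj).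
    by rewrite ler_norml => /andP[_]; lra.
  exists (sup [set p (u i) - e i | i in P]) => i Pi.
  rewrite ler_norml; apply/andP; split.
    rewrite lerBrDr -lerBrDl opprK addrC; apply: ge_sup; first by exists (p (u i0) - e i0), i0.
    by move=> _ [j Pj <-]; rewrite addrC; apply: hij.
  rewrite lerBlDl -lerBlDr; apply: ub_le_sup; last by exists i.
  by exists (p (u i0) + e i0) => _ [j Pj <-]; apply: hij.
have [a ha] := key (@complex.Re R) (fun z w => eq_ind _ (fun x => `|x| <= _) (nr_Re (z - w)) _ (cReB z w)).
have [b hb] := key (@complex.Im R) (fun z w => eq_ind _ (fun x => `|x| <= _) (nr_Im (z - w)) _ (cImB z w)).
exists (Complex a b) => i Pi; apply: le_trans (nr_ReIm _) _.
by rewrite cReB cImB /=; have := ha i Pi; have := hb i Pi; lra.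
Qed.

Lemma diff_bounded E F (f : E -> F) p (r : R) : 0 < r ->
  (forall z, nr (z - p) < r -> differentiable f z) ->
  exists r' M : R, [/\ 0 < r', r' <= r, 0 <= M & forall z, nr (z - p) < r' -> nr (f z) <= M].
Proof.
move=> r0 df.
have /cont_nr /(_ 1 ltr01)[d d0 hd] : {for p, continuous f}.
  by apply: differentiable_continuous; apply: df; rewrite subrr nr0.
exists (Num.min r d), (nr (f p) + 1); split.
- by rewrite lt_min r0.
- by rewrite ge_min lexx.
- by rewrite addr_ge0 ?nr_ge0.
move=> z; rewrite lt_min => /andP[_ /hd h].
by rewrite -(subrK (f p) (f z)) addrC; apply: le_trans (nrD _ _) _; rewrite lerD2l ltW.
Qed.

(** By [taylor] the differentials at [p] of the approximations converge too, and
    the quadratic remainder estimate, uniform over the approximations, passes to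
    the limit. *)
Lemma weierstrass E (g : E -> C) p (r : R) : 0 < r ->
  (forall e : R, 0 < e -> exists2 f : E -> C, (forall z, nr (z - p) < r -> differentiable f z) &
     forall z, nr (z - p) < r -> nr (f z - g z) <= e) ->
  differentiable g p.
Proof.
move=> r0 H.
have H' (e : R) : exists f : E -> C, 0 < e ->
    (forall z, nr (z - p) < r -> differentiable f z) /\
    (forall z, nr (z - p) < r -> nr (f z - g z) <= e).
  have [e0|e0] := ltP 0 e; last by exists g.
  by have [f f1 f2] := H e e0; exists f.
have [f hf] := choice H'.
have [r' [M0 [r'0 r'r M00 hM0]]] := diff_bounded r0 (hf 1 ltr01).1.
have inr z : nr (z - p) < r' -> nr (z - p) < r by move=> h; apply: lt_le_trans r'r.
pose M := M0 + 2.
have gM z : nr (z - p) < r' -> nr (g z) <= M0 + 1.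
  move=> zr; rewrite -(subKr (f 1 z) (g z)); apply: le_trans (nrB _ _) _.
  by apply: lerD; [exact: hM0|exact: (hf 1 ltr01).2 (inr _ zr)].
have fM e z : 0 < e -> e <= 1 -> nr (z - p) < r' -> nr (f e z) <= M.
  move=> e0 e1 zr; rewrite -(subrK (g z) (f e z)); apply: le_trans (nrD _ _) _.
  have := (hf e e0).2 z (inr _ zr); have := gM z zr; rewrite /M; lra.
(* [f e] approximates [g] within [e]. *)
pose L e h := 'd (f e) p h.
have dL e e' h : 0 < e -> 0 < e' -> nr (L e h - L e' h) <= 32 * e / r' * nr h + 32 * e' / r' * nr h.
  move=> e0 e'0.
  have pr : nr (p - p) < r by rewrite subrr nr0.
  have := @taylor _ (fun z => f e z - f e' z) p r' (e + e') r'0.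
  have ds z : nr (z - p) < r' -> is_diff z (fun z => f e z - f e' z) (fun h => 'd (f e) z h - 'd (f e') z h).
    by move=> /inr zr; exact: isd_sub (isd_of ((hf e e0).1 z zr)) (isd_of ((hf e' e'0).1 z zr)).
  move=> T; have [||+ _] := T _ _ h.
  - by move=> z /ds; exact: isd_ex.
  - move=> z /inr zr; apply: le_trans (nr_tri _ (g z) _) _; apply: lerD; first exact: (hf e e0).2.
    by rewrite nrBC; exact: (hf e' e'0).2.
  - have pr' : nr (p - p) < r' by rewrite subrr nr0.
    rewrite (isdE (ds p pr') h) => h1; apply: le_trans h1 _.
    by rewrite -mulrDl -!mulrDl mulrDr.
have lex (h : E) : exists l : C, forall e, 0 < e -> nr (L e h - l) <= 2 * (32 * e / r' * nr h).
  have [|e e' e0 e'0|l hl] := @C_complete R [set e : R | 0 < e] (fun e => L e h) (fun e => 32 * e / r' * nr h).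
  - by exists 1 => /=.
  - exact: dL.
  - by exists l => e e0; exact: hl.
have [l hl] := choice lex.
have linl : linear l.
  move=> a u v; pose B (h : E) := 64 / r' * nr h.
  apply: (@nr_eq _ _ _ (B (a *: u + v) + nr a * B u + B v)) => e e0.
  have -> : l (a *: u + v) - (a *: l u + l v) =
     - (L e (a *: u + v) - l (a *: u + v)) + a *: (L e u - l u) + (L e v - l v).
    have alg (X A B' P Q : C) : X - (A + B') = - (P + Q - X) + (P - A) + (Q - B') by ring.
    have EL : L e (a *: u + v) = a *: L e u + L e v by exact: linearP.
    by rewrite EL (scalerBr a (L e u)); exact: alg.
  rewrite !mulrDl; apply: le_trans (nrD _ _) _; apply: lerD; last first.
    by apply: le_trans (hl v e e0) _; rewrite /B le_eqVlt; apply/orP; left; apply/eqP; ring.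
  apply: le_trans (nrD _ _) _; apply: lerD.
    by rewrite nrN; apply: le_trans (hl _ e e0) _; rewrite /B le_eqVlt; apply/orP; left; apply/eqP; ring.
  rewrite nrZ' -mulrA ler_wpM2l ?nr_ge0 //.
  by apply: le_trans (hl u e e0) _; rewrite /B le_eqVlt; apply/orP; left; apply/eqP; ring.
have bl v : nr (l v) <= (32 * M / r' + 2 * (32 / r')) * nr v.
  rewrite -(subKr (L 1 v) (l v)); apply: le_trans (nrB _ _) _; rewrite mulrDl; apply: lerD.
    apply: (proj1 (@taylor _ (f 1) p r' M r'0 _ _ v)).
      by move=> z /inr; exact: (hf 1 ltr01).1.
    by move=> z; apply: fM.
  by apply: le_trans (hl v 1 ltr01) _; rewrite mulr1 !mulrA.
apply: (isd_ex (df := l)); apply: (is_diff_of_eps_fun linl bl) => e e0.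
pose K := 256 * M / r' ^+ 2.
have K0 : 0 <= K.
  by apply: divr_ge0; [apply: mulr_ge0 (ler0n _ _) _; rewrite /M addr_ge0|exact: sqr_ge0].
exists (Num.min (r' / 8) (e / (K + 1))).
  by rewrite lt_min !divr_gt0 // ltr_wpDl.
move=> h; rewrite lt_min => /andP[h8 hK].
apply: (@le_trans _ _ (K * nr h ^+ 2)); last first.
  rewrite expr2 mulrA ler_wpM2r ?nr_ge0 //.
  move: hK; rewrite ltr_pdivlMr ?ltr_wpDl // => h2; apply: le_trans (ltW h2).
  by rewrite mulrC ler_wpM2l ?nr_ge0 // lerDl.
apply: (@le_eps _ _ (2 + 2 * (32 / r' * nr h))) => a a0.
pose b := Num.min a 1.
have b0 : 0 < b by rewrite lt_min a0 ltr01.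
have ba : b <= a by rewrite ge_min lexx.
have b1 : b <= 1 by rewrite ge_min lexx orbT.
have hr' : nr (p + h - p) < r' by rewrite addrC addKr; lra.
have pr' : nr (p - p) < r' by rewrite subrr nr0.
have T := (proj2 (@taylor _ (f b) p r' M r'0 (fun z zr => (hf b b0).1 z (inr _ zr)) (fun z => fM b z b0 b1) h)) h8.
have -> : g (p + h) - g p - l h = (f b (p + h) - f b p - 'd (f b) p h)
   - (f b (p + h) - g (p + h)) + (f b p - g p) + (L b h - l h) by rewrite /L; ring.
have A1 := (hf b b0).2 _ (inr _ hr'); have A2 := (hf b b0).2 _ (inr _ pr').
have A3 := hl h b b0.
apply: le_trans (nrD _ _) _.
have A4 := nrD (f b (p + h) - f b p - 'd (f b) p h - (f b (p + h) - g (p + h))) (f b p - g p).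
have A5 := nrB (f b (p + h) - f b p - 'd (f b) p h) (f b (p + h) - g (p + h)).
have q : 32 * b / r' * nr h <= 32 / r' * nr h * a.
  rewrite [32 * b / r']mulrAC -!mulrA [b * _]mulrC !mulrA ler_wpM2l //.
  by rewrite mulr_ge0 ?nr_ge0 // divr_ge0 // ltW.
rewrite -/K in T; nra.
Qed.

Lemma quot_unif E (f : E -> C) z v (r M s : R) : 0 < r -> 0 < s ->
  (forall w, nr (w - z) < r -> differentiable f w) ->
  (forall w, nr (w - z) < r -> nr (f w) <= M) -> s * nr v < r / 8 ->
  nr ((rc s)^-1 * (f (z + rc s *: v) - f z) - 'd f z v) <= 256 * M / r ^+ 2 * nr v ^+ 2 * s.
Proof.
move=> r0 s0 df hM sv.
have sz : rc s != 0 by rewrite -nr_gt0 nr_rc normr_gt0 gt_eqF.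
have nsv : nr (rc s *: v) = s * nr v by rewrite nrZ' nr_rc gtr0_norm.
have [_ T] := taylor r0 df hM (rc s *: v); rewrite nsv in T; have {}T := T sv.
have -> : (rc s)^-1 * (f (z + rc s *: v) - f z) - 'd f z v =
   (rc s)^-1 * (f (z + rc s *: v) - f z - 'd f z (rc s *: v)).
  have EL : 'd f z (rc s *: v) = rc s * 'd f z v by exact: linearZ.
  by rewrite EL [RHS]mulrBr mulKf.
rewrite nrM nrV nr_rc gtr0_norm // ler_pdivrMl //; apply: le_trans T _.
by rewrite le_eqVlt; apply/orP; left; apply/eqP; ring.
Qed.

(** The difference quotients (f(z + s v) - f(z)) / s are differentiable in (z, v)
    and converge uniformly to the tangent map, so that [weierstrass] applies.  This
    is how a complex differentiable function gets a second derivative. *)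
Lemma tangent_diff E (f : E -> C) (z0 v0 : E) :
  (\forall z \near z0, differentiable f z) ->
  differentiable (fun x : E * E => 'd f (x.1 : E) x.2) ((z0, v0) : E * E).
Proof.
move=> /near_nr[r1 r10 df1].
have [r [M [r0 rr M0 hM]]] := diff_bounded r10 df1.
have df z : nr (z - z0) < r -> differentiable f z by move=> h; apply: df1; apply: lt_le_trans rr.
pose V := nr v0 + r.
have V0 : 0 < V by rewrite ltr_wpDl ?nr_ge0.
pose K := 256 * M / (r / 4) ^+ 2 * V ^+ 2.
have K0 : 0 <= K.
  apply: mulr_ge0; last exact: sqr_ge0.
  by apply: divr_ge0; [apply: mulr_ge0 (ler0n _ _) _|exact: sqr_ge0].
apply: (@weierstrass _ _ _ (r / 4)); first by rewrite divr_gt0.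
move=> e e0; pose s := Num.min (e / (K + 1)) (r / 4 / (8 * V) / 2).
have s0 : 0 < s by rewrite lt_min !divr_gt0 // ?mulr_gt0 // ltr_wpDl.
have s1 : K * s <= e.
  have : s <= e / (K + 1) by rewrite ge_min lexx.
  rewrite ler_pdivlMr ?ltr_wpDl // => h; apply: le_trans h.
  by rewrite mulrC; apply: ler_wpM2l; [exact: ltW|rewrite lerDl].
have s2 : s * V < r / 4 / 8.
  have : s <= r / 4 / (8 * V) / 2 by rewrite ge_min lexx orbT.
  have -> : r / 4 / (8 * V) / 2 = r / 4 / 8 / 2 / V by field; exact: lt0r_neq0.
  rewrite ler_pdivlMr // => h; apply: le_lt_trans h _; lra.
have xb (x : E * E) : nr (x - (z0, v0)) < r / 4 -> nr (x.1 - z0) < r / 4 /\ nr x.2 < V.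
  move=> h; have h1 := le_lt_trans (nr_fst _) h; have h2 := le_lt_trans (nr_snd _) h.
  split => //; rewrite -(subrK v0 x.2) addrC; apply: le_lt_trans (nrD _ _) _.
  by rewrite /V ltrD2l; apply: lt_trans h2 _; lra.
exists (fun x => (rc s)^-1 * (f (x.1 + rc s *: x.2) - f x.1)).
  move=> x /xb [x1 x2].
  have sx : nr (rc s *: x.2) < r / 4 / 8.
    rewrite nrZ' nr_rc gtr0_norm //; apply: le_lt_trans s2; rewrite ler_wpM2l ?ltW //.
  have d1 : differentiable f (x.1 + rc s *: x.2).
    apply: df; rewrite addrAC; apply: le_lt_trans (nrD _ _) _; lra.
  have d2 : differentiable f x.1 by apply: df; lra.
  have i1 := isd_add (isd_fst x) (isd_scalek (rc s) (isd_snd x)).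
  exact: isd_ex (isd_mul (isd_cst (rc s)^-1 x) (isd_sub (isd_comp i1 (isd_of d1)) (isd_comp (isd_fst x) (isd_of d2)))).
move=> x /xb [x1 x2].
have inr w : nr (w - x.1) < r / 4 -> nr (w - z0) < r.
  by move=> h; apply: le_lt_trans (nr_tri _ x.1 _) _; lra.
have r4 : 0 < r / 4 by rewrite divr_gt0.
apply: le_trans (quot_unif r4 s0 (fun w h => df w (inr w h)) (fun w h => hM w (inr w h)) _) _.
  by apply: le_lt_trans s2; rewrite ler_wpM2l ?ltW.
apply: le_trans s1; apply: ler_wpM2r; first exact: ltW.
rewrite /K; apply: ler_wpM2l.
  by apply: divr_ge0; [apply: mulr_ge0 (ler0n _ _) _|exact: sqr_ge0].
by rewrite ler_sqr ?nnegrE ?nr_ge0 ?(ltW V0) // ltW.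
Qed.

Lemma near_diff_dir E (f : E -> C) (z0 v : E) :
  (\forall z \near z0, differentiable f z) ->
  differentiable (fun z : E => 'd f z v) z0.
Proof.
move=> df; exact: isd_ex (isd_comp (isd_pair (isd_id z0) (isd_cst v z0)) (isd_of (tangent_diff v df))).
Qed.

(** Differentiate the difference quotient of [f] along [v] in the direction [w].  It
    is close to the left-hand side, because the quotients converge uniformly and
    [taylor] bounds differentials by values; and it is the difference quotient along
    [v] of the derivative along [w], close to the right-hand side. *)
Lemma schwarz E (f : E -> C) (z0 v w : E) :
  (\forall z \near z0, differentiable f z) ->
  'd (fun z => 'd f z v) z0 w = 'd (fun z => 'd f z w) z0 v.
Proof.
move=> dfn; have dw := near_diff_dir w dfn.
move: (dfn) => /near_nr[r1 r10 df1].
have [r [M [r0 rr M0 hM]]] := diff_bounded r10 df1.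
have df z : nr (z - z0) < r -> differentiable f z by move=> h; apply: df1; apply: lt_le_trans rr.
have nr' z : nr (z - z0) < r / 4 -> \forall w \near z, differentiable f w.
  move=> zr; apply/near_nr; exists (r / 4); first by rewrite divr_gt0.
  by move=> y yz; apply: df; apply: le_lt_trans (nr_tri _ z _) _; lra.
have r4 : 0 < r / 4 by rewrite divr_gt0.
pose K := 256 * M / (r / 4) ^+ 2 * nr v ^+ 2.
have K0 : 0 <= K.
  apply: mulr_ge0; last exact: sqr_ge0.
  by apply: divr_ge0; [apply: mulr_ge0 (ler0n _ _) _|exact: sqr_ge0].
apply: (@nr_eq _ _ _ (32 * K / (r / 4) * nr w + nr v)) => e e0.
have [d d0 hd] := diff_eps dw e0.
pose V := nr v + 1.
have V0 : 0 < V by rewrite ltr_wpDl ?nr_ge0.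
pose s := Num.min e (Num.min (r / 4 / 8 / V / 2) (d / V / 2)).
have s0 : 0 < s by rewrite !lt_min e0 !divr_gt0.
have se : s <= e by rewrite ge_min lexx.
have vV : nr v <= V by rewrite lerDl ler01.
have s2 : s * nr v < r / 4 / 8.
  have : s <= r / 4 / 8 / V / 2 by rewrite !ge_min lexx orbT.
  have -> : r / 4 / 8 / V / 2 = r / 4 / 8 / 2 / V by field; exact: lt0r_neq0.
  rewrite ler_pdivlMr // => h.
  apply: (@le_lt_trans _ _ (s * V)); first by apply: ler_wpM2l vV; exact: ltW.
  by apply: le_lt_trans h _; lra.
have s3 : s * nr v < d.
  have : s <= d / V / 2 by rewrite !ge_min lexx !orbT.
  have -> : d / V / 2 = d / 2 / V by field; exact: lt0r_neq0.
  rewrite ler_pdivlMr // => h.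
  apply: (@le_lt_trans _ _ (s * V)); first by apply: ler_wpM2l vV; exact: ltW.
  by apply: le_lt_trans h _; lra.
have sz : rc s != 0 by rewrite -nr_gt0 nr_rc normr_gt0 gt_eqF.
have nsv : nr (rc s *: v) = s * nr v by rewrite nrZ' nr_rc gtr0_norm.
pose Fs z := (rc s)^-1 * (f (z + rc s *: v) - f z).
have dFs z : nr (z - z0) < r / 4 ->
    is_diff z Fs (fun h => (rc s)^-1 * ('d f (z + rc s *: v) h - 'd f z h)).
  move=> zr; have d1 : differentiable f (z + rc s *: v).
    by apply: df; rewrite addrAC; apply: le_lt_trans (nrD _ _) _; rewrite nsv; lra.
  have d2 : differentiable f z by apply: df; lra.
  have i1 := isd_comp (isd_add (isd_id z) (isd_cst (rc s *: v) z)) (isd_of d1).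
  have i2 := isd_mul (isd_cst (rc s)^-1 z) (isd_sub i1 (isd_of d2)).
  apply: (isd_ext i2) => // h.
  by rewrite mulr0 addr0 (addr0 h).
have dG z : nr (z - z0) < r / 4 ->
   is_diff z (fun z => Fs z - 'd f z v) (fun h => (rc s)^-1 * ('d f (z + rc s *: v) h - 'd f z h) - 'd (fun z => 'd f z v) z h).
  by move=> zr; exact: isd_sub (dFs z zr) (isd_of (near_diff_dir v (nr' z zr))).
have bG z : nr (z - z0) < r / 4 -> nr (Fs z - 'd f z v) <= K * s.
  move=> zr; have inr y : nr (y - z) < r / 4 -> nr (y - z0) < r.
    by move=> h; apply: le_lt_trans (nr_tri _ z _) _; lra.
  exact: quot_unif r4 s0 (fun w h => df w (inr w h)) (fun w h => hM w (inr w h)) s2.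
have z0r : nr (z0 - z0) < r / 4 by rewrite subrr nr0.
have [T1 _] := taylor r4 (fun z zr => isd_ex (dG z zr)) bG w.
have {}T1 := eq_ind _ (fun t => nr t <= 32 * (K * s) / (r / 4) * nr w) T1 _ (isdE (dG z0 z0r) w).
have T2 := hd (rc s *: v); rewrite nsv in T2; have {}T2 := T2 s3.
pose D0 := 'd f (z0 + rc s *: v) w - 'd f z0 w.
pose D1 := 'd (fun z => 'd f z w) z0 v.
have EL : 'd (fun z => 'd f z w) z0 (rc s *: v) = rc s * D1 by exact: linearZ.
have {}T2 : nr (D0 - rc s * D1) <= e * (s * nr v) :=
  eq_ind _ (fun t => nr (D0 - t) <= e * (s * nr v)) T2 _ EL.
have T3 : nr ((rc s)^-1 * D0 - D1) <= e * nr v.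
  have -> : (rc s)^-1 * D0 - D1 = (rc s)^-1 * (D0 - rc s * D1).
    by rewrite [RHS]mulrBr mulKf.
  by rewrite nrM nrV nr_rc gtr0_norm // ler_pdivrMl // mulrCA.
refine (le_trans (nr_tri _ ((rc s)^-1 * D0) D1) _).
rewrite mulrDl; apply: lerD; last by rewrite [X in _ <= X]mulrC.
rewrite nrBC; refine (le_trans T1 _).
have -> : 32 * (K * s) / (r / 4) * nr w = 32 * K / (r / 4) * nr w * s by ring.
apply: ler_wpM2l => //; apply: mulr_ge0; last exact: nr_ge0.
by apply: divr_ge0; [apply: mulr_ge0 (ler0n _ _) _|exact: ltW].
Qed.

End Several.

(** * Vector-valued functions *)

(* The differential is obtained by choice: unfolding it never helps conversion. *)
Opaque diff.

Section FinCoord.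
Variable R : realType.
Local Notation C := (Cplx R).
Implicit Types E F G : normedModType C.

(** Finite-dimensionality, in the form of continuous coordinates: it reduces
    statements on vector-valued functions to scalar ones, and holds for the model
    spaces of the base and of the bundle alike. *)
Definition fin_coord F := exists (I : finType) (c : I -> F -> C) (e : I -> F),
  [/\ forall i, linear (c i), forall i, exists k : R, forall v, nr (c i v) <= k * nr v &
      forall v, v = \sum_i c i v *: e i].

Lemma fc_C : fin_coord C.
Proof.
exists unit, (fun _ v => v), (fun _ => 1); split => //.
- by move=> _; exists 1 => v; rewrite mul1r.
- by move=> v; rewrite big_const card_unit /= addr0 -[_ *: _]/(_ * _) mulr1.
Qed.

Lemma fc_rV n : fin_coord 'rV[C]_n.
Proof.
exists 'I_n, (fun i (v : 'rV[C]_n) => v 0 i), (fun i => delta_mx 0 i); split.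
- by move=> i a u v; rewrite !mxE.
- move=> i; pose f (N : 'rV[C]_n) := N 0 i.
  have d := differentiable_coord (0 : 'rV[C]_n) 0 i.
  have lin : linear f by move=> a u v; rewrite /f !mxE.
  pose fM := GRing.isLinear.Build _ _ _ _ _ lin.
  pose fL : {linear _ -> _} := HB.pack f fM.
  have [k _ hk] := @linear_bound R _ _ fL (@coord_continuous _ _ _ 0 i).
  by exists k.
- by move=> v; rewrite {1}[v]row_sum_delta.
Qed.

Lemma fc_prod F G : fin_coord F -> fin_coord G -> fin_coord (F * G)%type.
Proof.
move=> [I [c [e [c1 c2 c3]]]] [J [d [f [d1 d2 d3]]]].
exists (I + J)%type, (fun k => match k with inl i => fun v => c i v.1 | inr j => fun v => d j v.2 end),
  (fun k => match k with inl i => (e i, 0) | inr j => (0, f j) end); split.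
- by case=> [i|j] a u v /=; rewrite ?c1 ?d1.
- case=> [i|j].
    have [k hk] := c2 i; exists `|k| => v; apply: le_trans (hk _) _.
    exact: le_trans (ler_wpM2r (nr_ge0 _) (ler_norm k)) (ler_wpM2l (normr_ge0 k) (nr_fst v)).
  have [k hk] := d2 j; exists `|k| => v; apply: le_trans (hk _) _.
  exact: le_trans (ler_wpM2r (nr_ge0 _) (ler_norm k)) (ler_wpM2l (normr_ge0 k) (nr_snd v)).
- move=> [v w]; rewrite big_sumType /=.
  transitivity ((v, 0) + (0, w) : F * G); first by apply: injective_projections; rewrite /= ?addr0 ?add0r.
  congr (_ + _).
    rewrite {1}(c3 v); elim: (index_enum I) => [|i s IH]; first by rewrite !big_nil.
    by rewrite !big_cons -IH; apply: injective_projections; rewrite /= ?scaler0 ?addr0.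
  rewrite {1}(d3 w); elim: (index_enum J) => [|i s IH]; first by rewrite !big_nil.
  by rewrite !big_cons -IH; apply: injective_projections; rewrite /= ?scaler0 ?addr0.
Qed.

Section OneSystem.
Variables (F : normedModType C) (I : finType) (c : I -> F -> C) (e : I -> F).
Hypothesis (clin : forall i, linear (c i)) (cbnd : forall i, exists k : R, forall v, nr (c i v) <= k * nr v).
Hypothesis csum : forall v, v = \sum_i c i v *: e i.

Lemma isd_coord i (x : F) : is_diff x (c i) (c i).
Proof. by have [k hk] := cbnd i; exact: isd_lin (clin i) hk. Qed.

Lemma isd_from_coord E (f : E -> F) x (df : I -> E -> C) :
  (forall i, is_diff x (fun y => c i (f y)) (df i)) ->
  is_diff x f (fun h => \sum_i df i h *: e i).
Proof.
move=> h; have := isd_sum (index_enum I) (fun i => isd_scalev (e i) (h i)).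
by move=> H; apply: (isd_ext H) => // y; rewrite -csum.
Qed.

Lemma diff_coordE E (f : E -> F) x i h : differentiable f x ->
  'd (fun y => c i (f y)) x h = c i ('d f x h).
Proof. by move=> df; exact: isdE (isd_comp (isd_of df) (isd_coord i (f x))) h. Qed.

Lemma diff_coord E (f : E -> F) x i : differentiable f x -> differentiable (fun y => c i (f y)) x.
Proof. by move=> df; exact: isd_ex (isd_comp (isd_of df) (isd_coord i (f x))). Qed.

Lemma coord_inj u v : (forall i, c i u = c i v) -> u = v.
Proof. by move=> h; rewrite (csum u) (csum v); apply: eq_bigr => i _; rewrite h. Qed.

End OneSystem.

Lemma near_fst E G (P : E -> Prop) (z : E) (w : G) : (\forall y \near z, P y) ->
  \forall x \near ((z, w) : E * G), P (x.1 : E).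
Proof.
move=> /near_nr[r r0 hr]; apply/near_nr; exists r => // y hy; apply: hr.
by apply: le_lt_trans hy; exact: (nr_fst (y - (z, w))).
Qed.

Lemma tangentF E F (f : E -> F) (z0 v0 : E) : fin_coord F ->
  (\forall z \near z0, differentiable f z) ->
  differentiable (fun x : E * E => 'd f (x.1 : E) x.2) ((z0, v0) : E * E).
Proof.
move=> [I [c [e [c1 c2 c3]]]] df.
have H i : is_diff ((z0, v0) : E * E) (fun x : E * E => c i ('d f (x.1 : E) x.2))
    ('d (fun x : E * E => 'd (fun y => c i (f y)) (x.1 : E) x.2) ((z0, v0) : E * E)).
  have D : \forall z \near z0, differentiable (fun y => c i (f y)) z.
    move/near_nr: df => [r r0 hr]; apply/near_nr; exists r => // y /hr.
    move=> dd; exact: (diff_coord c1 c2 _ dd).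
  apply: (is_diff_near _ (isd_of (tangent_diff v0 D))).
  move/near_nr: (near_fst v0 df) => [r r0 hr]; apply/near_nr; exists r => // y yr.
  exact: (diff_coordE c1 c2 _ _ (hr y yr)).
exact: isd_ex (isd_from_coord c3 H).
Qed.

Lemma near_dirF E F (f : E -> F) (z0 v : E) : fin_coord F ->
  (\forall z \near z0, differentiable f z) -> differentiable (fun z : E => 'd f z v) z0.
Proof.
move=> fF df.
exact: isd_ex (isd_comp (isd_pair (isd_id z0) (isd_cst v z0)) (isd_of (tangentF v fF df))).
Qed.

Lemma schwarzF E F (f : E -> F) (z0 v w : E) : fin_coord F ->
  (\forall z \near z0, differentiable f z) ->
  'd (fun z => 'd f z v) z0 w = 'd (fun z => 'd f z w) z0 v.
Proof.
move=> fF df; have [I [c [e [c1 c2 c3]]]] := fF; apply: (coord_inj c3) => i.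
have key (a b : E) : c i ('d (fun z => 'd f z a) z0 b) = 'd (fun z => 'd (fun y => c i (f y)) z a) z0 b.
  have E1 := diff_coordE c1 c2 i b (near_dirF a fF df).
  refine (etrans (esym E1) _).
  have dci : \forall z \near z0, differentiable (fun y => c i (f y)) z.
    move/near_nr: df => [r r0 hr]; apply/near_nr; exists r => // y /hr.
    move=> dd; exact: (diff_coord c1 c2 _ dd).
  have H := isd_of (near_diff_dir a dci).
  have H2 : is_diff z0 (fun z => c i ('d f z a)) ('d (fun z => 'd (fun y => c i (f y)) z a) z0).
    apply: (is_diff_near _ H); move/near_nr: df => [r r0 hr]; apply/near_nr; exists r => // y /hr d.
    exact: (diff_coordE c1 c2 _ _ d).
  exact: isdE H2 b.
refine (etrans (key v w) (etrans _ (esym (key w v)))).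
apply: schwarz; move/near_nr: df => [r r0 hr]; apply/near_nr; exists r => // y /hr.
move=> dd; exact: (diff_coord c1 c2 _ dd).
Qed.

(** The product rule for a differential applied to a moving vector. *)
Lemma isd_apply E F (f : E -> F) (W : E -> E) dW (z0 : E) : fin_coord F ->
  (\forall z \near z0, differentiable f z) -> is_diff z0 W dW ->
  is_diff z0 (fun z => 'd f z (W z)) (fun h => 'd (fun z => 'd f z (W z0)) z0 h + 'd f z0 (dW h)).
Proof.
move=> fF df hW; pose T (x : E * E) := 'd f (x.1 : E) x.2.
have dT := isd_of (tangentF (W z0) fF df).
have H := isd_comp (isd_pair (isd_id z0) hW) dT.
have H1 := isd_comp (isd_pair (isd_id z0) (isd_cst (W z0) z0)) dT.
have df0 : differentiable f z0 by move/near_nr: df => [r r0]; apply; rewrite subrr nr0.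
have lin0 : is_diff (W z0) ('d f z0) ('d f z0).
  have [k _ hk] := linear_bound (diff_continuous df0).
  by apply: isd_lin hk; exact: linearP.
have H2 := isd_comp (isd_pair (isd_cst z0 (W z0)) (isd_id (W z0))) dT.
apply: (isd_ext H) => // h.
have E1 := isdE H1 h; have E2 := isd_uniq lin0 H2 (dW h).
refine (etrans _ (esym (f_equal2 (fun a b => a + b) E1 E2))).
refine (etrans _ (linearD ('d T (z0, W z0)) (h, 0) (0, dW h))).
congr ('d _ _ _).
by apply: injective_projections; rewrite /= ?addr0 ?add0r.
Qed.

End FinCoord.

(** * Mean value estimates and integration in time *)

Section Flow.
Variable R : realType.
Local Notation C := (Cplx R).
Implicit Types E F G : normedModType C.

Lemma mean_value E (f : E -> C) (a b : E) (M : R) :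
  (forall t : R, 0 <= t <= 1 -> differentiable f (a + rc t *: (b - a))) ->
  (forall t : R, 0 <= t <= 1 -> nr ('d f (a + rc t *: (b - a)) (b - a)) <= M) ->
  nr (f b - f a) <= 2 * M.
Proof.
move=> df hM; pose g (s : C) := f (a + s *: (b - a)).
have dg (t : R) : 0 <= t <= 1 -> is_diff (rc t : C) g (fun k => 'd f (a + rc t *: (b - a)) (k *: (b - a))).
  by move=> /df /isd_of d; exact: isd_comp (isd_line a (b - a) (rc t)) d.
have := @mean_value01 R g M; rewrite /g scale1r scale0r addr0 subrKC; apply.
  by move=> t /dg; exact: isd_ex.
move=> t tI; have E1 := isdE (dg t tI) 1; rewrite scale1r in E1.
by refine (le_trans _ (hM t tI)); refine (eq_ind _ (fun z => nr z <= nr ('d f (a + rc t *: (b - a)) (b - a))) (lexx _) _ (esym E1)).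
Qed.

Lemma seg_in_ball E (p a b : E) (r t : R) : nr (a - p) < r -> nr (b - p) < r -> 0 <= t <= 1 ->
  nr (a + rc t *: (b - a) - p) < r.
Proof.
move=> ha hb /andP[t0 t1].
have -> : a + rc t *: (b - a) - p = rc (1 - t) *: (a - p) + rc t *: (b - p).
  have -> : b - a = (b - p) - (a - p) by rewrite opprB addrA subrK.
  by rewrite addrAC (scalerBr (rc t)) rcB scalerBl scale1r addrA addrAC.
apply: le_lt_trans (nrD _ _) _; rewrite !nrZ' !nr_rc !ger0_norm ?subr_ge0 //.
have [->|t0'] := eqVneq t 0; first by rewrite subr0 mul1r mul0r addr0.
have : t * nr (b - p) < t * r by rewrite ltr_pM2l // lt_neqAle eq_sym t0' t0.
have : (1 - t) * nr (a - p) <= (1 - t) * r by apply: ler_wpM2l; rewrite ?subr_ge0 // ltW.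
lra.
Qed.

Section Coords.
Variables (F : normedModType C) (I : finType) (c : I -> F -> C) (e : I -> F).
Hypothesis (clin : forall i, linear (c i)) (cbnd : forall i, exists k : R, forall v, nr (c i v) <= k * nr v).
Hypothesis csum : forall v, v = \sum_i c i v *: e i.

Lemma coord_bound : exists2 k : R, 0 < k & forall i v, nr (c i v) <= k * nr v.
Proof.
have [k hk] := choice cbnd.
exists (1 + \sum_i `|k i|); first by rewrite ltr_pwDl // sumr_ge0.
move=> i v; apply: le_trans (hk i v) _; apply: ler_wpM2r; first exact: nr_ge0.
rewrite (bigD1 i) //= addrCA; apply: le_trans (ler_norm _) _; rewrite lerDl.
by rewrite addr_ge0 // sumr_ge0.
Qed.

Lemma recomb_bound : exists2 A : R, 0 < A & forall (u : I -> C) M, 0 <= M -> (forall i, nr (u i) <= M) ->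
  nr (\sum_i u i *: e i) <= A * M.
Proof.
exists (1 + \sum_i nr (e i)); first by rewrite ltr_pwDl // sumr_ge0 // => i _; exact: nr_ge0.
move=> u M M0 hM; apply: le_trans (nr_sum _ _ _) _; rewrite mulrDl mul1r mulr_suml.
apply: ler_wpDl => //; apply: ler_sum => i _; rewrite nrZ' mulrC.
by apply: ler_wpM2l; rewrite ?nr_ge0.
Qed.

Lemma csubE i x y : c i (x - y) = c i x - c i y.
Proof.
have H := clin i (-1) y x; rewrite scaleN1r in H.
by rewrite (addrC x) H scaleN1r addrC.
Qed.

End Coords.

(** The constant depends on the coordinates of [F] only. *)
Lemma mean_valueF F : fin_coord F -> exists2 A : R, 0 < A &
  forall E (f : E -> F) (a b : E) (M : R), 0 <= M ->
  (forall t : R, 0 <= t <= 1 -> differentiable f (a + rc t *: (b - a))) ->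
  (forall t : R, 0 <= t <= 1 -> nr ('d f (a + rc t *: (b - a)) (b - a)) <= M) ->
  nr (f b - f a) <= A * M.
Proof.
move=> [I [c [e [c1 c2 c3]]]].
have [k k0 hk] := coord_bound c2; have [A A0 hA] := recomb_bound e.
exists (A * (2 * k)); first by rewrite !mulr_gt0.
move=> E f a b M M0 df hM; rewrite [X in nr X]c3 -mulrA -[2 * k * M]mulrA; apply: hA.
  by rewrite !mulr_ge0 // ltW.
move=> i; rewrite (csubE c1); apply: (mean_value (f := fun y => c i (f y))).
  by move=> t /df d; exact: (diff_coord c1 c2 i d).
move=> t tI; have E1 := diff_coordE c1 c2 i (b - a) (df t tI).
refine (eq_ind _ (fun z => nr z <= k * M) _ _ (esym E1)).
by apply: le_trans (hk i _) _; apply: ler_wpM2l (hM t tI); exact: ltW.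
Qed.

(** [taylor] bounds the differentials of [f] uniformly near [p]. *)
Lemma lipschitz E F (f : E -> F) p : fin_coord F -> (\forall z \near p, differentiable f z) ->
  exists r L : R, [/\ 0 < r, 0 < L & forall x y, nr (x - p) < r -> nr (y - p) < r ->
    nr (f x - f y) <= L * nr (x - y)].
Proof.
move=> fF dfn; have [A A0 hA] := mean_valueF fF.
have [I [c [e [c1 c2 c3]]]] := fF.
have [k k0 hk] := coord_bound c2; have [B B0 hB] := recomb_bound e.
move: dfn => /near_nr[r1 r10 df1].
have [r [M [r0 rr M0 hM]]] := diff_bounded r10 df1.
have df z : nr (z - p) < r -> differentiable f z by move=> h; apply: df1; apply: lt_le_trans rr.
have r2 : 0 < r / 2 by rewrite divr_gt0.
pose L := B * (32 * (k * M) / (r / 2)).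
have L0 : 0 <= L.
  by apply: mulr_ge0; [exact: ltW|apply: divr_ge0; [do 2! apply: mulr_ge0 => //; exact: ltW|exact: ltW]].
have dbound z h : nr (z - p) < r / 2 -> nr ('d f z h) <= L * nr h.
  move=> zr; have inr w : nr (w - z) < r / 2 -> nr (w - p) < r.
    by move=> hw; apply: le_lt_trans (nr_tri _ z _) _; lra.
  have zr' : nr (z - p) < r by lra.
  rewrite [X in nr X]c3 /L -mulrA; apply: hB.
    by apply: mulr_ge0; [apply: divr_ge0; [do 2! apply: mulr_ge0 => //; exact: ltW|exact: ltW]|exact: nr_ge0].
  move=> i; have E1 := diff_coordE c1 c2 i h (df z zr').
  refine (eq_ind _ (fun y => nr y <= 32 * (k * M) / (r / 2) * nr h) _ _ E1).
  apply: (proj1 (taylor (f := fun y => c i (f y)) r2 _ _ h)).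
    by move=> w /inr /df d; exact: (diff_coord c1 c2 i d).
  move=> w /inr /hM m; apply: le_trans (hk i _) _; apply: ler_wpM2l m; exact: ltW.
exists (r / 2), (A * (L + 1)); split => //; first by rewrite mulr_gt0 // ltr_wpDl.
move=> x y xr yr; rewrite -mulrA nrBC (nrBC x); apply: hA.
- by rewrite mulr_ge0 ?nr_ge0 // addr_ge0.
- by move=> t tI; apply: df; apply: lt_trans (seg_in_ball xr yr tI) _; lra.
move=> t tI; apply: le_trans (dbound _ _ (seg_in_ball xr yr tI)) _.
by apply: ler_wpM2r; rewrite ?nr_ge0 // lerDl.
Qed.

Section Prim.
Variables (E : normedModType C) (p : E) (r rho : R).
Definition cylinder (x : C * E) := nr x.1 < r /\ nr (x.2 - p) < rho.

(** The integral of g(., x.2) from 0 to the complex time [x.1], along the segment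
    between them. *)
Definition prim (g : C * E -> C) (x : C * E) : C :=
  x.1 * cint (fun t => g (rc t * x.1, x.2)) 0 1.

Lemma cylinder_scale (x : C * E) (t : R) : 0 <= t <= 1 -> cylinder x -> cylinder (rc t * x.1, x.2).
Proof.
move=> /andP[t0 t1] [x1 x2]; split => //=; apply: le_lt_trans x1.
by rewrite nrM nr_rc ger0_norm // ler_piMl // nr_ge0.
Qed.

Lemma isd_scale_time (x : C * E) (y : C) :
  is_diff y (fun y => (y * x.1, x.2) : C * E) (fun h => (h * x.1, 0)).
Proof.
have H := isd_pair (isd_mul (isd_id y) (isd_cst x.1 y)) (isd_cst x.2 y).
by apply: (isd_ext H) => // h; rewrite mulr0 add0r mulrC.
Qed.

Lemma prim_ccont (g : C * E -> C) x : (forall y, cylinder y -> differentiable g y) -> cylinder x ->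
  ccont (fun t => g (rc t * x.1, x.2)) 0 1.
Proof.
move=> dg dx; apply: (@ccont_diff _ (fun y => g (y * x.1, x.2))) => t tI.
exact: isd_ex (isd_comp (isd_scale_time x (rc t)) (isd_of (dg _ (cylinder_scale tI dx)))).
Qed.

Lemma prim_bound (g : C * E -> C) (M : R) x : (forall y, cylinder y -> differentiable g y) ->
  (forall y, cylinder y -> nr (g y) <= M) -> cylinder x -> nr (prim g x) <= 2 * M * nr x.1.
Proof.
move=> dg hM dx; rewrite /prim nrM mulrC; apply: ler_wpM2r; first exact: nr_ge0.
have := cint_bound ler01 (prim_ccont dg dx) (M := M); rewrite subr0 mulr1; apply.
by move=> t tI; apply: hM; exact: cylinder_scale.
Qed.

Lemma primB (g g' : C * E -> C) x : (forall y, cylinder y -> differentiable g y) ->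
  (forall y, cylinder y -> differentiable g' y) -> cylinder x ->
  prim (fun y => g y - g' y) x = prim g x - prim g' x.
Proof.
move=> dg dg' dx; rewrite /prim -mulrBr; congr (_ * _).
have c1 := prim_ccont dg dx; have c2 := prim_ccont dg' dx.
rewrite -[X in _ = _ + X]mulN1r -cintZ // -cintD //; last exact: ccontZ.
by apply: eq_cint => t _; rewrite mulN1r.
Qed.

(** The remainder estimates of [taylor] allow one to differentiate under the
    integral sign.  In the direction of time the resulting integrand is the
    derivative of t g(t x.1, x.2) with respect to [t], so that its integral is the
    value of [g] at [x]. *)
Lemma prim_diff (g : C * E -> C) (M : R) x : (forall y, cylinder y -> differentiable g y) ->
  (forall y, cylinder y -> nr (g y) <= M) -> cylinder x ->
  differentiable (prim g) x /\ 'd (prim g) x (1, 0) = g x.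
Proof.
move=> dg hM dx; have [x1 x2] := dx.
pose d := Num.min (r - nr x.1) (rho - nr (x.2 - p)).
have d0 : 0 < d by rewrite lt_min !subr_gt0 x1 x2.
pose X (t : R) : C * E := (rc t * x.1, x.2).
have domX (t : R) y : 0 <= t <= 1 -> nr (y - X t) < d -> cylinder y.
  move=> /andP[t0 t1] yd; have y1 := le_lt_trans (nr_fst _) yd; have y2 := le_lt_trans (nr_snd _) yd.
  rewrite !lt_min in y1 y2; case/andP: y1 => y1 _; case/andP: y2 => _ y2.
  split; last by have := nr_tri y.2 x.2 p; rewrite /= in y2; lra.
  have T := nr_tri y.1 (rc t * x.1) 0; rewrite !subr0 in T; apply: le_lt_trans T _.
  rewrite /= in y1; have : nr (rc t * x.1) <= nr x.1.
    by rewrite nrM nr_rc ger0_norm // ler_piMl // nr_ge0.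
  lra.
pose k (t : R) (h : C * E) : C * E := (rc t * h.1, h.2).
have kh (t : R) h : 0 <= t <= 1 -> nr (k t h) <= nr h.
  move=> /andP[t0 t1]; rewrite !nr_pair ge_max !le_max /= lexx orbT andbT; apply/orP; left.
  by rewrite nrM nr_rc ger0_norm // ler_piMl // nr_ge0.
have T (t : R) h : 0 <= t <= 1 -> nr ('d g (X t) (k t h)) <= 32 * M / d * nr (k t h) /\
   (nr (k t h) < d / 8 -> nr (g (X t + k t h) - g (X t) - 'd g (X t) (k t h)) <= 256 * M / d ^+ 2 * nr (k t h) ^+ 2).
  move=> tI; apply: (taylor d0).
    by move=> z /(domX t z tI) /dg.
  by move=> z /(domX t z tI) /hM.
have M0 : 0 <= M by apply: le_trans (hM x dx); exact: nr_ge0.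
have nearX t : 0 <= t <= 1 -> \forall z \near X t, differentiable g z.
  by move=> tI; apply/near_nr; exists d => // z /(domX t z tI) /dg.
have cdk h : ccont (fun t => 'd g (X t) (k t h)) 0 1.
  apply: (@ccont_diff _ (fun y => 'd g (y * x.1, x.2) (y * h.1, h.2))) => t tI.
  have H1 := isd_pair (isd_scale_time x (rc t)) (isd_scale_time h (rc t)).
  exact: isd_ex (isd_comp H1 (isd_of (tangent_diff (k t h) (nearX t tI)))).
pose L h := cint (fun t => 'd g (X t) (k t h)) 0 1.
pose II (y : C * E) := cint (fun t => g (rc t * y.1, y.2)) 0 1.
have linL : linear L.
  move=> a u v; transitivity (a * L u + L v); last by [].
  rewrite /L -cintZ // -cintD //; last exact: ccontZ.
  apply: eq_cint => t _; have -> : k t (a *: u + v) = a *: k t u + k t v.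
    apply: injective_projections => //=; rewrite mulrDr; congr (_ + _).
    exact: mulrCA.
  exact: linearP.
have bL v : nr (L v) <= 2 * (32 * M / d) * nr v.
  have := cint_bound ler01 (cdk v) (M := 32 * M / d * nr v); rewrite subr0 mulr1 => H.
  rewrite -(mulrA 2); apply: H.
  move=> t tI; apply: le_trans (proj1 (T t v tI)) _; apply: ler_wpM2l; last exact: kh.
  by apply: divr_ge0; [apply: mulr_ge0|exact: ltW].
pose K := 2 * (256 * M / d ^+ 2).
have K0 : 0 <= K by apply: mulr_ge0 (ler0n _ _) _; apply: divr_ge0; [apply: mulr_ge0 (ler0n _ _) M0|exact: sqr_ge0].
have dI : is_diff x II L.
  apply: (is_diff_of_eps_fun linL bL) => a a0.
  exists (Num.min (d / 8) (a / (K + 1))).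
    by rewrite lt_min !divr_gt0 // ltr_wpDl.
  move=> h; rewrite lt_min => /andP[h8 hK].
  have dxh : cylinder (x + h).
    apply: (domX 1); first by rewrite ler01 lexx.
    have -> : X 1 = x by rewrite /X rc1 mul1r; case: (x).
    rewrite addrC addKr; lra.
  apply: (@le_trans _ _ (K * nr h ^+ 2)); last first.
    rewrite expr2 mulrA; apply: ler_wpM2r; first exact: nr_ge0.
    move: hK; rewrite ltr_pdivlMr ?ltr_wpDl // => h2; apply: le_trans (ltW h2).
    by rewrite mulrC; apply: ler_wpM2l; rewrite ?nr_ge0 // lerDl.
  have c1 := prim_ccont dg dxh; have c2 := prim_ccont dg dx.
  have -> : II (x + h) - II x - L h =
     cint (fun t => (g (rc t * (x + h).1, (x + h).2) + -1 * g (rc t * x.1, x.2)) + -1 * 'd g (X t) (k t h)) 0 1.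
    rewrite cintD; [|exact: ccontD c1 (ccontZ (-1) c2)|exact: ccontZ].
    by rewrite (cintD c1 (ccontZ (-1) c2)) !cintZ // !mulN1r.
  have cc := ccontD (ccontD c1 (ccontZ (-1) c2)) (ccontZ (-1) (cdk h)).
  have := cint_bound ler01 cc (M := 256 * M / d ^+ 2 * nr h ^+ 2).
  rewrite subr0 mulr1 /K -(mulrA 2) => H; apply: H => t tI.
  have nk := kh t h tI.
  have -> : (rc t * (x + h).1, (x + h).2) = X t + k t h.
    by apply: injective_projections => //=; rewrite mulrDr.
  rewrite !mulN1r; apply: le_trans (proj2 (T t h tI) _) _; first exact: le_lt_trans nk h8.
  apply: ler_wpM2l; first by apply: divr_ge0; [apply: mulr_ge0 (ler0n _ _) M0|exact: sqr_ge0].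
  by rewrite ler_sqr ?nnegrE ?nr_ge0.
have dP : is_diff x (prim g) (fun h => x.1 * L h + II x * h.1) := isd_mul (isd_fst x) dI.
split; first exact: isd_ex dP.
refine (etrans (isdE dP (1, 0)) _).
have dq (t : R) : 0 <= t <= 1 -> is_diff (rc t : C) (fun y => y * g (y * x.1, x.2))
    (fun h => rc t * 'd g (X t) (h * x.1, 0) + g (X t) * h).
  move=> tI; exact: isd_mul (isd_id (rc t : C)) (isd_comp (isd_scale_time x (rc t)) (isd_of (dg _ (cylinder_scale tI dx)))).
have eq1 (t : R) : 0 <= t <= 1 -> 'd (fun y => y * g (y * x.1, x.2)) (rc t : C) 1 =
   x.1 * 'd g (X t) (k t (1, 0)) + g (X t).
  move=> tI; refine (etrans (isdE (dq t tI) 1) _); rewrite mulr1 mul1r; congr (_ + _).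
  have lin1 (z w : C) : z * 'd g (X t) (w, 0) = 'd g (X t) (z * w, 0).
    have -> : (z * w, 0) = z *: (w, 0) :> C * E by apply: injective_projections => //=; rewrite scaler0.
    by symmetry; exact: linearZ.
  by rewrite /k /= mulr1 !lin1 mulrC.
have cdq : ccont (fun t => x.1 * 'd g (X t) (k t (1, 0)) + g (X t)) 0 1.
  by apply: ccontD; [exact: ccontZ|exact: prim_ccont].
have ftc := @cint_ftc R (fun y => y * g (y * x.1, x.2)) (fun t tI => isd_ex (dq t tI)).
have ccq : ccont (fun t : R => 'd (fun y => y * g (y * x.1, x.2)) (rc t : C) 1) 0 1.
  move=> t tI a a0; have [b b0 hb] := cdq t tI a a0; exists b => // y yI yt.
  have := hb y yI yt; rewrite -!eq1 //.
have {}ftc := ftc ccq; rewrite (eq_cint eq1) in ftc.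
rewrite cintD in ftc; [|exact: ccontZ|exact: prim_ccont].
rewrite cintZ // in ftc; rewrite mulr1; refine (etrans ftc _).
by rewrite mul1r mul0r subr0 mul1r; case: (x).
Qed.

End Prim.
End Flow.

(** * Holomorphic flows and the identity theorem *)

Section Picard.
Variable R : realType.
Local Notation C := (Cplx R).
Implicit Types E F G : normedModType C.

Lemma pow2_small (K e : R) : 0 < e -> exists n : nat, K / 2 ^+ n <= e.
Proof.
move=> e0; exists (Num.truncn (K / e)).+1.
rewrite ler_pdivrMr ?exprn_gt0 // mulrC -ler_pdivrMr //.
apply: le_trans (ltW (truncnS_gt _)) _; rewrite -natrX ler_nat ltnW // ltn_expl //.
Qed.

Lemma pow2_le (x y K : R) : (forall n, x <= y + K / 2 ^+ n) -> x <= y.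
Proof.
move=> h; apply/ler_addgt0Pr => e e0; have [n hn] := pow2_small K e0.
by apply: le_trans (h n) _; rewrite lerD2l.
Qed.

Lemma pow2_eq F (x y : F) (K : R) : (forall n, nr (x - y) <= K / 2 ^+ n) -> x = y.
Proof.
move=> h; apply: subr0_eq; apply: nr_eq0; apply/eqP; rewrite eq_le nr_ge0 andbT.
by apply: (@pow2_le _ _ K) => n; rewrite add0r.
Qed.

Lemma fc_complete F : fin_coord F -> exists2 A : R, 0 < A & forall (u : nat -> F) (K : R),
  (forall n m, nr (u n - u m) <= K / 2 ^+ n + K / 2 ^+ m) ->
  exists l, forall n, nr (u n - l) <= A * K / 2 ^+ n.
Proof.
move=> [I [c [e [c1 c2 c3]]]].
have [k k0 hk] := coord_bound c2; have [A A0 hA] := recomb_bound e.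
exists (A * (2 * k)); first by rewrite !mulr_gt0.
move=> u K hu.
have K0 : 0 <= K.
  have := le_trans (nr_ge0 _) (hu 0%N 0%N); rewrite expr0 divr1; lra.
have lex i : exists l : C, forall n, nr (c i (u n) - l) <= 2 * (k * K / 2 ^+ n).
  have [|n m _ _|l hl] := @C_complete R nat setT (fun n => c i (u n)) (fun n => k * K / 2 ^+ n).
  - by exists 0%N.
  - rewrite -(csubE c1); apply: le_trans (hk _ _) _.
    by rewrite -!mulrA -mulrDr; apply: ler_wpM2l (hu n m); exact: ltW.
  - by exists l => n; exact: hl.
have [l hl] := choice lex; exists (\sum_i l i *: e i) => n.
rewrite {1}(c3 (u n)) -sumrB (eq_bigr (fun i => (c i (u n) - l i) *: e i)); last first.
  by move=> i _; rewrite scalerBl.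
have -> : A * (2 * k) * K / 2 ^+ n = A * (2 * (k * K / 2 ^+ n)) by ring.
apply: hA => [|i]; last exact: hl.
by rewrite !mulr_ge0 ?invr_ge0 ?exprn_ge0 // ltW.
Qed.

Lemma weierstrassF E F (g : E -> F) p (r : R) : fin_coord F -> 0 < r ->
  (forall e : R, 0 < e -> exists2 f : E -> F, (forall z, nr (z - p) < r -> differentiable f z) &
     forall z, nr (z - p) < r -> nr (f z - g z) <= e) ->
  differentiable g p.
Proof.
move=> [I [c [e [c1 c2 c3]]]] r0 H.
have [k k0 hk] := coord_bound c2.
have d i : differentiable (fun y => c i (g y)) p.
  apply: (weierstrass r0) => a a0; have [|f f1 f2] := H (a / k); first by rewrite divr_gt0.
  exists (fun y => c i (f y)); first by move=> z /f1 dd; exact: (diff_coord c1 c2 _ dd).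
  move=> z /f2 h; rewrite -(csubE c1); apply: le_trans (hk _ _) _.
  by rewrite mulrC -ler_pdivlMr.
exact: isd_ex (isd_from_coord c3 (fun i => isd_of (d i))).
Qed.

(** The operator is chosen before the cylinder, so that the constant [A] is available
    when the size of the cylinder is determined. *)
Lemma primF F : fin_coord F -> exists (A : R) (P : (C * F -> F) -> C * F -> F), 0 < A /\
  forall (p : F) (r rho : R), [/\
    forall (g : C * F -> F) (M : R) x, (forall y, cylinder p r rho y -> differentiable g y) ->
      (forall y, cylinder p r rho y -> nr (g y) <= M) -> cylinder p r rho x ->
      [/\ differentiable (P g) x, 'd (P g) x (1, 0) = g x & nr (P g x) <= A * M * nr x.1] &
    forall (g g' : C * F -> F) (M : R) x, (forall y, cylinder p r rho y -> differentiable g y) ->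
      (forall y, cylinder p r rho y -> differentiable g' y) ->
      (forall y, cylinder p r rho y -> nr (g y - g' y) <= M) -> cylinder p r rho x ->
      nr (P g x - P g' x) <= A * M * nr x.1].
Proof.
move=> [I [c [e [c1 c2 c3]]]].
have [k k0 hk] := coord_bound c2; have [A A0 hA] := recomb_bound e.
exists (A * (2 * k)), (fun g x => \sum_i prim (fun y => c i (g y)) x *: e i).
split; first by rewrite !mulr_gt0.
move=> p r rho.
have bnd (u : C * F -> I -> C) (g : C * F -> F) M x : (forall y, cylinder p r rho y -> nr (g y) <= M) -> cylinder p r rho x ->
    (forall i, nr (u x i) <= 2 * (k * M) * nr x.1) -> nr (\sum_i u x i *: e i) <= A * (2 * k) * M * nr x.1.
  move=> hM dx h; have M0 := le_trans (nr_ge0 _) (hM x dx).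
  have -> : A * (2 * k) * M * nr x.1 = A * (2 * (k * M) * nr x.1) by ring.
  by apply: hA; rewrite ?mulr_ge0 ?nr_ge0 // ltW.
split=> [g M x dg hM dx|g g' M x dg dg' hM dx].
  have dci i y : cylinder p r rho y -> differentiable (fun y => c i (g y)) y.
    by move=> /dg d; exact: (diff_coord c1 c2 i d).
  have hci i y : cylinder p r rho y -> nr (c i (g y)) <= k * M.
    by move=> /hM h; apply: le_trans (hk _ _) _; apply: ler_wpM2l h; exact: ltW.
  have dP i := prim_diff (dci i) (hci i) dx.
  have H := isd_from_coord c3 (f := fun x => \sum_i prim (fun y => c i (g y)) x *: e i).
  have HH := isd_sum (index_enum I) (fun i => isd_scalev (e i) (isd_of (proj1 (dP i)))).
  split; first exact: isd_ex HH.
    refine (etrans (isdE HH (1, 0)) _); rewrite [RHS]c3; apply: eq_bigr => i _.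
    by rewrite (proj2 (dP i)).
  apply: (bnd (fun x i => prim (fun y => c i (g y)) x) g) => // i.
  exact: prim_bound (dci i) (hci i) dx.
have dci i y : cylinder p r rho y -> differentiable (fun y => c i (g y)) y.
  by move=> /dg d; exact: (diff_coord c1 c2 i d).
have dci' i y : cylinder p r rho y -> differentiable (fun y => c i (g' y)) y.
  by move=> /dg' d; exact: (diff_coord c1 c2 i d).
rewrite -sumrB (eq_bigr (fun i => prim (fun y => c i (g y) - c i (g' y)) x *: e i)); last first.
  by move=> i _; rewrite -scalerBl (primB (dci i) (dci' i) dx).
apply: (bnd (fun x i => prim (fun y => c i (g y) - c i (g' y)) x) (fun y => g y - g' y)) => // i.
apply: (@prim_bound _ _ p r rho (fun y => c i (g y) - c i (g' y)) (k * M) x) dx.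
  by move=> y yd; exact: isd_ex (isd_sub (isd_of (dci i y yd)) (isd_of (dci' i y yd))).
move=> y yd; rewrite -(csubE c1); apply: le_trans (hk _ _) _.
by apply: ler_wpM2l (hM y yd); exact: ltW.
Qed.

Lemma cylinder_open F (p : F) (r rho : R) x : cylinder p r rho x ->
  exists2 d : R, 0 < d & forall y, nr (y - x) < d -> cylinder p r rho y.
Proof.
move=> [x1 x2]; exists (Num.min (r - nr x.1) (rho - nr (x.2 - p))).
  by rewrite lt_min !subr_gt0 x1 x2.
move=> y; rewrite lt_min => /andP[yd1 yd2].
have y1 := le_lt_trans (nr_fst (y - x)) yd1; have y2 := le_lt_trans (nr_snd (y - x)) yd2.
rewrite /= in y1 y2; split.
  by have := nr_tri y.1 x.1 0; rewrite !subr0; lra.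
by have := nr_tri y.2 x.2 p; lra.
Qed.

(** Picard iteration, on a cylinder thin enough in time for the integral operator
    to halve distances.  All iterates are differentiable in time and initial value
    together, hence so is their uniform limit, by [weierstrassF]. *)
Theorem flow F (X : F -> F) (p : F) (delta0 : R) : fin_coord F -> 0 < delta0 ->
  (forall z, nr (z - p) < delta0 -> differentiable X z) ->
  exists (eps rho : R) (Phi : C * F -> F), [/\ 0 < eps, 0 < rho, rho <= delta0,
    forall x, cylinder p eps rho x ->
      [/\ differentiable Phi x, 'd Phi x (1, 0) = X (Phi x) & nr (Phi x - p) < delta0] &
    forall z, nr (z - p) < rho -> Phi (0, z) = z].
Proof.
move=> fF delta00 dX0.
have dXn : \forall z \near p, differentiable X z by apply/near_nr; exists delta0.
have [r1 [L [r10 L0 hL]]] := lipschitz fF dXn.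
have [r2 [M0 [r20 r2d M00 hM0]]] := diff_bounded delta00 dX0.
pose delta := Num.min r1 r2.
have delta_gt0 : 0 < delta by rewrite lt_min r10 r20.
have d_r1 z : nr (z - p) < delta -> nr (z - p) < r1 by rewrite lt_min => /andP[].
have d_r2 z : nr (z - p) < delta -> nr (z - p) < r2 by rewrite lt_min => /andP[].
have dd0 : delta <= delta0 by rewrite ge_min r2d orbT.
have dX z : nr (z - p) < delta -> differentiable X z by move=> /d_r2 h; apply: dX0; apply: lt_le_trans r2d.
pose M := M0 + 1; have M_gt0 : 0 < M by rewrite /M; lra.
have hM z : nr (z - p) < delta -> nr (X z) <= M by move=> /d_r2 /hM0; rewrite /M; lra.
have [A [P [A0 hP]]] := primF fF.
have [B B0 hB] := fc_complete fF.
pose rho := delta / 2; pose eps := Num.min (delta / 4 / (A * M)) (2^-1 / (A * L)).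
have rho0 : 0 < rho by rewrite divr_gt0.
have eps0 : 0 < eps by rewrite lt_min !divr_gt0 ?mulr_gt0.
have eps1 : A * M * eps <= delta / 4.
  have : eps <= delta / 4 / (A * M) by rewrite ge_min lexx.
  by rewrite ler_pdivlMr ?mulr_gt0 // mulrC.
have eps2 : A * L * eps <= 2^-1.
  have : eps <= 2^-1 / (A * L) by rewrite ge_min lexx orbT.
  by rewrite ler_pdivlMr ?mulr_gt0 // mulrC.
have [hP1 hP2] := hP p eps rho.
(* The integral equation f(t, z) = z + int_0^t X(f(s, z)) ds. *)
pose T (f : C * F -> F) (x : C * F) := x.2 + P (fun y => X (f y)) x.
pose good (f : C * F -> F) := forall x, cylinder p eps rho x -> differentiable f x /\ nr (f x - p) <= 3 * delta / 4.
have gd f x : good f -> cylinder p eps rho x -> nr (f x - p) < delta.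
  by move=> gf /gf[_ h]; apply: le_lt_trans h _; lra.
have dXf f : good f -> forall x, cylinder p eps rho x -> differentiable (fun y => X (f y)) x.
  by move=> gf x dx; exact: isd_ex (isd_comp (isd_of (proj1 (gf x dx))) (isd_of (dX _ (gd f x gf dx)))).
have bXf f : good f -> forall x, cylinder p eps rho x -> nr (X (f x)) <= M.
  by move=> gf x dx; apply: hM; exact: gd.
have Pb f x : good f -> cylinder p eps rho x -> nr (P (fun y => X (f y)) x) <= delta / 4.
  move=> gf dx; have [_ _ h] := hP1 _ M x (dXf f gf) (bXf f gf) dx.
  apply: le_trans h _; apply: le_trans eps1; apply: ler_wpM2l; last by case: dx => /ltW.
  by rewrite mulr_ge0 ?ltW.
have gT f : good f -> good (T f).
  move=> gf x dx; have [d1 d2 _] := hP1 _ M x (dXf f gf) (bXf f gf) dx; split.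
    exact: isd_ex (isd_add (isd_snd x) (isd_of d1)).
  rewrite /T addrAC; apply: le_trans (nrD _ _) _; have := Pb f x gf dx.
  by case: dx => _ /ltW; rewrite /rho; lra.
have cT f f' N x : good f -> good f' -> (forall y, cylinder p eps rho y -> nr (f y - f' y) <= N) ->
    cylinder p eps rho x -> nr (T f x - T f' x) <= N / 2.
  move=> gf gf' hN dx; rewrite /T opprD addrACA subrr add0r.
  have N0 := le_trans (nr_ge0 _) (hN x dx).
  have h := hP2 _ _ (L * N) x (dXf f gf) (dXf f' gf').
  apply: le_trans (h _ dx) _.
    move=> y dy; apply: le_trans (hL _ _ (d_r1 _ (gd f y gf dy)) (d_r1 _ (gd f' y gf' dy))) _.
    by apply: ler_wpM2l (hN y dy); exact: ltW.
  have -> : A * (L * N) * nr x.1 = N * (A * L * nr x.1) by ring.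
  apply: ler_wpM2l => //; apply: le_trans eps2; apply: ler_wpM2l; last by case: dx => /ltW.
  by rewrite mulr_ge0 ?ltW.
pose f n := iter n T (fun x => x.2).
have gf n : good (f n).
  elim: n => [|n IH]; last exact: gT.
  move=> x dx; split; first exact: isd_ex (isd_snd x).
  by case: dx => _ /ltW; rewrite /f /rho /=; lra.
have st n x : cylinder p eps rho x -> nr (f n.+1 x - f n x) <= delta / 2 ^+ n.
  elim: n x => [|n IH] x dx.
    rewrite /f /= /T addrC addKr expr0 divr1; apply: le_trans (Pb _ x (gf 0%N) dx) _; lra.
  apply: le_trans (cT (f n.+1) (f n) (delta / 2 ^+ n) x (gf _) (gf _) _ dx) _ => //.
  by rewrite exprSr invfM mulrA.
have cau n m x : cylinder p eps rho x -> nr (f (n + m)%N x - f n x) <= 2 * delta / 2 ^+ n - 2 * delta / 2 ^+ (n + m).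
  move=> dx; elim: m => [|m IH]; first by rewrite addn0 !subrr nr0.
  rewrite addnS; apply: le_trans (nr_tri _ (f (n + m)%N x) _) _.
  apply: le_trans (lerD (st _ x dx) IH) _; rewrite exprS invfM.
  rewrite le_eqVlt; apply/orP; left; apply/eqP; field.
  by rewrite !expf_neq0.
have cau2 n m x : cylinder p eps rho x -> nr (f n x - f m x) <= 2 * delta / 2 ^+ n + 2 * delta / 2 ^+ m.
  have pos q : 0 <= 2 * delta / 2 ^+ q by rewrite divr_ge0 ?exprn_ge0 // mulr_ge0 // ltW.
  move=> dx; have [nm|mn] := leqP n m.
    rewrite nrBC -(subnKC nm); apply: le_trans (cau _ _ x dx) _.
    by have := pos (n + (m - n))%N; lra.
  rewrite -(subnKC (ltnW mn)); apply: le_trans (cau _ _ x dx) _.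
  by have := pos m; have := pos (m + (n - m))%N; lra.
pose K := B * (2 * delta).
have lex (x : C * F) : exists l : F, cylinder p eps rho x -> forall n, nr (f n x - l) <= K / 2 ^+ n.
  have [dx|ndx] := pselect (cylinder p eps rho x); last by exists 0.
  by have [l hl] := hB (fun n => f n x) (2 * delta) (fun n m => cau2 n m x dx); exists l.
have [Phi hPhi] := choice lex.
have gPhi : good Phi.
  move=> x dx; split.
    have [d d0 hd] := cylinder_open dx.
    apply: (weierstrassF fF d0) => a a0; have [n hn] := pow2_small K a0.
    exists (f n); first by move=> z /hd dz; exact: (gf n z dz).1.
    by move=> z /hd dz; apply: le_trans (hPhi z dz n) hn.
  apply: (@pow2_le _ _ K) => n; have [_ h1] := gf n x dx; have h2 := hPhi x dx n.
  apply: le_trans (nr_tri _ (f n x) _) _; rewrite addrC; apply: lerD => //.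
  by rewrite nrBC.
have fix_ x : cylinder p eps rho x -> Phi x = T Phi x.
  move=> dx; apply: (@pow2_eq _ _ _ K) => n.
  apply: le_trans (nr_tri _ (f n.+1 x) _) _.
  have h1 := hPhi x dx n.+1.
  have h2 : nr (f n.+1 x - T Phi x) <= K / 2 ^+ n / 2.
    exact: cT (f n) Phi (K / 2 ^+ n) x (gf n) gPhi (fun y dy => hPhi y dy n) dx.
  rewrite (nrBC (Phi x)); refine (le_trans (lerD h1 h2) _).
  rewrite exprS invfM le_eqVlt; apply/orP; left; apply/eqP; field.
  by rewrite expf_neq0.
exists eps, rho, Phi; split => //; first by rewrite /rho; lra.
  move=> x dx; have [d1 d2 _] := hP1 _ M x (dXf Phi gPhi) (bXf Phi gPhi) dx.
  split; first exact: (gPhi x dx).1.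
    have H : is_diff x (T Phi) (fun h => h.2 + 'd (P (fun y => X (Phi y))) x h) := isd_add (isd_snd x) (isd_of d1).
    have [d dpos hd] := cylinder_open dx.
    have nT : \forall y \near x, T Phi y = Phi y.
      by apply/near_nr; exists d => // y /hd /fix_.
    refine (etrans (isdE (is_diff_near nT H) (1, 0)) _).
    by rewrite add0r.
  exact: lt_le_trans (gd Phi x gPhi dx) dd0.
move=> z zr; have dz : cylinder p eps rho (0, z) by split => //=; rewrite nr0.
rewrite fix_ // /T /=.
have [_ _ h] := hP1 _ M (0, z) (dXf Phi gPhi) (bXf Phi gPhi) dz.
have m0 : nr (0 : C) = 0 := nr0 C.
rewrite /= m0 mulr0 in h.
have -> : P (fun y => X (Phi y)) (0, z) = 0 by apply: nr_eq0; apply/eqP; rewrite eq_le h nr_ge0.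
exact: addr0.
Qed.

(** The mean value estimate halves any bound on the difference of two solutions. *)
Lemma ode_unique F (X : F -> F) (p : F) (c1 c2 : C -> F) (r : R) : fin_coord F -> 0 < r ->
  (\forall z \near p, differentiable X z) ->
  (forall s, nr s < r -> differentiable c1 s /\ 'd c1 s 1 = X (c1 s)) ->
  (forall s, nr s < r -> differentiable c2 s /\ 'd c2 s 1 = X (c2 s)) ->
  c1 0 = p -> c2 0 = p ->
  exists2 r' : R, 0 < r' & forall s, nr s < r' -> c1 s = c2 s.
Proof.
move=> fF r0 dX h1 h2 e1 e2.
have [r1 [L [r10 L0 hL]]] := lipschitz fF dX.
have [A A0 hA] := mean_valueF fF.
have n0 : nr (0 : C) < r by rewrite nr0.
have /cont_nr /(_ r1 r10)[a a0 ha] := differentiable_continuous (h1 0 n0).1.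
have /cont_nr /(_ r1 r10)[b b0 hb] := differentiable_continuous (h2 0 n0).1.
pose r' := Num.min (Num.min r (2^-1 / (A * L))) (Num.min a b).
have r'0 : 0 < r' by rewrite !lt_min r0 a0 b0 divr_gt0 ?mulr_gt0.
have r'r : r' <= r by rewrite !ge_min lexx.
have r'A : A * L * r' <= 2^-1.
  have : r' <= 2^-1 / (A * L) by rewrite !ge_min lexx !orbT.
  by rewrite ler_pdivlMr ?mulr_gt0 // mulrC.
have r'a : r' <= a by rewrite !ge_min lexx !orbT.
have r'b : r' <= b by rewrite !ge_min lexx !orbT.
have in1 s : nr s < r' -> nr (c1 s - p) < r1.
  by move=> sr; rewrite -e1; apply: ha; rewrite subr0; apply: lt_le_trans r'a.
have in2 s : nr s < r' -> nr (c2 s - p) < r1.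
  by move=> sr; rewrite -e2; apply: hb; rewrite subr0; apply: lt_le_trans r'b.
exists r' => // s sr; apply: (@pow2_eq _ _ _ (2 * r1)) => n; elim: n s sr => [|n IH] s sr.
  rewrite expr0 divr1; apply: le_trans (nr_tri _ p _) _; have := in1 s sr; have := in2 s sr.
  by rewrite [nr (p - _)]nrBC; lra.
have K0 : 0 <= 2 * r1 / 2 ^+ n by rewrite divr_ge0 ?exprn_ge0 // mulr_ge0 // ltW.
have sub (t : R) : 0 <= t <= 1 -> nr (0 + rc t *: (s - 0)) < r'.
  move=> /andP[t0 t1]; rewrite add0r subr0 nrZ' nr_rc ger0_norm //.
  by apply: le_lt_trans sr; rewrite ler_piMl // nr_ge0.
have dc (t : R) : 0 <= t <= 1 -> is_diff (0 + rc t *: (s - 0) : C) (fun s => c1 s - c2 s)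
   (fun h => 'd c1 (0 + rc t *: (s - 0)) h - 'd c2 (0 + rc t *: (s - 0)) h).
  move=> /sub h; have hr := lt_le_trans h r'r.
  exact: isd_sub (isd_of (h1 _ hr).1) (isd_of (h2 _ hr).1).
have := hA C (fun s => c1 s - c2 s) 0 s (L * (2 * r1 / 2 ^+ n) * nr s).
move=> /= H.
have -> : c1 s - c2 s = (c1 s - c2 s) - (c1 0 - c2 0) by rewrite e1 e2 subrr subr0.
refine (le_trans (H _ _ _) _).
- by rewrite !mulr_ge0 ?nr_ge0 ?invr_ge0 ?exprn_ge0 // ltW.
- by move=> t tI; exact: isd_ex (dc t tI).
- move=> t tI; have E := isdE (dc t tI) s; have hs := sub t tI.
  rewrite !subr0; rewrite subr0 in E hs; set u := 0 + rc t *: s in E hs *.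
  have hr := lt_le_trans hs r'r.
  have k1 : 'd c1 u s = s *: X (c1 u).
    by rewrite -(h1 u hr).2 -linearZ -[s *: 1]/(s * 1) mulr1.
  have k2 : 'd c2 u s = s *: X (c2 u).
    by rewrite -(h2 u hr).2 -linearZ -[s *: 1]/(s * 1) mulr1.
  have E' := etrans E (etrans (f_equal2 (fun a b => a - b) k1 k2) (esym (scalerBr s (X (c1 u)) (X (c2 u))))).
  refine (eq_ind _ (fun z => nr z <= L * (2 * r1 / 2 ^+ n) * nr s) _ _ (esym E')).
  rewrite nrZ' mulrC; apply: ler_wpM2r; first exact: nr_ge0.
  apply: le_trans (hL _ _ (in1 u hs) (in2 u hs)) _; apply: ler_wpM2l (IH u hs); exact: ltW.
have -> : A * (L * (2 * r1 / 2 ^+ n) * nr s) = 2 * r1 / 2 ^+ n * (A * L * nr s) by ring.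
rewrite exprSr invfM [X in _ <= X]mulrA; apply: ler_wpM2l => //; apply: le_trans r'A.
by apply: ler_wpM2l; [rewrite mulr_ge0 ?ltW|exact: ltW].
Qed.

(** Dividing [g] by w^n preserves differentiability, since [g] vanishes near 0;
    [maximum_weak] then bounds [g s] by a constant times 2^(-n). *)
Lemma identity_disc (g : C -> C) (rho eta M : R) : 0 < rho -> 0 < eta ->
  (forall s, nr s < rho -> differentiable g s) -> (forall s, nr s < rho -> nr (g s) <= M) ->
  (forall s, nr s < eta -> g s = 0) -> forall s, nr s < rho / 16 -> g s = 0.
Proof.
move=> rho0 eta0 dg hM g0 s hs.
have m0 : nr (0 : C) = 0 := nr0 C.
have [->|sz] := eqVneq s 0; first by apply: g0; rewrite m0.
have spos : 0 < nr s by rewrite nr_gt0.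
have Mpos : 0 <= M by apply: le_trans (hM 0 _); rewrite ?nr_ge0 ?m0.
apply: (@pow2_eq _ _ _ (16 * M)) => n; rewrite subr0.
pose q (w : C) := g w / w ^+ n.
have dq w : nr w < rho -> differentiable q w.
  move=> wr; have [w0|wz] := eqVneq w 0.
    have H : is_diff w (fun _ : C => 0 : C) (fun _ => 0) by exact: isd_cst.
    apply: isd_ex (is_diff_near _ H); apply/near_nr; exists eta => // y.
    by rewrite w0 subr0 => yr; rewrite /q g0 // mul0r.
  have H : is_diff w (fun y : C => y ^+ n) ('d (fun y : C => y ^+ n) w).
    apply: isd_of; elim: n {q} => [|n IH]; first exact: isd_ex (isd_cst (1 : C) w).
    have E : (fun y : C => y ^+ n.+1) = (fun y => y * y ^+ n) by apply/funext => y; rewrite exprS.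
    rewrite E; exact: isd_ex (isd_mul (isd_id w) (isd_of IH)).
  exact: isd_ex (isd_mul (isd_of (dg w wr)) (isd_inv H (expf_neq0 n wz))).
pose r := rho / 2.
have r0 : 0 < r by rewrite divr_gt0.
have rr : r < rho by rewrite /r; lra.
have hs4 : nr s < r / 4 by rewrite /r; lra.
have B := @maximum_weak R q s r rho (M / (r / 2) ^+ n) r0 rr hs4 dq _.
have {}B : nr (q s) <= 16 * (M / (r / 2) ^+ n).
  apply: B => w /andP[w1 w2]; rewrite /q nrM nrV nrX.
  have r2 : 0 < r / 2 by rewrite divr_gt0.
  apply: ler_pM; rewrite ?nr_ge0 ?invr_ge0 ?exprn_ge0 ?nr_ge0 //; first by apply: hM; lra.
  rewrite lef_pV2 ?posrE ?exprn_gt0 //; last exact: lt_le_trans w1.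
  by apply: lerXn2r; rewrite ?nnegrE ?nr_ge0 // ltW.
rewrite /q nrM nrV nrX ler_pdivrMr ?exprn_gt0 // in B; apply: le_trans B _.
have r2 : 0 < r / 2 by rewrite divr_gt0.
have -> : 16 * (M / (r / 2) ^+ n) * nr s ^+ n = 16 * M * (nr s / (r / 2)) ^+ n.
  by rewrite (expr_div_n (nr s)) -!mulrA [(_ ^- n * _)%R]mulrC.
apply: ler_wpM2l; first by apply: mulr_ge0 (ler0n _ _) Mpos.
have h1 : nr s / (r / 2) <= 2^-1 by rewrite ler_pdivrMr // /r; lra.
have h0 : 0 <= nr s / (r / 2) by rewrite divr_ge0 ?nr_ge0 // ltW.
by rewrite -exprVn; apply: lerXn2r; rewrite // nnegrE invr_ge0.
Qed.

End Picard.

(** * Functions and vector fields on complex manifolds *)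

Section ManifoldToolkit.
Variable R : realType.
Local Notation C := (Cplx R).
Implicit Types E F G : normedModType C.

(** The vector-valued version of [holo_fun_at]. *)
Definition vholo_at E (M : cmanifold E) F (f : M -> F) (x : M) :=
  forall i, cm_dom M i x -> differentiable (f \o cm_inv M i) (cm_chart M i x).

Section OneManifold.
Variables (E : normedModType C) (M : cmanifold E).
Implicit Types (x y : M).

Lemma dom_near i x : cm_dom M i x -> \forall y \near x, cm_dom M i y.
Proof. by move=> dx; apply: open_nbhs_nbhs; split => //; exact: cm_dom_open. Qed.

Lemma inv_near i x : cm_dom M i x -> \forall z \near cm_chart M i x,
  cm_dom M i (cm_inv M i z) /\ cm_chart M i (cm_inv M i z) = z.
Proof.
move=> dx; have : nbhs (cm_chart M i x) (cm_chart M i @` cm_dom M i).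
  by apply: open_nbhs_nbhs; split; [exact: cm_codom_open|exists x].
by apply: filterS => z [y dy <-]; rewrite cm_chartK.
Qed.

Lemma inv_near_of i x (P : M -> Prop) : cm_dom M i x -> (\forall y \near x, P y) ->
  \forall z \near cm_chart M i x, P (cm_inv M i z).
Proof.
move=> dx nP; have c := cm_inv_continuous dx.
by have := c P; rewrite cm_chartK //; apply.
Qed.

Lemma chart_near_of i x (P : E -> Prop) : cm_dom M i x -> (\forall z \near cm_chart M i x, P z) ->
  \forall y \near x, P (cm_chart M i y).
Proof. by move=> dx nP; exact: (cm_chart_continuous dx nP). Qed.

Lemma inv_param i x : cm_dom M i x -> holo_param_at (cm_inv M i) (cm_chart M i x).
Proof.
move=> dx; split; first exact: cm_inv_continuous.
by move=> j; rewrite cm_chartK // => dj; exact: cm_transition.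
Qed.

(** The chain rule in a chart [j] around [h z]. *)
Lemma param_comp F G (h : F -> M) (f : M -> G) z j : holo_param_at h z -> cm_dom M j (h z) ->
  differentiable (f \o cm_inv M j) (cm_chart M j (h z)) ->
  is_diff z (f \o h) (fun v => 'd (f \o cm_inv M j) (cm_chart M j (h z)) ('d (cm_chart M j \o h) z v)).
Proof.
move=> [hc hd] dj df.
apply: (is_diff_near _ (isd_comp (isd_of (hd j dj)) (isd_of df))).
have n : \forall w \near z, cm_dom M j (h w) := hc _ (dom_near dj).
move: n; apply: filterS => w /= dw.
by rewrite /= cm_chartK.
Qed.

(** By compatibility of the charts it is enough to look in one of them. *)
Lemma vholo_one F (f : M -> F) i x : cm_dom M i x ->
  differentiable (f \o cm_inv M i) (cm_chart M i x) -> vholo_at f x.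
Proof.
move=> dx df j djx; have dxj : cm_dom M i (cm_inv M j (cm_chart M j x)) by rewrite cm_chartK.
have df' : differentiable (f \o cm_inv M i) (cm_chart M i (cm_inv M j (cm_chart M j x))).
  by rewrite cm_chartK.
exact: isd_ex (param_comp (inv_param djx) dxj df').
Qed.

Lemma vholo_cont F (f : M -> F) x : vholo_at f x -> {for x, continuous f}.
Proof.
move=> hf; have [i dx] := cm_cover x.
have c1 := cm_chart_continuous dx.
have c2 := differentiable_continuous (hf i dx).
move=> A; have fx : f (cm_inv M i (cm_chart M i x)) = f x by rewrite cm_chartK.
move=> nA; have nA' : nbhs ((f \o cm_inv M i) (cm_chart M i x)) A by rewrite /= fx.
have n : \forall y \near x, A ((f \o cm_inv M i) (cm_chart M i y)) := c1 _ (c2 _ nA').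
have := dom_near dx; move: n; apply: filterS2 => y /= h dy.
by rewrite cm_chartK // in h.
Qed.

Lemma vholo_comp F G (f : M -> F) (g : F -> G) x : vholo_at f x -> differentiable g (f x) ->
  vholo_at (g \o f) x.
Proof.
move=> hf dg i dx; have dg' : differentiable g (f (cm_inv M i (cm_chart M i x))) by rewrite cm_chartK.
exact: isd_ex (isd_comp (isd_of (hf i dx)) (isd_of dg')).
Qed.

Lemma vholo_near F (f g : M -> F) x : (\forall y \near x, f y = g y) -> vholo_at f x -> vholo_at g x.
Proof.
move=> nfg hf i dx; apply: isd_ex (is_diff_near (inv_near_of dx nfg) (isd_of (hf i dx))).
Qed.

Lemma vholo_nearby F (f : M -> F) i x : cm_dom M i x -> (\forall y \near x, vholo_at f y) ->
  \forall z \near cm_chart M i x, differentiable (f \o cm_inv M i) z.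
Proof.
move=> dx nf; have n1 := inv_near_of dx nf; have n2 := inv_near dx.
move: n1; apply: filterS2 n2 => z [d1 d2] hz.
by have := hz i d1; rewrite d2.
Qed.

Lemma chart_vholo i x : cm_dom M i x -> vholo_at (cm_chart M i) x.
Proof. by move=> di j dj; exact: cm_transition. Qed.

Lemma param_diff F G (h : F -> M) (f : M -> G) z : holo_param_at h z -> vholo_at f (h z) ->
  differentiable (f \o h) z.
Proof.
move=> hp hf; have [j dj] := cm_cover (h z).
exact: isd_ex (param_comp hp dj (hf j dj)).
Qed.

Lemma param_pre F G (h : F -> M) (k : G -> F) w : holo_param_at h (k w) -> differentiable k w ->
  holo_param_at (h \o k) w.
Proof.
move=> [hc hd] dk; split; first exact: continuous_comp (differentiable_continuous dk) hc.
move=> j dj; exact: isd_ex (isd_comp (isd_of dk) (isd_of (hd j dj))).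
Qed.

Lemma param_near F (h k : F -> M) z : (\forall w \near z, h w = k w) -> holo_param_at h z -> holo_param_at k z.
Proof.
move=> n [hc hd]; have hk : h z = k z by move/near_nr: n => [r r0]; apply; rewrite subrr nr0.
split.
  move=> A; rewrite -hk => /hc; move: n; apply: filterS2 => w /= <- //.
move=> j; rewrite -hk => dj; apply: isd_ex (is_diff_near _ (isd_of (hd j dj))).
by move: n; apply: filterS => w /= ->.
Qed.

End OneManifold.

Lemma map_param E F G (M : cmanifold E) (N : cmanifold F) (f : M -> N) (h : G -> M) z :
  holo_map f -> holo_param_at h z -> holo_param_at (f \o h) z.
Proof.
move=> hf hp; have [i di] := cm_cover (h z).
have h1 := hf _ _ di.
have [hc hd] := hp.
have h2 : holo_param_at ((f \o cm_inv M i) \o (cm_chart M i \o h)) z by apply: param_pre h1 (hd i di).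
apply: param_near h2.
have n : \forall w \near z, cm_dom M i (h w) := hc _ (dom_near di).
move: n; apply: filterS => w /= dw.
by rewrite cm_chartK.
Qed.

Lemma map_comp E F G (M : cmanifold E) (N : cmanifold F) (P : cmanifold G) (f : M -> N) (g : N -> P) :
  holo_map f -> holo_map g -> holo_map (g \o f).
Proof. by move=> hf hg x i dx; exact: map_param hg (hf x i dx). Qed.

Lemma map_cont E F (M : cmanifold E) (N : cmanifold F) (f : M -> N) x : holo_map f -> {for x, continuous f}.
Proof.
move=> hf; have [i di] := cm_cover x; have [c _] := hf x i di.
have fx : (f \o cm_inv M i) (cm_chart M i x) = f x by rewrite /= cm_chartK.
have c1 := cm_chart_continuous di.
move=> A nA; have nA' : nbhs ((f \o cm_inv M i) (cm_chart M i x)) A by rewrite fx.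
have n : \forall y \near x, A ((f \o cm_inv M i) (cm_chart M i y)) := c1 _ (c _ nA').
have := dom_near di; move: n; apply: filterS2 => y /= h dy.
by rewrite cm_chartK // in h.
Qed.

Lemma map_vholo E F G (M : cmanifold E) (N : cmanifold F) (f : M -> N) (g : N -> G) x :
  holo_map f -> vholo_at g (f x) -> vholo_at (g \o f) x.
Proof.
move=> hf hg i di; have hg' : vholo_at g ((f \o cm_inv M i) (cm_chart M i x)) by rewrite /= cm_chartK.
exact: param_diff (hf x i di) hg'.
Qed.

(** X f, for a vector-valued [f], computed in the chart [i]. *)
Definition along E (M : cmanifold E) F (V : vfield M) (f : M -> F) (i : cm_index M) (x : M) : F :=
  'd (f \o cm_inv M i) (cm_chart M i x) (V i x).

Lemma along_near E (M : cmanifold E) F (V : vfield M) (f g : M -> F) i x : cm_dom M i x ->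
  vholo_at f x -> (\forall y \near x, f y = g y) -> along V g i x = along V f i x.
Proof.
move=> di hf n; rewrite /along.
exact: isdE (is_diff_near (inv_near_of di n) (isd_of (hf i di))) (V i x).
Qed.

Lemma along_chain E F G (M : cmanifold E) (N : cmanifold F) (V : vfield M) (h : M -> N) (f : N -> G) i j x :
  holo_map h -> cm_dom M i x -> cm_dom N j (h x) -> vholo_at f (h x) ->
  along V (f \o h) i x = 'd (f \o cm_inv N j) (cm_chart N j (h x)) (along V (cm_chart N j \o h) i x).
Proof.
move=> hh di dj hf; have hp := hh x i di.
have hx : (h \o cm_inv M i) (cm_chart M i x) = h x by rewrite /= cm_chartK.
have dj' : cm_dom N j ((h \o cm_inv M i) (cm_chart M i x)) by rewrite hx.
have df : differentiable (f \o cm_inv N j) (cm_chart N j ((h \o cm_inv M i) (cm_chart M i x))).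
  by rewrite hx; exact: hf.
refine (etrans (isdE (param_comp hp dj' df) (V i x)) _).
by rewrite hx.
Qed.

Lemma along_id E (M : cmanifold E) (V : vfield M) i x : cm_dom M i x -> along V (cm_chart M i) i x = V i x.
Proof.
move=> di; rewrite /along.
apply: (isdE (df := fun v => v)).
apply: (is_diff_near _ (isd_id (cm_chart M i x))).
by have := inv_near di; apply: filterS => z [_ /= ->].
Qed.

Lemma alongM E (M : cmanifold E) (V : vfield M) (f g : M -> C) i x : cm_dom M i x ->
  vholo_at f x -> vholo_at g x ->
  along V (fun y => f y * g y) i x = f x * along V g i x + g x * along V f i x.
Proof.
move=> di hf hg; refine (etrans (isdE (isd_mul (isd_of (hf i di)) (isd_of (hg i di))) (V i x)) _).
by rewrite /= cm_chartK.
Qed.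

Lemma along_pair E (M : cmanifold E) F G (V : vfield M) (f : M -> F) (g : M -> G) i x : cm_dom M i x ->
  vholo_at f x -> vholo_at g x ->
  along V (fun y => (f y, g y)) i x = (along V f i x, along V g i x).
Proof. by move=> di hf hg; exact: isdE (isd_pair (isd_of (hf i di)) (isd_of (hg i di))) (V i x). Qed.

Lemma vholo_pair E (M : cmanifold E) F G (f : M -> F) (g : M -> G) x :
  vholo_at f x -> vholo_at g x -> vholo_at (fun y => (f y, g y)) x.
Proof. by move=> hf hg i di; exact: isd_ex (isd_pair (isd_of (hf i di)) (isd_of (hg i di))). Qed.

Lemma vholoM E (M : cmanifold E) (f g : M -> C) x :
  vholo_at f x -> vholo_at g x -> vholo_at (fun y => f y * g y) x.
Proof. by move=> hf hg i di; exact: isd_ex (isd_mul (isd_of (hf i di)) (isd_of (hg i di))). Qed.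

Lemma vholoV E (M : cmanifold E) (f : M -> C) x :
  vholo_at f x -> f x != 0 -> vholo_at (fun y => (f y)^-1) x.
Proof.
move=> hf f0 i di; have f0' : (f \o cm_inv M i) (cm_chart M i x) != 0 by rewrite /= cm_chartK.
exact: isd_ex (isd_inv (isd_of (hf i di)) f0').
Qed.

Lemma field_vholo E (M : cmanifold E) (X : vfield M) j x : holo_vfield X -> cm_dom M j x -> vholo_at (X j) x.
Proof. by move=> [_ h _] dj; exact: vholo_one (h j x dj). Qed.

(** The terms with second derivatives of [Phi] cancel by symmetry. *)
Lemma bracket_natural E F (Phi : E -> F) (V W : E -> E) (V' W' : F -> F) (z0 : E) :
  fin_coord F -> (\forall z \near z0, differentiable Phi z) ->
  differentiable V z0 -> differentiable W z0 ->
  differentiable V' (Phi z0) -> differentiable W' (Phi z0) ->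
  (\forall z \near z0, 'd Phi z (V z) = V' (Phi z)) ->
  (\forall z \near z0, 'd Phi z (W z) = W' (Phi z)) ->
  'd Phi z0 ('d W z0 (V z0) - 'd V z0 (W z0)) =
  'd W' (Phi z0) (V' (Phi z0)) - 'd V' (Phi z0) (W' (Phi z0)).
Proof.
move=> fF dPhi dV dW dV' dW' eV eW.
have self (P : E -> Prop) : (\forall z \near z0, P z) -> P z0.
  by move/near_nr => [r r0]; apply; rewrite subrr nr0.
have dP0 := self _ dPhi; have eV0 := self _ eV; have eW0 := self _ eW.
have key (A B : E -> E) (A' : F -> F) : differentiable A z0 -> differentiable A' (Phi z0) ->
    (\forall z \near z0, 'd Phi z (A z) = A' (Phi z)) ->
    'd (fun z => 'd Phi z (A z0)) z0 (B z0) + 'd Phi z0 ('d A z0 (B z0)) = 'd A' (Phi z0) ('d Phi z0 (B z0)).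
  move=> dA dA' eA; have H1 := is_diff_near eA (isd_apply fF dPhi (isd_of dA)).
  have H2 := isd_comp (isd_of dP0) (isd_of dA').
  exact: isd_uniq H1 H2 (B z0).
have k1 := key W V W' dW dW' eW; have k2 := key V W V' dV dV' eV.
have k1' := etrans k1 (congr1 ('d W' (Phi z0)) eV0).
have k2' := etrans k2 (congr1 ('d V' (Phi z0)) eW0).
have alg (a b s t : F) : s = t -> a - b = (s + a) - (t + b).
  by move=> ->; rewrite opprD addrACA subrr add0r.
refine (etrans (linearB ('d Phi z0) ('d W z0 (V z0)) ('d V z0 (W z0))) _).
refine (etrans _ (f_equal2 (fun a b => a - b) k1' k2')).
exact: alg (schwarzF (W z0) (V z0) fF dPhi).
Qed.

Lemma field_near E (M : cmanifold E) (V : vfield M) i x : holo_vfield V -> cm_dom M i x ->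
  \forall z \near cm_chart M i x, differentiable (V i \o cm_inv M i) z.
Proof.
move=> hV di; apply: (vholo_nearby di); have := dom_near di; apply: filterS => y dy.
exact: field_vholo.
Qed.

Lemma lie_bracketE E (M : cmanifold E) (V W : vfield M) i x : cm_dom M i x ->
  lie_bracket V W i x = 'd (W i \o cm_inv M i) (cm_chart M i x) (V i x) -
    'd (V i \o cm_inv M i) (cm_chart M i x) (W i x).
Proof. by move=> di; rewrite /lie_bracket mem_set. Qed.

Lemma lie_bracket_out E (M : cmanifold E) (V W : vfield M) i x : ~ cm_dom M i x ->
  lie_bracket V W i x = 0.
Proof. by move=> di; rewrite /lie_bracket memNset. Qed.

Lemma bracket_push E F (M : cmanifold E) (V W : vfield M) (f : M -> F) (V' W' : F -> F) i x :
  fin_coord F -> holo_vfield V -> holo_vfield W -> cm_dom M i x ->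
  (\forall y \near x, vholo_at f y) ->
  (\forall y \near x, along V f i y = V' (f y)) -> (\forall y \near x, along W f i y = W' (f y)) ->
  differentiable V' (f x) -> differentiable W' (f x) ->
  along (lie_bracket V W) f i x = 'd W' (f x) (V' (f x)) - 'd V' (f x) (W' (f x)).
Proof.
move=> fF hV hW di hf eV eW dV' dW'.
have fx : (f \o cm_inv M i) (cm_chart M i x) = f x by rewrite /= cm_chartK.
have nV (A : vfield M) (A' : F -> F) : (\forall y \near x, along A f i y = A' (f y)) ->
    \forall z \near cm_chart M i x, 'd (f \o cm_inv M i) z ((A i \o cm_inv M i) z) = A' ((f \o cm_inv M i) z).
  move=> h; have n1 := inv_near_of di h; have n2 := inv_near di.
  move: n1; apply: filterS2 n2 => z [d1 d2]; rewrite /along d2; exact.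
have self (P : M -> Prop) : (\forall y \near x, P y) -> P x by exact: nbhs_singleton.
have B := @bracket_natural E F (f \o cm_inv M i) (V i \o cm_inv M i) (W i \o cm_inv M i) V' W' (cm_chart M i x) fF
  (vholo_nearby di hf) (nbhs_singleton (field_near hV di)) (nbhs_singleton (field_near hW di)).
rewrite fx in B; have {}B := B dV' dW' (nV V V' eV) (nV W W' eW).
rewrite /along lie_bracketE //; refine (etrans _ B).
by rewrite /= cm_chartK.
Qed.

Lemma holo_bracket E (M : cmanifold E) (V W : vfield M) : fin_coord E ->
  holo_vfield V -> holo_vfield W -> holo_vfield (lie_bracket V W).
Proof.
move=> fE hV hW; split.
- by move=> i x; exact: lie_bracket_out.
- move=> i x di.
  have nA (A B : vfield M) : holo_vfield A -> holo_vfield B ->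
      differentiable (fun z => 'd (B i \o cm_inv M i) z ((A i \o cm_inv M i) z)) (cm_chart M i x).
    move=> hA hB.
    exact: isd_ex (isd_apply fE (field_near hB di) (isd_of (nbhs_singleton (field_near hA di)))).
  apply: isd_ex (is_diff_near _ (isd_sub (isd_of (nA V W hV hW)) (isd_of (nA W V hW hV)))).
  have := inv_near di; apply: filterS => z [d1 d2].
  by rewrite /= lie_bracketE // d2.
move=> i j x di dj.
have := @bracket_push _ _ M V W (cm_chart M j) (V j \o cm_inv M j) (W j \o cm_inv M j) i x fE hV hW di.
rewrite lie_bracketE // /along /= cm_chartK // => H; rewrite -H //.
- by have := dom_near dj; apply: filterS => y; exact: chart_vholo.
- have n1 := dom_near di; have := dom_near dj; move: n1; apply: filterS2 => y dy1 dy2.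
  by rewrite /= cm_chartK //; case: hV => _ _ h; exact: esym (h i j y dy1 dy2).
- have n1 := dom_near di; have := dom_near dj; move: n1; apply: filterS2 => y dy1 dy2.
  by rewrite /= cm_chartK //; case: hW => _ _ h; exact: esym (h i j y dy1 dy2).
- exact: (nbhs_singleton (field_near hV dj)).
- exact: (nbhs_singleton (field_near hW dj)).
Qed.

End ManifoldToolkit.

(** * Vector fields on the bundle over vector fields on the base *)

Section Bundle.
Variable R : realType.
Local Notation C := (Cplx R).
Variables (E : normedModType C) (fE : fin_coord E) (M : cmanifold E) (D : divisor M) (L : divisor_bundle D).
Local Notation U := (@dv_open _ _ _ D).
Local Notation t := (@dv_trans _ _ _ D).
Local Notation pi := (@lb_proj _ _ _ _ _ _ L).
Local Notation u := (@lb_coord _ _ _ _ _ _ L).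
Local Notation sec := (@lb_sec _ _ _ _ _ _ L).
Implicit Types (a b : dv_index D) (x : M) (y : L).

Lemma fEC : fin_coord (E * C)%type.
Proof. exact: fc_prod fE (fc_C R). Qed.

Lemma open_near (A : set M) x : open A -> A x -> \forall y \near x, A y.
Proof. by move=> oA Ax; apply: open_nbhs_nbhs; split. Qed.

Lemma U_near a x : U a x -> \forall x' \near x, U a x'.
Proof. by apply: open_near; exact: dv_open_open. Qed.

Definition in_triv a j y := U a (pi y) /\ cm_dom M j (pi y).
(** The trivialization (pi, u_a) over U_a, with the base read in the chart [j]. *)
Definition tcoord a j y : E * C := (cm_chart M j (pi y), u a y).

Lemma pi_near (P : M -> Prop) y : (\forall x \near pi y, P x) -> \forall y' \near y, P (pi y').
Proof. by move=> h; exact: (map_cont (x := y) (lb_proj_holo (l := L)) h). Qed.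

Lemma in_triv_near a j y : in_triv a j y -> \forall y' \near y, in_triv a j y'.
Proof.
by move=> [h1 h2]; have := pi_near (U_near h1); apply: filterS2 (pi_near (dom_near h2)) => ? ? ?.
Qed.

Lemma in_triv_ex y : exists a j, in_triv a j y.
Proof. by have [a ha] := dv_cover D (pi y); have [j hj] := cm_cover (pi y); exists a, j. Qed.

Lemma vholo_u a y : U a (pi y) -> vholo_at (u a) y.
Proof. exact: lb_coord_holo. Qed.

Lemma vholo_pi (F : normedModType C) (f : M -> F) y : vholo_at f (pi y) -> vholo_at (f \o pi) y.
Proof. exact: map_vholo (lb_proj_holo (l := L)). Qed.

Lemma vholo_tcoord a j y : in_triv a j y -> vholo_at (tcoord a j) y.
Proof.
by move=> [h1 h2]; apply: vholo_pair (vholo_pi (chart_vholo h2)) (vholo_u h1).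
Qed.

Lemma triv_param a j y : in_triv a j y -> holo_param_at (lb_triv L a j) (tcoord a j y).
Proof. by move=> [h1 h2]; exact: lb_triv_holo. Qed.

Lemma trivK a j y : in_triv a j y -> lb_triv L a j (tcoord a j y) = y.
Proof. by move=> [h1 h2]; rewrite /lb_triv /= cm_chartK // lb_secK. Qed.

Lemma tcoord_triv_near a j y : in_triv a j y ->
  \forall z \near tcoord a j y, tcoord a j (lb_triv L a j z) = z.
Proof.
move=> [h1 h2]; have n1 := near_fst (u a y) (inv_near h2).
have n2 := near_fst (u a y) (inv_near_of h2 (U_near h1)).
move: n1; apply: filterS2 n2 => z /= Uz [dz cz].
by rewrite /tcoord /lb_triv /= lb_sec_proj // lb_sec_coord // cz; case: (z).
Qed.

(** In charts, the trivialization and [lb_triv] are inverse to each other, and so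
    are their differentials. *)
Lemma triv_charE a j i y (v w : E * C) : in_triv a j y -> cm_dom L i y ->
  v = 'd (cm_chart L i \o lb_triv L a j) (tcoord a j y) w <->
  'd (tcoord a j \o cm_inv L i) (cm_chart L i y) v = w.
Proof.
move=> vy di; pose G := cm_chart L i \o lb_triv L a j; pose H := tcoord a j \o cm_inv L i.
have Hy : H (cm_chart L i y) = tcoord a j y by rewrite /H /= cm_chartK.
have Gy : G (tcoord a j y) = cm_chart L i y by rewrite /G /= trivK.
have dH : differentiable H (cm_chart L i y) := vholo_tcoord vy di.
have dG : differentiable G (tcoord a j y).
  by have [_ h] := triv_param vy; apply: h; rewrite trivK.
have GH : \forall z \near cm_chart L i y, z = G (H z).
  have n1 := inv_near di; have n2 := inv_near_of di (in_triv_near vy).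
  by move: n1; apply: filterS2 n2 => z v1 [d1 d2]; rewrite /G /H /= trivK.
have HG : \forall z \near tcoord a j y, z = H (G z).
  have [hc _] := triv_param vy.
  have n1 : \forall z \near tcoord a j y, cm_dom L i (lb_triv L a j z).
    by apply: hc; rewrite trivK //; exact: dom_near.
  by move: n1; apply: filterS2 (tcoord_triv_near vy) => z e d; rewrite /H /G /= cm_chartK.
have dG' : differentiable G (H (cm_chart L i y)) by rewrite Hy.
have dH' : differentiable H (G (tcoord a j y)) by rewrite Gy.
have e1 := isd_uniq (isd_comp (isd_of dH) (isd_of dG')) (is_diff_near GH (isd_id (cm_chart L i y))).
have e2 := isd_uniq (isd_comp (isd_of dG) (isd_of dH')) (is_diff_near HG (isd_id (tcoord a j y))).
rewrite Hy in e1; rewrite Gy in e2.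
split=> [e|e]; last exact: etrans (esym (e1 v)) (congr1 _ e).
exact: etrans (congr1 _ e) (e2 w).
Qed.

(** At [y] the field [V] projects to [X] and multiplies u_a by h_a: this is
    [trivialized_as], phrased with derivatives of functions along [V] instead of
    the differential of the inverse trivialization. *)
Definition over_at (V : vfield L) (X : vfield M) (h : dv_index D -> M -> C) i y := forall a j, in_triv a j y ->
  along V (tcoord a j) i y = (X j (pi y), h a (pi y) * u a y).

Lemma trivializedE (V : vfield L) (X : vfield M) (h : dv_index D -> M -> C) :
  (forall a, trivialized_as a V X (h a)) <-> (forall y i, cm_dom L i y -> over_at V X h i y).
Proof.
split=> [H y i di a j vy|H a y i j h1 di h2].
  by apply/(triv_charE _ _ vy di); case: vy => h1 h2; exact: H.
by apply/(triv_charE _ _ (conj h1 h2) di); exact: H.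
Qed.

Lemma along_tcoord_inj (V W : vfield L) a j i y : in_triv a j y -> cm_dom L i y ->
  along V (tcoord a j) i y = along W (tcoord a j) i y -> V i y = W i y.
Proof.
move=> vy di e; have [_ h1] := triv_charE (V i y) (along W (tcoord a j) i y) vy di.
have [_ h2] := triv_charE (W i y) (along W (tcoord a j) i y) vy di.
by rewrite (h1 e) {1}(h2 erefl).
Qed.

Lemma over_unique_vert (V W : vfield L) (X : vfield M) h : holo_vfield V -> holo_vfield W ->
  (forall y i, cm_dom L i y -> over_at V X h i y) ->
  (forall y i, cm_dom L i y -> over_at W X h i y) -> V = W.
Proof.
move=> [oV _ _] [oW _ _] hV hW; apply/funext => i; apply/funext => y.
have [di|ndi] := pselect (cm_dom L i y); last by rewrite oV // oW.
have [a [j vy]] := in_triv_ex y; apply: (along_tcoord_inj vy di).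
by rewrite (hV y i di a j vy) (hW y i di a j vy).
Qed.

Lemma over_unique_base (V : vfield L) (X Y : vfield M) h k : holo_vfield X -> holo_vfield Y ->
  (forall y i, cm_dom L i y -> over_at V X h i y) ->
  (forall y i, cm_dom L i y -> over_at V Y k i y) -> X = Y.
Proof.
move=> [oX _ _] [oY _ _] hX hY; apply/funext => j; apply/funext => x.
have [dj|ndj] := pselect (cm_dom M j x); last by rewrite oX // oY.
have [a ha] := dv_cover D x; pose y := sec a x 0.
have py : pi y = x by exact: lb_sec_proj.
have [i di] := cm_cover (y : L).
have vy : in_triv a j y by rewrite /in_triv py.
have := hX y i di a j vy; rewrite (hY y i di a j vy) py => /(congr1 fst) /= ->.
by [].
Qed.

Lemma along_pi (V : vfield L) (X : vfield M) h i y (F : normedModType C) (f : M -> F) j : cm_dom L i y -> over_at V X h i y ->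
  cm_dom M j (pi y) -> vholo_at f (pi y) -> along V (f \o pi) i y = along X f j (pi y).
Proof.
move=> di hV dj hf; have [a [_ [ha _]]] := in_triv_ex y.
have hp := lb_proj_holo (l := L).
rewrite (along_chain V hp di dj hf) /along; congr ('d _ _ _).
have := hV a j (conj ha dj); rewrite /tcoord along_pair //; last first.
  exact: vholo_u.
  exact: (vholo_pi (chart_vholo dj)).
by move=> /(congr1 fst).
Qed.

Lemma along_u (V : vfield L) (X : vfield M) h i y a : cm_dom L i y -> over_at V X h i y ->
  U a (pi y) -> along V (u a) i y = h a (pi y) * u a y.
Proof.
move=> di hV ha; have [j dj] := cm_cover (pi y).
have := hV a j (conj ha dj); rewrite /tcoord along_pair //; last first.
  exact: vholo_u.
  exact: (vholo_pi (chart_vholo dj)).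
by move=> /(congr1 snd).
Qed.

(** This makes the fields X + h_a u_a d/du_a agree on overlaps. *)
Definition cocycle_rule (X : vfield M) (h : dv_index D -> M -> C) := forall a b x j, U a x -> U b x ->
  cm_dom M j x -> along X (t a b) j x = (h a x - h b x) * t a b x.

Lemma vholo_t a b x : U a x -> U b x -> vholo_at (t a b) x.
Proof. by move=> ha hb; have [] := dv_trans_holo ha hb. Qed.

(** Along [V] one has V u_b = (X t_ba) u_a + t_ba V u_a, which is h_b u_b by the
    cocycle rule. *)
Lemma over_indep (V : vfield L) (X : vfield M) h i y a j : holo_vfield X -> cocycle_rule X h ->
  cm_dom L i y -> in_triv a j y ->
  along V (tcoord a j) i y = (X j (pi y), h a (pi y) * u a y) -> over_at V X h i y.
Proof.
move=> hX hc di [ha dj]; rewrite /tcoord along_pair //; last first.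
  exact: vholo_u.
  exact: (vholo_pi (chart_vholo dj)).
case=> e1 e2 a' j' [ha' dj']; rewrite /tcoord along_pair //; last first.
  exact: vholo_u.
  exact: (vholo_pi (chart_vholo dj')).
have hp := lb_proj_holo (l := L).
have push (F : normedModType C) (f : M -> F) : vholo_at f (pi y) -> along V (f \o pi) i y = along X f j (pi y).
  by move=> hf; rewrite (along_chain V hp di dj hf) /along; congr ('d _ _ _).
congr (_, _).
  rewrite (push _ _ (chart_vholo dj')); case: hX => _ _ h'; exact: esym (h' j j' (pi y) dj dj').
have nE : \forall y' \near y, t a' a (pi y') * u a y' = u a' y'.
  have n1 := pi_near (U_near ha); have n2 := pi_near (U_near ha').
  by move: n1; apply: filterS2 n2 => y' h1 h2; rewrite (lb_coord_trans (l := L) h1 h2).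
have ht := vholo_t ha' ha.
have hm : vholo_at (fun y' : L => t a' a (pi y') * u a y') y.
  exact: vholoM (vholo_pi ht) (vholo_u ha).
rewrite (along_near V di hm nE).
rewrite (alongM V di (vholo_pi ht) (vholo_u ha)) e2 (push _ _ ht) (hc _ _ _ _ ha' ha dj).
rewrite (lb_coord_trans (l := L) ha' ha) /=; ring.
Qed.

(** At each point the value of the field is prescribed by any trivialization there;
    by [over_indep] the choice does not matter, so that the field is holomorphic. *)
Lemma lift_exists (X : vfield M) h : holo_vfield X ->
  (forall a x, U a x -> vholo_at (h a) x) -> cocycle_rule X h ->
  exists2 V : vfield L, holo_vfield V & forall y i, cm_dom L i y -> over_at V X h i y.
Proof.
move=> hX hh hc.
(* Off the domain of a chart the components of a field are 0 by convention. *)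
have ex (iy : cm_index L * L) : exists v : E * C, (cm_dom L iy.1 iy.2 ->
    exists a j, in_triv a j iy.2 /\ v = 'd (cm_chart L iy.1 \o lb_triv L a j) (tcoord a j iy.2) (X j (pi iy.2), h a (pi iy.2) * u a iy.2)) /\
    (~ cm_dom L iy.1 iy.2 -> v = 0).
  have [di|ndi] := pselect (cm_dom L iy.1 iy.2); last by exists 0; split.
  have [a [j vy]] := in_triv_ex iy.2.
  exists ('d (cm_chart L iy.1 \o lb_triv L a j) (tcoord a j iy.2) (X j (pi iy.2), h a (pi iy.2) * u a iy.2)).
  by split=> [_|nd]; [exists a, j | case: (nd di)].
have [f hf] := choice ex.
pose V : vfield L := fun i y => f (i, y).
have ovV y i : cm_dom L i y -> over_at V X h i y.
  move=> di; have [/(_ di) [a [j [vy e]]] _] := hf (i, y).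
  apply: (over_indep hX hc di vy).
  by apply/(triv_charE _ _ vy di).
exists V => //; split.
- by move=> i y ndi; have [_] := hf (i, y); apply.
- move=> i y di; have [a [j vy]] := in_triv_ex y.
  pose G := cm_chart L i \o lb_triv L a j.
  pose W (y' : L) : E * C := (X j (pi y'), h a (pi y') * u a y').
  have nG : \forall z \near tcoord a j y, differentiable G z.
    have n1 := near_fst (u a y) (inv_near vy.2); have n2 := near_fst (u a y) (inv_near_of vy.2 (U_near vy.1)).
    have [hc' _] := triv_param vy.
    have n3 : \forall z \near tcoord a j y, cm_dom L i (lb_triv L a j z).
      by apply: hc'; rewrite trivK //; exact: dom_near.
    have n4 : \forall z \near tcoord a j y, holo_param_at (lb_triv L a j) z.
      move: n1; apply: filterS2 n2 => -[z1 z2] /= Uz [dz cz].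
      by have := lb_triv_holo L z2 Uz dz; rewrite cz.
    by move: n3; apply: filterS2 n4 => z [_ h4] dz; apply: h4.
  have hW : vholo_at W y.
    apply: vholo_pair; first exact: (vholo_pi (field_vholo hX vy.2)).
    exact: vholoM (vholo_pi (hh a _ vy.1)) (vholo_u vy.1).
  pose T (x : (E * C) * (E * C)) := 'd G (x.1 : (E * C)%type) x.2.
  have dT : differentiable T (tcoord a j y, W y) := tangentF (W y) fEC nG.
  have hTW : vholo_at (fun y' => (tcoord a j y', W y')) y := vholo_pair (vholo_tcoord vy) hW.
  have := vholo_comp hTW dT; move=> H; apply: (vholo_near _ H) => //.
  have := dom_near di; apply: filterS2 (in_triv_near vy) => y' vy' di'.
  by apply/esym/(triv_charE _ _ vy' di'); exact: ovV.
move=> i j y di dj; have [a [k vy]] := in_triv_ex y.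
have [_ h1] := triv_charE (V j y) (X k (pi y), h a (pi y) * u a y) vy dj.
have [_ h2] := triv_charE ('d (cm_chart L j \o cm_inv L i) (cm_chart L i y) (V i y)) (X k (pi y), h a (pi y) * u a y) vy dj.
rewrite (h1 (ovV y j dj a k vy)); symmetry; apply: h2.
rewrite -(ovV y i di a k vy) /along.
have dj' : cm_dom L j (cm_inv L i (cm_chart L i y)) by rewrite cm_chartK.
have dTh : differentiable (tcoord a k \o cm_inv L j) (cm_chart L j (cm_inv L i (cm_chart L i y))).
  by rewrite cm_chartK //; exact: vholo_tcoord.
refine (etrans _ (esym (isdE (param_comp (inv_param di) dj' dTh) (V i y)))).
by rewrite (cm_chartK di).
Qed.

(** In the trivialization the two fields are X + h u d/du and Y + k u d/du, whose
    bracket has no term in h k since u d/du commutes with itself. *)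
Lemma over_bracket (V W : vfield L) (X Y : vfield M) h k :
  holo_vfield V -> holo_vfield W -> holo_vfield X -> holo_vfield Y ->
  (forall a x, U a x -> vholo_at (h a) x) -> (forall a x, U a x -> vholo_at (k a) x) ->
  (forall y i, cm_dom L i y -> over_at V X h i y) ->
  (forall y i, cm_dom L i y -> over_at W Y k i y) ->
  forall y i a j, cm_dom L i y -> in_triv a j y ->
    along (lie_bracket V W) (tcoord a j) i y =
    (lie_bracket X Y j (pi y), (along X (k a) j (pi y) - along Y (h a) j (pi y)) * u a y).
Proof.
move=> hV hW hX hY hh hk oV oW y i a j di vy.
pose lf (Z : vfield M) (l : M -> C) (z : E * C) : E * C := (Z j (cm_inv M j z.1), l (cm_inv M j z.1) * z.2).
have lfE Z l y' : cm_dom M j (pi y') -> lf Z l (tcoord a j y') = (Z j (pi y'), l (pi y') * u a y').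
  by move=> d; rewrite /lf /= cm_chartK.
have dlf (Z : vfield M) (l : M -> C) : holo_vfield Z -> vholo_at l (pi y) ->
    is_diff (tcoord a j y) (lf Z l) (fun v => ('d (Z j \o cm_inv M j) (cm_chart M j (pi y)) v.1,
      l (pi y) * v.2 + u a y * 'd (l \o cm_inv M j) (cm_chart M j (pi y)) v.1)).
  move=> hZ hl; have d1 := nbhs_singleton (field_near hZ vy.2); have d2 := hl j vy.2.
  have f1 := isd_fst (tcoord a j y).
  have H := isd_pair (isd_comp f1 (isd_of d1)) (isd_mul (isd_comp f1 (isd_of d2)) (isd_snd (tcoord a j y))).
  by apply: (isd_ext H) => // v; rewrite /= cm_chartK //; exact: vy.2.
have dX := dlf X (h a) hX (hh a _ vy.1); have dY := dlf Y (k a) hY (hk a _ vy.1).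
have nn (Z : vfield L) (Z' : vfield M) l : (forall y i, cm_dom L i y -> over_at Z Z' l i y) ->
    \forall y' \near y, along Z (tcoord a j) i y' = lf Z' (l a) (tcoord a j y').
  move=> oZ; have := dom_near di; apply: filterS2 (in_triv_near vy) => y' vy' di'.
  by rewrite lfE ?(oZ y' i di' a j vy') //; exact: vy'.2.
have nTh : \forall y' \near y, vholo_at (tcoord a j) y'.
  by have := in_triv_near vy; apply: filterS => y'; exact: vholo_tcoord.
have B := bracket_push fEC hV hW di nTh (nn V X h oV) (nn W Y k oW) (isd_ex dX) (isd_ex dY).
refine (etrans B _).
have eX := isdE dX (lf Y (k a) (tcoord a j y)); have eY := isdE dY (lf X (h a) (tcoord a j y)).
refine (etrans (f_equal2 (fun p q => p - q) eY eX) _).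
rewrite !lfE; [|exact: vy.2..].
apply: injective_projections; rewrite /= /along.
  by rewrite lie_bracketE //; exact: vy.2.
have alg (kk hh' uu p q : C) : (kk * (hh' * uu) + uu * p) - (hh' * (kk * uu) + uu * q) = (p - q) * uu by ring.
exact: alg.
Qed.

End Bundle.

(** * The lift defined by a weight *)

Section Weights.
Variable R : realType.
Local Notation C := (Cplx R).
Variables (E : normedModType C) (fE : fin_coord E) (M : cmanifold E) (D : divisor M).
Local Notation U := (@dv_open _ _ _ D).
Local Notation t := (@dv_trans _ _ _ D).
Local Notation f := (@dv_fun _ _ _ D).
Implicit Types (a b : dv_index D) (x : M) (F G : normedModType C).

(** Identities involving f_a are proved at points as in the conclusion, and
    extended by [eq_dense]. *)
Lemma dense_pt a x (V : M -> Prop) : U a x -> (\forall y \near x, V y) ->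
  exists y, [/\ V y, U a y, mero_dom (f a) y & f a y != 0].
Proof.
move=> ax nV; have : nbhs x V by []; rewrite nbhsE => -[B [oB Bx] BV].
have oBU : open (B `&` U a) by apply: openI => //; exact: dv_open_open.
have ne : (B `&` U a) `&` mero_dom (f a) !=set0.
  by apply: mero_dom_dense => //; exists x.
have oV2 : open ((B `&` U a) `&` mero_dom (f a)) by apply: openI => //; exact: mero_dom_open.
have sub : (B `&` U a) `&` mero_dom (f a) `<=` mero_dom (f a) by move=> y [].
have [y [[By Uy] my] fy] := dv_fun_neq0 oV2 sub ne.
by exists y; split => //; exact: BV.
Qed.

Lemma dense_pt2 a b x (V : M -> Prop) : U a x -> U b x -> (\forall y \near x, V y) ->
  exists y, [/\ V y, U a y /\ U b y, mero_dom (f a) y, mero_dom (f b) y & f b y != 0].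
Proof.
move=> ax bx nV; have : nbhs x V by []; rewrite nbhsE => -[B [oB Bx] BV].
pose B1 := (B `&` U a) `&` U b.
have oB1 : open B1 by apply: openI; [apply: openI => //|]; exact: dv_open_open.
have sub1 : B1 `<=` U b by move=> y [].
have B1x : B1 x by [].
have ne : B1 `&` mero_dom (f b) !=set0 by apply: mero_dom_dense oB1 sub1 _; exists x.
have oB2 : open (B1 `&` mero_dom (f b)) by apply: openI => //; exact: mero_dom_open.
have sub2 : B1 `&` mero_dom (f b) `<=` U a by move=> y [[[]]].
have ne2 : (B1 `&` mero_dom (f b)) `&` mero_dom (f a) !=set0 by exact: mero_dom_dense oB2 sub2 ne.
have oB3 : open ((B1 `&` mero_dom (f b)) `&` mero_dom (f a)) by apply: openI => //; exact: mero_dom_open.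
have sub : (B1 `&` mero_dom (f b)) `&` mero_dom (f a) `<=` mero_dom (f b) by move=> y [[]].
have [y [[[[By Uay] Uby] mb] ma] fy] := dv_fun_neq0 oB3 sub ne2.
by exists y; split => //; exact: BV.
Qed.

Lemma eq_dense (p q : M -> C) x : {for x, continuous p} -> {for x, continuous q} ->
  (forall V : M -> Prop, (\forall y \near x, V y) -> exists2 y, V y & p y = q y) -> p x = q x.
Proof.
move=> cp cq h; apply: (@nr_eq _ _ _ _ 2) => e e0.
have np : \forall y \near x, nr (p y - p x) < e.
  by apply: (cp (fun w => nr (w - p x) < e)); apply/nbhs_nr; exists e.
have nq : \forall y \near x, nr (q y - q x) < e.
  by apply: (cq (fun w => nr (w - q x) < e)); apply/nbhs_nr; exists e.
have [|y [h1 h2] e12] := h (fun y => nr (p y - p x) < e /\ nr (q y - q x) < e).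
  by move: np; apply: filterS2 nq => y ? ?.
have -> : p x - q x = - (p y - p x) + (q y - q x) by rewrite -e12 opprB addrA subrK.
apply: le_trans (nrD _ _) _; rewrite nrN mulr_natl mulr2n.
by apply: lerD; apply: ltW.
Qed.

Lemma along_vholo F (X : vfield M) (k : M -> F) j x : fin_coord F -> holo_vfield X ->
  cm_dom M j x -> (\forall y \near x, vholo_at k y) -> vholo_at (along X k j) x.
Proof.
move=> fF hX dj hk; apply: (vholo_one dj).
apply: isd_ex (is_diff_near _ (isd_apply fF (vholo_nearby dj hk) (isd_of (nbhs_singleton (field_near hX dj))))).
by have := inv_near dj; apply: filterS => z [d1 d2]; rewrite /= /along d2.
Qed.

(** The second derivatives of [k] cancel by symmetry. *)
Lemma along_along (X Y : vfield M) (k : M -> C) j x : holo_vfield X -> holo_vfield Y ->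
  cm_dom M j x -> (\forall y \near x, vholo_at k y) ->
  along (lie_bracket X Y) k j x = along X (along Y k j) j x - along Y (along X k j) j x.
Proof.
move=> hX hY dj hk; have nk := vholo_nearby dj hk.
pose S (v w : E) := 'd (fun z => 'd (k \o cm_inv M j) z v) (cm_chart M j x) w.
have key (A B : vfield M) : holo_vfield A -> holo_vfield B ->
    along B (along A k j) j x = S (A j x) (B j x) +
      'd (k \o cm_inv M j) (cm_chart M j x) ('d (A j \o cm_inv M j) (cm_chart M j x) (B j x)).
  move=> hA hB; have H := isd_apply (fc_C R) nk (isd_of (nbhs_singleton (field_near hA dj))).
  have nn : \forall z \near cm_chart M j x,
      'd (k \o cm_inv M j) z ((A j \o cm_inv M j) z) = (along A k j \o cm_inv M j) z.
    by have := inv_near dj; apply: filterS => z [d1 d2]; rewrite /= /along d2.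
  have H2 := is_diff_near nn H.
  refine (etrans (isdE H2 (B j x)) _).
  by rewrite /S /= cm_chartK.
have e1 := key X Y hX hY; have e2 := key Y X hY hX.
have sym : S (X j x) (Y j x) = S (Y j x) (X j x) by exact: schwarz.
have alg (p q s s' : C) : s = s' -> p - q = (s' + p) - (s + q) by move=> ->; ring.
refine (etrans _ (esym (f_equal2 (fun p q => p - q) e2 e1))).
refine (etrans _ (alg _ _ _ _ sym)).
rewrite /along lie_bracketE //; exact: linearB.
Qed.

Variables (g : set (vfield M)) (lambda : dv_index D -> vfield M -> M -> C).
Hypotheses (lg : lie_algebra g) (wg : is_weight g lambda).

Lemma g_holo X : g X -> holo_vfield X.
Proof. by case: lg => h _ _ _; exact: h. Qed.

Lemma f_vholo a x : mero_dom (f a) x -> vholo_at (f a) x.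
Proof. exact: mero_holo. Qed.

Lemma mero_near a x : mero_dom (f a) x -> \forall y \near x, mero_dom (f a) y.
Proof. by move=> h; apply: open_nbhs_nbhs; split => //; exact: mero_dom_open. Qed.

Lemma weight_vholo X a x : g X -> U a x -> vholo_at (lambda a X) x.
Proof. by move=> gX ax; have [h _ _] := wg a; exact: h. Qed.

Lemma weight_along X a x j : g X -> mero_dom (f a) x -> cm_dom M j x ->
  along X (f a) j x = lambda a X x * f a x.
Proof. by move=> gX mx dj; have [_ _ h] := wg a; exact: (h X gX x mx j dj). Qed.

(** Differentiate f_a = t_ab f_b along [X] where both functions are holomorphic and
    divide by f_b. *)
Lemma weight_cocycle X : g X -> forall a b x j, U a x -> U b x -> cm_dom M j x ->
  along X (t a b) j x = (lambda a X x - lambda b X x) * t a b x.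
Proof.
move=> gX a b x j ax bx dj; have hX := g_holo gX.
have hab y : U a y -> U b y -> vholo_at (t a b) y by move=> ha hb; have [] := dv_trans_holo ha hb.
have Un c : U c x -> \forall y \near x, U c y by move=> h; apply: open_nbhs_nbhs; split => //; exact: dv_open_open.
apply: (eq_dense (p := along X (t a b) j) (q := fun y => (lambda a X y - lambda b X y) * t a b y)).
- apply: vholo_cont; apply: (along_vholo (fc_C R)) => //.
  by have := Un a ax; apply: filterS2 (Un b bx) => y ? ?; exact: hab.
- apply: vholo_cont; apply: vholoM; last exact: hab.
  by move=> i di; exact: isd_ex (isd_sub (isd_of (weight_vholo gX ax di)) (isd_of (weight_vholo gX bx di))).
move=> V nV; have nVj : \forall y \near x, V y /\ cm_dom M j y.
  by have := dom_near dj; apply: filterS2 nV => ? ? ?.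
have [y [[Vy djy] [Uay Uby] ma mb fy]] := dense_pt2 ax bx nVj.
exists y => //.
have nE : \forall y' \near y, t a b y' * f b y' = f a y'.
  by have := mero_near ma; apply: filterS2 (mero_near mb) => y' h1 h2; rewrite (dv_transE h2 h1).
have hm : vholo_at (fun y => t a b y * f b y) y := vholoM (hab _ Uay Uby) (f_vholo mb).
have e1 := along_near X djy hm nE.
rewrite (alongM X djy (hab _ Uay Uby) (f_vholo mb)) !weight_along // (dv_transE ma mb) in e1.
apply: (mulfI fy); rewrite -[LHS](addKr (t a b y * (lambda b X y * f b y))) -e1; ring.
Qed.

(** Compute [X, Y] f_a with [along_along]: the terms lambda_a(X) lambda_a(Y) f_a
    cancel, and f_a can be divided out. *)
Lemma weight_bracket X Y a x j : g X -> g Y -> U a x -> cm_dom M j x ->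
  lambda a (lie_bracket X Y) x = along X (lambda a Y) j x - along Y (lambda a X) j x.
Proof.
move=> gX gY ax dj; have hX := g_holo gX; have hY := g_holo gY.
have gXY : g (lie_bracket X Y) by case: lg => _ _ _; apply.
have Ua : \forall y \near x, U a y by apply: open_nbhs_nbhs; split => //; exact: dv_open_open.
have nl Z : g Z -> \forall y \near x, vholo_at (lambda a Z) y.
  by move=> gZ; move: Ua; apply: filterS => y; exact: weight_vholo.
apply: (eq_dense (p := lambda a (lie_bracket X Y)) (q := fun x => along X (lambda a Y) j x - along Y (lambda a X) j x)).
- by apply: vholo_cont; exact: weight_vholo.
- apply: vholo_cont => i di.
  have h1 := along_vholo (fc_C R) hX dj (nl Y gY); have h2 := along_vholo (fc_C R) hY dj (nl X gX).
  exact: isd_ex (isd_sub (isd_of (h1 i di)) (isd_of (h2 i di))).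
move=> V nV; have nVj : \forall y \near x, V y /\ cm_dom M j y.
  by have := dom_near dj; apply: filterS2 nV => ? ? ?.
have [y [[Vy djy] Uy my fy]] := dense_pt ax nVj.
exists y => //.
have nf : \forall y' \near y, vholo_at (f a) y'.
  by have := mero_near my; apply: filterS => y'; exact: f_vholo.
have e := along_along hX hY djy nf.
have key A B : g A -> g B -> along B (along A (f a) j) j y =
    lambda a A y * (lambda a B y * f a y) + f a y * along B (lambda a A) j y.
  move=> gA gB; have n : \forall y' \near y, lambda a A y' * f a y' = along A (f a) j y'.
    by have := mero_near my; apply: filterS2 (dom_near djy) => y' d m; rewrite weight_along.
  rewrite (along_near B djy (vholoM (weight_vholo gA Uy) (f_vholo my)) n).
  by rewrite (alongM B djy (weight_vholo gA Uy) (f_vholo my)) weight_along.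
rewrite (key X Y gX gY) (key Y X gY gX) weight_along // in e.
apply: (mulfI fy); rewrite mulrC e; ring.
Qed.

Lemma weight0 a x : U a x -> lambda a 0 x = 0.
Proof.
move=> ax; have [_ h _] := wg a; have g0 : g 0 by case: lg.
have e := h 1 0 0 g0 g0 x ax; rewrite scale1r addr0 mul1r in e.
by apply: (addrI (lambda a 0 x)); rewrite addr0 -e.
Qed.

Variable L : divisor_bundle D.
Local Notation pi := (@lb_proj _ _ _ _ _ _ L).
Local Notation u := (@lb_coord _ _ _ _ _ _ L).

Let ghat := weight_lift L g lambda.

Lemma weight_liftP V : ghat V <-> holo_vfield V /\ exists2 X, g X &
  forall y i, cm_dom L i y -> over_at V X (fun a => lambda a X) i y.
Proof.
split=> -[hV [X gX h]]; split => //; exists X => //.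
  exact: (proj1 (trivializedE V X (fun a => lambda a X)) h).
exact: (proj2 (trivializedE V X (fun a => lambda a X)) h).
Qed.

Lemma holo_lin F (N : cmanifold F) (c : C) (V W : vfield N) : holo_vfield V -> holo_vfield W ->
  holo_vfield (c *: V + W).
Proof.
move=> [v1 v2 v3] [w1 w2 w3]; have E1 i y : (c *: V + W) i y = c *: V i y + W i y by [].
split.
- by move=> i x nd; rewrite E1 v1 // w1 // scaler0 addr0.
- move=> i x di; exact: isd_ex (isd_add (isd_scalek c (isd_of (v2 i x di))) (isd_of (w2 i x di))).
move=> i j x di dj; rewrite !E1 (v3 i j x di dj) (w3 i j x di dj).
exact: esym (linearP _ c _ _).
Qed.

Lemma holo0 F (N : cmanifold F) : holo_vfield (0 : vfield N).
Proof.
have E1 i y : (0 : vfield N) i y = 0 by [].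
split => //.
- by move=> i x di; exact: isd_ex (isd_cst (0 : F) (cm_chart N i x)).
by move=> i j x di dj; rewrite !E1; symmetry; exact: linear0.
Qed.

Lemma over_lin (c : C) (V W : vfield L) X Y : g X -> g Y ->
  (forall y i, cm_dom L i y -> over_at V X (fun a => lambda a X) i y) ->
  (forall y i, cm_dom L i y -> over_at W Y (fun a => lambda a Y) i y) ->
  forall y i, cm_dom L i y -> over_at (c *: V + W) (c *: X + Y) (fun a => lambda a (c *: X + Y)) i y.
Proof.
move=> gX gY oV oW y i di a j vy.
have e1 := oV y i di a j vy; have e2 := oW y i di a j vy.
have e : along (c *: V + W) (tcoord a j) i y = c *: along V (tcoord a j) i y + along W (tcoord a j) i y.
  exact: linearP.
refine (etrans e _); rewrite e1 e2.
have [_ h _] := wg a; rewrite (h c X Y gX gY _ vy.1).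
apply: injective_projections => //=.
by rewrite -[c *: _]/(c * _) mulrDl mulrA.
Qed.

Lemma over_br (V W : vfield L) X Y : g X -> g Y -> holo_vfield V -> holo_vfield W ->
  (forall y i, cm_dom L i y -> over_at V X (fun a => lambda a X) i y) ->
  (forall y i, cm_dom L i y -> over_at W Y (fun a => lambda a Y) i y) ->
  forall y i, cm_dom L i y ->
   over_at (lie_bracket V W) (lie_bracket X Y) (fun a => lambda a (lie_bracket X Y)) i y.
Proof.
move=> gX gY hV hW oV oW y i di a j vy.
rewrite (over_bracket fE hV hW (g_holo gX) (g_holo gY) (fun a x => weight_vholo gX) (fun a x => weight_vholo gY) oV oW di vy).
by rewrite (weight_bracket gX gY vy.1 vy.2).
Qed.

Lemma weight_lift_lie : lie_algebra ghat.
Proof.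
have g0 : g 0 by case: lg.
split.
- by move=> V [].
- apply/weight_liftP; split; first exact: holo0.
  exists 0 => // y i di a j vy; rewrite (weight0 vy.1) mul0r.
  exact: linear0.
- move=> c V W /weight_liftP [hV [X gX oV]] /weight_liftP [hW [Y gY oW]]; apply/weight_liftP; split; first exact: holo_lin.
  exists (c *: X + Y); first by case: lg => _ _ h _; exact: h.
  exact: over_lin.
move=> V W /weight_liftP [hV [X gX oV]] /weight_liftP [hW [Y gY oW]]; apply/weight_liftP; split.
  exact: (holo_bracket (fEC fE)).
exists (lie_bracket X Y); first by case: lg => _ _ _; apply.
exact: over_br.
Qed.

Lemma cst_vholo F (N : cmanifold F) (c : C) (x : N) : vholo_at (fun _ : N => c) x.
Proof. by move=> i di; exact: isd_ex (isd_cst c (cm_chart N i x)). Qed.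

Lemma along_cst F (N : cmanifold F) (V : vfield N) (c : C) i (x : N) : along V (fun _ : N => c) i x = 0.
Proof. exact: isdE (isd_cst c (cm_chart N i x)) (V i x). Qed.

Lemma along0 F G (N : cmanifold F) (k : N -> G) i (x : N) : along 0 k i x = 0.
Proof. exact: linear0. Qed.

Lemma lie_bracket0r (X : vfield M) : holo_vfield X -> lie_bracket X 0 = 0.
Proof.
move=> hX; apply/funext => i; apply/funext => x.
have [di|ndi] := pselect (cm_dom M i x); last by rewrite lie_bracket_out.
rewrite lie_bracketE //.
have e1 : 'd ((0 : vfield M) i \o cm_inv M i) (cm_chart M i x) (X i x) = 0.
  exact: isdE (isd_cst (0 : E) (cm_chart M i x)) (X i x).
have e2 : 'd (X i \o cm_inv M i) (cm_chart M i x) ((0 : vfield M) i x) = 0 by exact: linear0.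
refine (etrans (f_equal2 (fun p q => p - q) e1 e2) _).
by rewrite subrr.
Qed.

(** The Euler field is itself a lift, of the zero field with constant weight 1, so
    that [over_bracket] shows that it commutes with the lift.  The projection is a
    bijection because a field of the lift determines the field below it
    ([over_unique_base]) and, the weight being given, is determined by it
    ([over_unique_vert]). *)
Lemma is_lift_weight_lift : is_lift g ghat.
Proof.
split; first exact: weight_lift_lie.
  have [|e he oe] := @lift_exists R E fE M D L 0 (fun _ _ => 1) (holo0 M) (fun _ _ _ => @cst_vholo _ _ _ _).
    by move=> a b x j _ _ _; rewrite along0 subrr mul0r.
  exists e; first by split => //; exact: (proj2 (trivializedE e 0 (fun _ _ => 1)) oe).
  move=> V /weight_liftP [hV [X gX oV]].
  apply: (@over_unique_vert R E M D L _ 0 0 (fun _ _ => 0)).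
  - exact: (holo_bracket (fEC fE)).
  - exact: holo0.
  - move=> y i di a j vy.
    rewrite (over_bracket fE hV he (g_holo gX) (holo0 M) (fun a x => weight_vholo gX) (fun a x _ => @cst_vholo _ _ _ _) oV oe di vy).
    by rewrite lie_bracket0r ?along_cst ?along0 ?subrr //; exact: g_holo.
  - by move=> y i di a j vy; rewrite mul0r; exact: linear0.
have ex (V : vfield L) : exists X : vfield M, ghat V -> g X /\ forall y i, cm_dom L i y -> over_at V X (fun a => lambda a X) i y.
  by have [/weight_liftP [hV [X gX oV]]|nV] := pselect (ghat V); [exists X|exists 0].
have [dpi hd] := choice ex.
exists dpi.
have uniq V X : ghat V -> g X -> (forall y i, cm_dom L i y -> over_at V X (fun a => lambda a X) i y) -> dpi V = X.
  move=> gV gX oV; have [gd od] := hd V gV.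
  exact: (over_unique_base (g_holo gd) (g_holo gX) od oV).
split.
- move=> V gV y i j di dj; have [gX oV] := hd V gV.
  have := along_pi di (oV y i di) dj (chart_vholo dj).
  by rewrite (along_id _ dj).
- split.
  + by move=> V /= gV; case: (hd V gV).
  + move=> V W; rewrite !inE => gV gW e; have [gX oV] := hd V gV; have [gY oW] := hd W gW.
    rewrite e in oV.
    by apply: (over_unique_vert _ _ oV oW); [case: gV|case: gW].
  + move=> X gX; have [V hV oV] := lift_exists fE L (g_holo gX) (fun a x => weight_vholo gX) (weight_cocycle gX).
    have gV : ghat V by apply/weight_liftP; split => //; exists X.
    by exists V => //; exact: uniq.
- move=> c V W gV gW; have [gX oV] := hd V gV; have [gY oW] := hd W gW.
  have [_ _ hl _] := weight_lift_lie; have [_ _ hg _] := lg.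
  by apply: uniq; [exact: hl|exact: hg|exact: over_lin].
- move=> V W gV gW; have [gX oV] := hd V gV; have [gY oW] := hd W gW.
  have [hh _ _ hl] := weight_lift_lie; have [_ _ _ hg] := lg.
  by apply: uniq; [exact: hl|exact: hg|apply: over_br => //; exact: hh].
Qed.

End Weights.

(** * Extending a quotient along a flow *)

Section Transport.
Variable R : realType.
Local Notation C := (Cplx R).
Implicit Types E F : normedModType C.

Lemma const_ball (h : C -> C) (r : R) : 
  (forall s, nr s < r -> differentiable h s) -> (forall s, nr s < r -> 'd h s 1 = 0) ->
  forall s, nr s < r -> h s = h 0.
Proof.
move=> dh h0 s sr.
have n0 : nr (0 : C) = 0 := nr0 C.
have rn : nr (0 - 0 : C) < r by rewrite subrr n0; apply: le_lt_trans sr; exact: nr_ge0.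
have sn : nr (s - 0) < r by rewrite subr0.
have seg (t : R) : 0 <= t <= 1 -> nr (0 + rc t *: (s - 0)) < r.
  by move=> tI; have := seg_in_ball rn sn tI; rewrite subr0.
have := @mean_value R C h 0 s 0 (fun t tI => dh _ (seg t tI)) _.
rewrite mulr0 => H; apply: subr0_eq; apply: nr_eq0; apply/eqP; rewrite eq_le nr_ge0 andbT.
apply: H => t tI; rewrite diff_C (h0 _ (seg t tI)) mulr0 n0 //.
Qed.

Lemma quot_alg (A B K p q r l : C) : B != 0 -> K != 0 -> p * B - A * q = l * A * B -> r = l * K ->
  A * (- (B * K) ^- 2 * (B * r + K * q)) + (B * K)^-1 * p = 0.
Proof.
move=> B0 K0 e ->; have -> : p = (l * A * B + A * q) / B by rewrite -e subrK mulfK.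
by field; rewrite B0 K0.
Qed.

(** Where [b] does not vanish the logarithmic derivatives show that a / (b k) is
    constant; the identity theorem extends the conclusion across the zeros of [b]. *)
Lemma wronskian (a b k l : C -> C) (eps M : R) : 0 < eps ->
  (forall s, nr s < eps -> [/\ differentiable a s, differentiable b s & differentiable k s]) ->
  (forall s, nr s < eps -> [/\ nr (a s) <= M, nr (b s) <= M & nr (k s) <= M]) ->
  (forall s, nr s < eps -> 'd a s 1 * b s - a s * 'd b s 1 = l s * a s * b s) ->
  (forall s, nr s < eps -> 'd k s 1 = l s * k s) ->
  (forall s, nr s < eps -> k s != 0) -> k 0 = 1 -> b 0 != 0 ->
  forall s, nr s < eps / 16 -> a 0 * b s * k s = a s * b 0.
Proof.
move=> eps0 dd hM hw hk kz k0 b0.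
have n0 : nr (0 : C) = 0 := nr0 C.
have e00 : nr (0 : C) < eps by rewrite n0.
have M0 : 0 <= M by have [h _ _] := hM 0 e00; apply: le_trans h; exact: nr_ge0.
pose N s := a 0 * b s * k s - a s * b 0.
have [_ db0 _] := dd 0 e00.
have nb : 0 < nr (b 0) by rewrite nr_gt0.
have /cont_nr /(_ _ nb)[d d0 hd] := differentiable_continuous db0.
pose eta := Num.min d eps.
have eta0 : 0 < eta by rewrite lt_min d0.
have bz (s : C) : nr s < eta -> b s != 0.
  rewrite lt_min => /andP[sd _]; have := hd s; rewrite subr0 => /(_ sd) h.
  by apply: contraTN h => /eqP ->; rewrite sub0r nrN ltxx.
have se (s : C) : nr s < eta -> nr s < eps by rewrite lt_min => /andP[].
(* [h] is constant on the disc of radius [eta], where [b] does not vanish. *)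
pose h s := a s / (b s * k s).
have dh s : nr s < eta -> is_diff s h (fun v => v * 0).
  move=> sr; have [da db dk] := dd s (se s sr).
  have bk : b s * k s != 0 by rewrite mulf_neq0 ?bz ?kz ?se.
  have H := isd_C (isd_mul (isd_of da) (isd_inv (isd_mul (isd_of db) (isd_of dk)) bk)).
  apply: (isd_ext H) => // v; congr (_ * _).
  exact: (quot_alg (bz s sr) (kz s (se s sr)) (hw s (se s sr)) (hk s (se s sr))).
have hc s : nr s < eta -> h s = h 0.
  apply: const_ball => z zr; first exact: isd_ex (dh z zr).
  by refine (etrans (isdE (dh z zr) 1) _); rewrite mulr0.
have N0 s : nr s < eta -> N s = 0.
  move=> sr; have := hc s sr; rewrite /h /N k0 mulr1 => e.
  have bs := bz s sr; have ks := kz s (se s sr).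
  have -> : a s = a 0 / b 0 * (b s * k s) by rewrite -e divfK // mulf_neq0.
  by field.
move=> s sr; suff Ns : N s = 0 by exact: subr0_eq Ns.
refine (@identity_disc R N eps eta (M * M * M + M * M) eps0 eta0 _ _ N0 s sr).
  move=> z ze; have [da db dk] := dd z ze.
  exact: isd_ex (isd_sub (isd_mul (isd_mul (isd_cst (a 0) z) (isd_of db)) (isd_of dk)) (isd_mul (isd_of da) (isd_cst (b 0) z))).
move=> z ze; have [ma mb mk] := hM z ze; have [ma0 mb0 _] := hM 0 e00.
apply: le_trans (nrB _ _) _; rewrite !nrM; apply: lerD; last by apply: ler_pM; rewrite ?nr_ge0.
apply: ler_pM; rewrite ?mulr_ge0 ?nr_ge0 //.
by apply: ler_pM; rewrite ?nr_ge0.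
Qed.

(** Let phi_s be the flow of [X] and k_s the solution of k' = l k along it, with
    k_0 = 1.  By [wronskian], A(z) B(phi_s z) k_s(z) = A(phi_s z) B(z).  Since [c1]
    is the flow line of z0, [F0] is the quotient A / B near phi_s(z0) for s = s1;
    so F0(phi_s z) / k_s(z) is this quotient near z0. *)
Theorem quotient_transport E (X : E -> E) (l A B : E -> C) (z0 : E) (delta : R) (c1 : C -> E) (r0 : R) :
  fin_coord E -> 0 < delta -> 0 < r0 ->
  (forall z, nr (z - z0) < delta -> [/\ differentiable X z, differentiable l z, differentiable A z & differentiable B z]) ->
  (forall z, nr (z - z0) < delta -> 'd A z (X z) * B z - A z * 'd B z (X z) = l z * A z * B z) ->
  (forall z (r : R), nr (z - z0) < delta -> 0 < r -> exists2 w, nr (w - z) < r & B w != 0) ->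
  (forall s, nr s < r0 -> differentiable c1 s /\ 'd c1 s 1 = X (c1 s)) -> c1 0 = z0 ->
  exists2 r : R, 0 < r & forall s1, nr s1 < r -> forall F0 : E -> C,
    (\forall z \near c1 s1, [/\ differentiable F0 z, F0 z != 0 & B z * F0 z = A z]) ->
    exists F : E -> C, \forall z \near z0, [/\ differentiable F z, F z != 0 & B z * F z = A z].
Proof.
move=> fE delta0 r00 dd hw hB hc c10.
have n0 : nr (0 : C) = 0 := nr0 C.
have p0 : nr (z0 - z0) < delta by rewrite subrr nr0.
have [rA [MA [rA0 rAd MA0 hA]]] := diff_bounded delta0 (fun z h => let: And4 _ _ d _ := dd z h in d).
have [rB [MB [rB0 rBd MB0 hBb]]] := diff_bounded delta0 (fun z h => let: And4 _ _ _ d := dd z h in d).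
pose M := MA + MB + 2.
have MAM : MA <= M by rewrite /M; lra.
have MBM : MB <= M by rewrite /M; lra.
have M2 : 3 / 2 <= M by rewrite /M; lra.
have kaM (k : C) : nr (k - 1) < 1 / 2 -> nr k <= M.
  by move=> h; apply: le_trans M2; have := nrD (k - 1) 1; rewrite subrK nr1; lra.
pose de := Num.min (Num.min rA rB) (1 / 2).
have de0 : 0 < de by rewrite !lt_min rA0 rB0 divr_gt0.
have deA z : nr (z - z0) < de -> nr (z - z0) < rA by rewrite !lt_min => /andP[/andP[]].
have deB z : nr (z - z0) < de -> nr (z - z0) < rB by rewrite !lt_min => /andP[/andP[]].
have ded z : nr (z - z0) < de -> nr (z - z0) < delta by move=> /deA h; apply: lt_le_trans rAd.
(* The flow and the factor k_s are obtained together, as the flow of (X, l k) on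
   E * C started at (z, 1). *)
pose X2 (x : E * C) : E * C := (X x.1, l x.1 * x.2).
pose p2 : E * C := (z0, 1).
have fEC : fin_coord (E * C)%type := fc_prod fE (fc_C R).
have p2_1 (x : E * C) e : nr (x - p2) < e -> nr (x.1 - z0) < e.
  by apply: le_lt_trans; exact: (nr_fst (x - p2)).
have p2_2 (x : E * C) e : nr (x - p2) < e -> nr (x.2 - 1) < e.
  by apply: le_lt_trans; exact: (nr_snd (x - p2)).
have dX2 x : nr (x - p2) < de -> differentiable X2 x.
  move=> /p2_1 /ded /dd [dX dl _ _].
  have f1 := isd_fst x.
  exact: isd_ex (isd_pair (isd_comp f1 (isd_of dX)) (isd_mul (isd_comp f1 (isd_of dl)) (isd_snd x))).
have [eps [rho [Phi [eps0 rho0 rhod hPhi Phi0]]]] := flow fEC de0 dX2.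
have e64_1 (x : R) : x < eps / 64 -> x < eps by lra.
have e64_32 (x : R) : x < eps / 64 -> x < eps / 2 / 16 by lra.
have e64_16 (x y : C) : nr (x - y) < eps / 64 -> nr y < eps / 64 -> nr x < eps / 16.
  by have := nr_tri x y 0; rewrite !subr0; lra.
have e64_2 (x y : C) : nr x < eps / 64 -> nr y < eps / 2 -> nr (x + y) < eps.
  by have := nrD x y; lra.
pose pnt (s : C) (z : E) : C * (E * C) := (s, (z, 1)).
have domP s z : nr s < eps -> nr (z - z0) < rho -> cylinder p2 eps rho (pnt s z).
  move=> hs hz; split => //=; by rewrite nr_pair /= gt_max hz /= subrr n0.
pose ph s z := (Phi (pnt s z)).1; pose ka s z := (Phi (pnt s z)).2.
have phd s z : nr s < eps -> nr (z - z0) < rho -> nr (ph s z - z0) < de.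
  by move=> hs hz; have [_ _ /p2_1] := hPhi _ (domP s z hs hz).
have kad s z : nr s < eps -> nr (z - z0) < rho -> nr (ka s z - 1) < 1 / 2.
  move=> hs hz; have [_ _ /p2_2 h] := hPhi _ (domP s z hs hz); apply: lt_le_trans h _.
  by rewrite ge_min lexx orbT.
have kaz s z : nr s < eps -> nr (z - z0) < rho -> ka s z != 0.
  move=> hs hz; have := kad s z hs hz; apply: contraTneq => ->.
  by rewrite sub0r nrN nr1; apply/negP; lra.
have dPs s z : nr s < eps -> nr (z - z0) < rho ->
    is_diff s (fun s => Phi (pnt s z)) (fun h => 'd Phi (pnt s z) (h, 0)).
  move=> hs hz; have [d _ _] := hPhi _ (domP s z hs hz).
  exact: isd_comp (isd_pair (isd_id s) (isd_cst ((z, 1) : E * C) s)) (isd_of d).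
have dPz s z : nr s < eps -> nr (z - z0) < rho -> differentiable (fun z => Phi (pnt s z)) z.
  move=> hs hz; have [d _ _] := hPhi _ (domP s z hs hz).
  exact: isd_ex (isd_comp (isd_pair (isd_cst s z) (isd_pair (isd_id z) (isd_cst (1 : C) z))) (isd_of d)).
have dphs s z : nr s < eps -> nr (z - z0) < rho -> is_diff s (fun s => ph s z) ('d (fun s => ph s z) s) /\ 'd (fun s => ph s z) s 1 = X (ph s z).
  move=> hs hz; have H := isd_comp (dPs s z hs hz) (isd_fst (Phi (pnt s z))).
  split; first exact: isd_of (isd_ex H).
  refine (etrans (isdE H 1) _); have [_ e _] := hPhi _ (domP s z hs hz).
  by rewrite e.
have dkas s z : nr s < eps -> nr (z - z0) < rho -> differentiable (fun s => ka s z) s /\ 'd (fun s => ka s z) s 1 = l (ph s z) * ka s z.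
  move=> hs hz; have H := isd_comp (dPs s z hs hz) (isd_snd (Phi (pnt s z))).
  split; first exact: isd_ex H.
  refine (etrans (isdE H 1) _); have [_ e _] := hPhi _ (domP s z hs hz).
  by rewrite e.
have ph0 z : nr (z - z0) < rho -> ph 0 z = z.
  by move=> hz; rewrite /ph Phi0 //= nr_pair /= gt_max hz subrr n0.
have ka0 z : nr (z - z0) < rho -> ka 0 z = 1.
  by move=> hz; rewrite /ka Phi0 //= nr_pair /= gt_max hz subrr n0.
have wr z : nr (z - z0) < rho -> B z != 0 -> forall s, nr s < eps / 16 ->
    A z * B (ph s z) * ka s z = A (ph s z) * B z.
  move=> hz Bz s hs.
  have dcomp (G : E -> C) : (forall w, nr (w - z0) < delta -> differentiable G w) -> forall s, nr s < eps ->
      differentiable (fun s => G (ph s z)) s /\ 'd (fun s => G (ph s z)) s 1 = 'd G (ph s z) (X (ph s z)).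
    move=> dG s' hs'; have [H e] := dphs s' z hs' hz.
    have H2 := isd_comp H (isd_of (dG _ (ded _ (phd s' z hs' hz)))).
    split; first exact: isd_ex H2.
    refine (etrans (isdE H2 1) _); exact: congr1 e.
  have dA := dcomp A (fun z h => let: And4 _ _ d _ := dd z h in d).
  have dB := dcomp B (fun z h => let: And4 _ _ _ d := dd z h in d).
  have W := @wronskian (fun s => A (ph s z)) (fun s => B (ph s z)) (fun s => ka s z) (fun s => l (ph s z)) eps M eps0.
  rewrite /= ph0 // ka0 // in W; apply: W => //.
  - by move=> s' hs'; split; [exact: (dA s' hs').1|exact: (dB s' hs').1|exact: (dkas s' z hs' hz).1].
  - move=> s' hs'; have hp := phd s' z hs' hz; split.
    + by apply: le_trans (hA _ (deA _ hp)) MAM.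
    + by apply: le_trans (hBb _ (deB _ hp)) MBM.
    exact: kaM (kad s' z hs' hz).
  - move=> s' hs'; have e := hw _ (ded _ (phd s' z hs' hz)).
    refine (etrans (f_equal2 (fun p q => p * B (ph s' z) - A (ph s' z) * q) (dA s' hs').2 (dB s' hs').2) e).
  - by move=> s' hs'; exact: (dkas s' z hs' hz).2.
  - by move=> s' hs'; exact: kaz.
have z0r : nr (z0 - z0) < rho by rewrite subrr nr0.
pose rm := Num.min r0 eps.
have rm0 : 0 < rm by rewrite lt_min r00 eps0.
(* Near 0 the curve [c1] is the flow line of z0. *)
have [|||||r' r'0 hr'] := @ode_unique R E X z0 c1 (fun s => ph s z0) rm fE rm0.
- by apply/near_nr; exists delta => // z /dd [].
- by move=> s; rewrite lt_min => /andP[/hc].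
- by move=> s; rewrite lt_min => /andP[_ hs]; have [H e] := dphs s z0 hs z0r; split; first exact: isd_ex H.
- exact: c10.
- exact: ph0 z0 z0r.
exists (Num.min r' (eps / 64)); first by rewrite lt_min r'0 divr_gt0.
move=> s1; rewrite lt_min => /andP[s1r s1e] F0 hF0.
have s1eps : nr s1 < eps := e64_1 _ s1e.
move: hF0; rewrite (hr' s1 s1r) => /near_nr[eta eta0 heta].
have [dPhi1 _ _] := hPhi _ (domP s1 z0 s1eps z0r).
have /cont_nr /(_ eta eta0)[et et0 het] := differentiable_continuous dPhi1.
(* For (s, z) within [eu] of (s1, z0) the flow stays where [F0] is defined. *)
pose eu := Num.min et (Num.min rho (eps / 64)).
have eu0 : 0 < eu by rewrite !lt_min et0 rho0 divr_gt0.
have inF s z : nr (s - s1) < eu -> nr (z - z0) < eu -> nr (ph s z - ph s1 z0) < eta.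
  rewrite lt_min => /andP[hs _]; rewrite lt_min => /andP[hz _].
  apply: le_lt_trans (het (pnt s z) _); first exact: (nr_fst (Phi (pnt s z) - Phi (pnt s1 z0))).
  by rewrite !nr_pair /= !gt_max hs hz subrr n0.
have eu_rho z : nr (z - z0) < eu -> nr (z - z0) < rho by rewrite !lt_min => /and3P[].
have eu_eps s : nr (s - s1) < eu -> nr s < eps / 16.
  by rewrite !lt_min => /and3P[_ _ h]; exact: e64_16 h s1e.
have s1s1 : nr (s1 - s1) < eu by rewrite subrr n0.
have s1eu : nr s1 < eps / 16 by exact: eu_eps.
pose F z := F0 (ph s1 z) / ka s1 z.
(* [wr] gives this identity multiplied by B(phi_s z), which may vanish at s1.  If the
   identity failed at s1 it would fail for all nearby s, so that B would vanish on
   an arc of the flow line, hence at z by the identity theorem. *)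
have key z : nr (z - z0) < eu -> B z != 0 -> A z * ka s1 z = F0 (ph s1 z) * B z.
  move=> hz Bz; have hzr := eu_rho z hz.
  pose G s := A z * ka s z - F0 (ph s z) * B z.
  have cG : differentiable G s1.
    have [dF _ _] := heta _ (inF s1 z s1s1 hz).
    have [H _] := dphs s1 z s1eps hzr; have [dk _] := dkas s1 z s1eps hzr.
    exact: isd_ex (isd_sub (isd_mul (isd_cst (A z) s1) (isd_of dk)) (isd_mul (isd_comp H (isd_of dF)) (isd_cst (B z) s1))).
  have bG s : nr (s - s1) < eu -> B (ph s z) * G s = 0.
    move=> hs; have [_ _ eF] := heta _ (inF s z hs hz).
    have e := wr z hzr Bz s (eu_eps s hs); rewrite /G mulrBr.
    have -> : B (ph s z) * (A z * ka s z) = A (ph s z) * B z by rewrite -e; ring.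
    by rewrite -eF; ring.
  apply: subr0_eq; apply/eqP; apply: contraT => Gz; exfalso.
  have nG : 0 < nr (G s1) by rewrite nr_gt0.
  have /cont_nr /(_ _ nG)[d d0 hd] := differentiable_continuous cG.
  pose b s := B (ph (s1 + s) z).
  have small s : nr s < eps / 2 -> nr (s1 + s) < eps by exact: e64_2.
  have := @identity_disc R b (eps / 2) (Num.min d eu) M.
  have e2 : 0 < eps / 2 by rewrite divr_gt0.
  have me : 0 < Num.min d eu by rewrite lt_min d0.
  move=> /(_ e2 me) H.
  have : b (- s1) = 0.
    apply: H.
    - move=> s hs; have hs' := small s hs; have [Hp _] := dphs (s1 + s) z hs' hzr.
      have [_ _ _ dB] := dd _ (ded _ (phd _ z hs' hzr)).
      have sh := isd_add (isd_cst s1 s) (isd_id s).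
      exact: isd_ex (isd_comp (isd_comp sh Hp) (isd_of dB)).
    - move=> s hs; have hp := phd _ z (small s hs) hzr.
      by apply: le_trans (hBb _ (deB _ hp)) MBM.
    - move=> s; rewrite lt_min => /andP[h1 h2].
      have hs : nr (s1 + s - s1) < eu by rewrite addrC addKr.
      have Gs : G (s1 + s) != 0.
        have := hd (s1 + s); rewrite (addrC s1) addrK => /(_ h1) h; apply: contraTneq h => ->.
        by rewrite sub0r nrN ltxx.
      by have /eqP := bG _ hs; rewrite mulf_eq0 (negbTE Gs) orbF => /eqP.
    - by rewrite nrN; exact: e64_32.
  by rewrite /b subrr ph0 //; apply/eqP.
exists F; apply/near_nr; exists eu; first exact: eu0.
move=> z hz; have hzr := eu_rho z hz.
have dF' w : nr (w - z0) < eu -> differentiable F w.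
  move=> hw'; have hwr := eu_rho w hw'; have [dF _ _] := heta _ (inF s1 w s1s1 hw').
  have dP := isd_of (dPz s1 w s1eps hwr).
  have d1 := isd_comp dP (isd_fst (Phi (pnt s1 w))).
  have d2 := isd_comp dP (isd_snd (Phi (pnt s1 w))).
  exact: isd_ex (isd_mul (isd_comp d1 (isd_of dF)) (isd_inv d2 (kaz s1 w s1eps hwr))).
have [dF Fz _] := heta _ (inF s1 z s1s1 hz).
have kz := kaz s1 z s1eps hzr.
split; first exact: dF'.
  by rewrite /F mulf_neq0 // invr_eq0.
have hzd : nr (z - z0) < delta by apply: lt_le_trans hzr _; apply: le_trans rhod _; rewrite !ge_min rAd.
have [_ _ dA dB] := dd z hzd.
(* [key] requires B(z) to be nonzero; this holds on a dense set, and both sides are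
   continuous. *)
apply: (@nr_eq R C _ _ 1) => a a0; rewrite mul1r.
have cN : differentiable (fun w => B w * F w - A w) z.
  exact: isd_ex (isd_sub (isd_mul (isd_of dB) (isd_of (dF' z hz))) (isd_of dA)).
have /cont_nr /(_ a a0)[d d0 hd] := differentiable_continuous cN.
have me : 0 < Num.min d (eu - nr (z - z0)) by rewrite lt_min d0 subr_gt0.
have [w hw' Bw] := hB z _ hzd me.
move: hw'; rewrite lt_min => /andP[w1 w2].
have hwe : nr (w - z0) < eu by rewrite ltrBrDr in w2; exact: le_lt_trans (nr_tri w z z0) w2.
have := hd w w1; rewrite /F.
have kw := kaz s1 w s1eps (eu_rho w hwe).
have -> : B w * (F0 (ph s1 w) / ka s1 w) - A w = 0.
  have e := key w hwe Bw; have -> : A w = F0 (ph s1 w) * B w / ka s1 w by rewrite -e mulfK.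
  ring.
by rewrite sub0r nrN => /ltW.
Qed.

End Transport.

(** * Regular points *)

Section Connected.
Variable R : realType.
Local Notation C := (Cplx R).

(** The set where [P] holds is open and closed in [Omega]. *)
Lemma connected_ind (Omega : set C) (P : C -> Prop) : connected Omega ->
  (forall t0, Omega t0 -> exists2 r : R, 0 < r & forall t, nr (t - t0) < r -> Omega t /\ (P t <-> P t0)) ->
  forall s t, Omega s -> Omega t -> P s -> P t.
Proof.
move=> cO hP s t Os Ot Ps.
pose B : set C := [set w | Omega w /\ P w].
have oB : open B.
  rewrite openE => w [Ow Pw]; have [r r0 hr] := hP w Ow.
  apply/nbhs_nr; exists r => // v /hr [Ov e]; split => //; exact/e.
suff e : B = Omega by have [] : B t by rewrite e.
apply: cO.
- by exists s.
- exists B => //; apply/seteqP; split=> w; last by move=> [].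
  by move=> Bw; split => //; case: Bw.
exists (closure B); first exact: closed_closure.
apply/seteqP; split=> w.
  by move=> Bw; split; [case: Bw|exact: subset_closure].
move=> [Ow cw]; split => //; have [r r0 hr] := hP w Ow.
have /cw [v [[Ov Pv] vr]] : nbhs w [set v | nr (v - w) < r] by apply/nbhs_nr; exists r.
by have [_ e] := hr v vr; apply/e.
Qed.

Lemma const_connected (Omega : set C) (q : C -> C) : open Omega -> connected Omega ->
  (forall t, Omega t -> differentiable q t /\ 'd q t 1 = 0) ->
  forall s t, Omega s -> Omega t -> q t = q s.
Proof.
move=> oO cO hq s t Os Ot; apply: (connected_ind (P := fun w => q w = q s) cO _ Os Ot) => // t0 Ot0.
have /nbhs_nr [r r0 hr] : nbhs t0 Omega by apply: open_nbhs_nbhs.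
exists r => // w hw; split; first exact: hr.
suff -> : q w = q t0 by [].
have sh v : nr v < r -> is_diff v (fun v => q (t0 + v)) (fun h => h * 0).
  move=> hv; have Ov : Omega (t0 + v) by apply: hr; rewrite addrC addKr.
  have H := isd_C (isd_comp (isd_add (isd_cst t0 v) (isd_id v)) (isd_of (hq _ Ov).1)).
  by apply: (isd_ext H) => // h; congr (_ * _); rewrite add0r; exact: (hq _ Ov).2.
have := @const_ball R (fun v => q (t0 + v)) r (fun v hv => isd_ex (sh v hv)) _ (w - t0) hw.
rewrite /= addr0 subrKC; apply => v hv; refine (etrans (isdE (sh v hv) 1) _).
by rewrite mulr0.
Qed.

End Connected.

Section Good.
Variable R : realType.
Local Notation C := (Cplx R).
Variables (E : normedModType C) (fE : fin_coord E) (M : cmanifold E) (D : divisor M).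
Local Notation U := (@dv_open _ _ _ D).
Local Notation t := (@dv_trans _ _ _ D).
Local Notation f := (@dv_fun _ _ _ D).
Implicit Types (a b : dv_index D) (x y : M).

Lemma near_nearM (T : topologicalType) (P : T -> Prop) (x : T) : (\forall y \near x, P y) ->
  \forall y \near x, \forall z \near y, P z.
Proof.
move=> h; have : nbhs x P by []; rewrite nbhsE => -[B [oB Bx] BP].
have : nbhs x B by apply: open_nbhs_nbhs.
apply: filterS => y By; have : nbhs y B by apply: open_nbhs_nbhs.
by apply: filterS => z /BP.
Qed.

Definition extends a x (F : M -> C) := \forall y \near x,
  [/\ U a y, vholo_at F y, F y != 0 & mero_dom (f a) y -> f a y = F y].
Definition regular_in a x := exists F, extends a x F.
Definition regular x := exists a, regular_in a x.

Lemma extends_near a x F : extends a x F -> \forall y \near x, extends a y F.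
Proof. exact: near_nearM. Qed.

Lemma extends_uniq a x F G : extends a x F -> extends a x G -> F x = G x.
Proof.
move=> hF hG; have [ax vF _ _] := nbhs_singleton hF; have [_ vG _ _] := nbhs_singleton hG.
apply: eq_dense; [exact: vholo_cont|exact: vholo_cont|] => V nV.
have n : \forall y \near x, V y /\ (mero_dom (f a) y -> F y = G y).
  move: nV; apply: filterS3 hF hG => y [_ _ _ e1] [_ _ _ e2] Vy; split => // my.
  by rewrite -e1 // e2.
by have [y [[Vy e] _ my _]] := dense_pt ax n; exists y => //; exact: e.
Qed.

(** The value at [x] of the extension of f_a; it does not depend on the extension
    by [extends_uniq], and is 0 if there is none. *)
Definition fval a x : C := match pselect (regular_in a x) with
  | left h => (projT1 (cid h)) x | right _ => 0 end.

Lemma fval_extends a x F : extends a x F -> fval a x = F x.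
Proof.
move=> hF; rewrite /fval; case: pselect => [h|[]]; last by exists F.
by case: (cid h) => G hG /=; exact: extends_uniq hG hF.
Qed.

Lemma extends_fval a x F : extends a x F -> extends a x (fval a).
Proof.
move=> hF; have n1 := extends_near hF; have n2 := near_nearM n1.
move: n1; apply: filterS3 n2 hF => y n3 [Uy vF F0 e] hy.
have ev := fval_extends hy.
split; first exact: Uy.
- apply: (vholo_near _ vF); move: n3; apply: filterS => z hz; exact: esym (fval_extends hz).
- by rewrite ev.
- by move=> my; rewrite ev; exact: e.
Qed.

Lemma regular_fval a x : regular_in a x -> extends a x (fval a).
Proof. by move=> [F /extends_fval]. Qed.

Lemma mero_regular a x : mero_dom (f a) x -> f a x != 0 -> regular_in a x.
Proof.
move=> mx fx; exists (f a).
have c := vholo_cont (f_vholo mx).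
have nz : \forall y \near x, f a y != 0.
  have n0 : 0 < nr (f a x) by rewrite nr_gt0.
  have n : \forall w \near (f a x), w != 0.
    apply/near_nr; exists (nr (f a x)) => // w; apply: contraTneq => ->.
    by rewrite sub0r nrN ltxx.
  exact: (c _ n).
move: nz; apply: filterS2 (mero_near mx) => y my fy; split.
- exact: (mero_dom_sub my).
- exact: f_vholo.
- exact: fy.
by [].
Qed.

Lemma regular_dense x (V : M -> Prop) : (\forall y \near x, V y) -> exists2 y, V y & regular y.
Proof.
move=> nV; have [a ax] := dv_cover D x; have [y [Vy _ my fy]] := dense_pt ax nV.
by exists y => //; exists a; exact: mero_regular.
Qed.

Lemma regular_near x : regular x -> \forall y \near x, regular y.
Proof.
move=> [a [F hF]]; have := extends_near hF; apply: filterS => y hy; exists a, F => //.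
Qed.

(** If [F] extends f_a then t_ba F extends f_b. *)
Lemma regular_any a b x : regular_in a x -> U b x -> regular_in b x.
Proof.
move=> [F hF] bx; exists (fun y => t b a y * F y).
have nb : \forall y \near x, U b y by apply: open_nbhs_nbhs; split => //; exact: dv_open_open.
have n1 := extends_near hF.
move: nb; apply: filterS3 n1 hF => y hy [Uay vF F0 e] Uby.
have [ht t0] := dv_trans_holo Uby Uay.
have vt : vholo_at (t b a) y by exact: ht.
split; [exact: Uby|exact: (vholoM vt vF)|by rewrite mulf_neq0|] => my.
apply: (eq_dense (p := f b) (q := fun y => t b a y * F y)).
- exact: vholo_cont (f_vholo my).
- exact: vholo_cont (vholoM vt vF).
move=> V nV; have n : \forall z \near y, V z /\ (mero_dom (f a) z -> f a z = F z).
  by move: nV; apply: filterS2 hy => z [_ _ _ ez] Vz.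
have [z [[Vz ez] [Ubz Uaz] mb ma _]] := dense_pt2 Uby Uay n.
by exists z => //; rewrite (dv_transE mb ma) ez.
Qed.

Lemma regular_at a x : regular x -> U a x -> regular_in a x.
Proof. by move=> [b hb] ax; exact: regular_any hb ax. Qed.

Lemma fval_trans a b x : regular x -> U a x -> U b x -> fval a x = t a b x * fval b x.
Proof.
move=> gx ax bx; have ha := regular_fval (regular_at gx ax); have hb := regular_fval (regular_at gx bx).
have [ht _] := dv_trans_holo ax bx; have vt : vholo_at (t a b) x by exact: ht.
have [_ va _ _] := nbhs_singleton ha; have [_ vb _ _] := nbhs_singleton hb.
apply: (eq_dense (p := fval a) (q := fun x => t a b x * fval b x)).
- exact: vholo_cont.
- exact: vholo_cont (vholoM vt vb).
move=> V nV; have n : \forall z \near x, [/\ V z, mero_dom (f a) z -> f a z = fval a z & mero_dom (f b) z -> f b z = fval b z].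
  by move: nV; apply: filterS3 ha hb => z [_ _ _ e1] [_ _ _ e2] Vz.
have [z [[Vz e1 e2] [Uaz Ubz] ma mb _]] := dense_pt2 ax bx n.
by exists z => //; rewrite -e1 // -e2 // (dv_transE ma mb).
Qed.

Variables (g : set (vfield M)) (lambda : dv_index D -> vfield M -> M -> C).
Hypotheses (lg : lie_algebra g) (wg : is_weight g lambda).

(** X f_a = lambda_a(X) f_a extends by density to the extension of f_a. *)
Lemma fval_along X a x j : g X -> regular_in a x -> cm_dom M j x ->
  along X (fval a) j x = lambda a X x * fval a x.
Proof.
move=> gX gx dj; have hv := regular_fval gx; have [ax va _ _] := nbhs_singleton hv.
have hX := g_holo lg gX.
have nv : \forall y \near x, vholo_at (fval a) y by move: hv; apply: filterS => y [].
apply: (eq_dense (p := along X (fval a) j) (q := fun x => lambda a X x * fval a x)).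
- by apply: vholo_cont; apply: (along_vholo (fc_C R)).
- by apply: vholo_cont; apply: vholoM => //; exact: (weight_vholo wg).
move=> V nV; have n : \forall z \near x, [/\ V z, cm_dom M j z & extends a z (fval a)].
  by move: nV; apply: filterS3 (dom_near dj) (extends_near hv).
have [y [[Vy djy hy] Uy my fy]] := dense_pt ax n.
exists y => //.
have ne : \forall z \near y, f a z = fval a z.
  by move: hy; apply: filterS2 (mero_near my) => z mz [_ _ _ e]; exact: e.
rewrite (along_near X djy (f_vholo my) ne) (weight_along wg gX my djy).
by rewrite -(nbhs_singleton ne).
Qed.

(** [quotient_transport], read in a chart around gamma(t0), for a local quotient
    A / B of holomorphic functions that represents f_a. *)
Lemma regular_local X Omega (gamma : C -> M) t0 : g X -> open Omega ->
  integral_curve X Omega gamma -> Omega t0 ->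
  exists2 r : R, 0 < r & forall s, nr (s - t0) < r -> Omega s /\ (regular (gamma s) -> regular (gamma t0)).
Proof.
move=> gX oO hg Ot0; set p := gamma t0.
have hX := g_holo lg gX.
have [a ap] := dv_cover D p; have [j jp] := cm_cover p.
have [V [A [B [[oV VU] Vp hAB nzB BfA]]]] := mero_quotient (f a) ap.
have nV : \forall y \near p, V y by apply: open_nbhs_nbhs.
pose z0 := cm_chart M j p.
(* All hypotheses of [quotient_transport] hold on a ball of this radius. *)
have /near_nr [delta delta0 hd] : \forall z \near z0,
    [/\ V (cm_inv M j z), cm_dom M j (cm_inv M j z) & cm_chart M j (cm_inv M j z) = z].
  by have n1 := inv_near_of jp nV; have := inv_near jp; move: n1; apply: filterS2 => z ? [].
have vA y : V y -> vholo_at A y by move=> /hAB [].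
have vB y : V y -> vholo_at B y by move=> /hAB [].
have vl y : V y -> vholo_at (lambda a X) y by move=> /VU; exact: (weight_vholo wg gX).
have nVy y : V y -> \forall z \near y, V z by move=> Vy; apply: open_nbhs_nbhs.
have diffs z : nr (z - z0) < delta -> [/\ differentiable (X j \o cm_inv M j) z, differentiable (lambda a X \o cm_inv M j) z,
    differentiable (A \o cm_inv M j) z & differentiable (B \o cm_inv M j) z].
  move=> /hd [Vz dz cz]; split.
  - by have := nbhs_singleton (field_near hX dz); rewrite cz.
  - by have := vl _ Vz j dz; rewrite cz.
  - by have := vA _ Vz j dz; rewrite cz.
  - by have := vB _ Vz j dz; rewrite cz.
(* Differentiate B f_a = A along [X] where f_a is holomorphic; conclude by density. *)
have wrM y : V y -> cm_dom M j y ->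
    along X A j y * B y - A y * along X B j y = lambda a X y * A y * B y.
  move=> Vy dy; have nA : \forall z \near y, vholo_at A z by have := nVy y Vy; apply: filterS => z; exact: vA.
  have nB : \forall z \near y, vholo_at B z by have := nVy y Vy; apply: filterS => z; exact: vB.
  have cA := along_vholo (fc_C R) hX dy nA; have cB := along_vholo (fc_C R) hX dy nB.
  apply: (eq_dense (p := fun y => along X A j y * B y - A y * along X B j y) (q := fun y => lambda a X y * A y * B y)).
  - apply: vholo_cont => i di; have h1 := vholoM cA (vB y Vy); have h2 := vholoM (vA y Vy) cB.
    exact: isd_ex (isd_sub (isd_of (h1 i di)) (isd_of (h2 i di))).
  - exact: vholo_cont (vholoM (vholoM (vl y Vy) (vA y Vy)) (vB y Vy)).
  move=> W nW; have n : \forall z \near y, [/\ W z, V z & cm_dom M j z].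
    by move: nW; apply: filterS3 (dom_near dy) (nVy y Vy).
  have [z [[Wz Vz dz] Uz mz fz]] := dense_pt (VU _ Vy) n.
  exists z => //.
  have ne : \forall w \near z, B w * f a w = A w.
    by have := nVy z Vz; apply: filterS2 (mero_near mz) => w mw Vw; exact: BfA.
  have e := along_near X dz (vholoM (vB z Vz) (f_vholo mz)) ne.
  rewrite (alongM X dz (vB z Vz) (f_vholo mz)) (weight_along wg gX mz dz) in e.
  rewrite e -(nbhs_singleton ne); ring.
have wrE z : nr (z - z0) < delta -> 'd (A \o cm_inv M j) z ((X j \o cm_inv M j) z) * (B \o cm_inv M j) z
   - (A \o cm_inv M j) z * 'd (B \o cm_inv M j) z ((X j \o cm_inv M j) z) =
   (lambda a X \o cm_inv M j) z * (A \o cm_inv M j) z * (B \o cm_inv M j) z.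
  by move=> /hd [Vz dz cz]; have := wrM _ Vz dz; rewrite /along cz.
have denseB z (r : R) : nr (z - z0) < delta -> 0 < r -> exists2 w, nr (w - z) < r & (B \o cm_inv M j) w != 0.
  move=> /hd [Vz dz cz] r0; set y := cm_inv M j z.
  have n1 : \forall y' \near y, nr (cm_chart M j y' - z) < r.
    apply: (chart_near_of (P := fun w => nr (w - z) < r) dz); rewrite cz; apply/near_nr; exists r => //.
  have n : \forall y' \near y, [/\ nr (cm_chart M j y' - z) < r, V y' & cm_dom M j y'].
    by move: n1; apply: filterS3 (dom_near dz) (nVy _ Vz).
  have : nbhs y (fun y' => [/\ nr (cm_chart M j y' - z) < r, V y' & cm_dom M j y']) by [].
  rewrite nbhsE => -[Q [oQ Qy] QP].
  have [||y' Qy' By'] := nzB Q oQ; [by move=> y' /QP []|by exists y|].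
  have [h1 h2 h3] := QP _ Qy'.
  by exists (cm_chart M j y') => //=; rewrite cm_chartK.
have gc := (hg t0 Ot0).1.1.
have /near_nr [r0 r00 hr0] : \forall s \near t0, Omega s /\ (V (gamma s) /\ cm_dom M j (gamma s)).
  have n1 : \forall s \near t0, cm_dom M j (gamma s) := gc _ (dom_near jp).
  have n2 : \forall s \near t0, V (gamma s) := gc _ nV.
  have n3 : \forall s \near t0, Omega s by apply: open_nbhs_nbhs.
  by move: n1; apply: filterS3 n2 n3.
pose c1 s := cm_chart M j (gamma (t0 + s)).
have tK (s : C) : t0 + s - t0 = s by rewrite addrC addKr.
have hc1 s : nr s < r0 -> differentiable c1 s /\ 'd c1 s 1 = (X j \o cm_inv M j) (c1 s).
  move=> sr; have [|Os [Us ds]] := hr0 (t0 + s); first by rewrite tK.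
  have [[_ hd1] hd2] := hg _ Os.
  have H := isd_comp (isd_add (isd_cst t0 s) (isd_id s)) (isd_of (hd1 j ds)).
  split; first exact: isd_ex H.
  refine (etrans (isdE H 1) _); rewrite add0r /c1 /= cm_chartK //; exact: hd2.
have c10 : c1 0 = z0 by rewrite /c1 addr0.
have [r rpos hr] := quotient_transport fE delta0 r00 diffs wrE denseB hc1 c10.
exists (Num.min r r0); first by rewrite lt_min rpos.
move=> s; rewrite lt_min => /andP[sr sr0]; have [Os [Vs ds]] := hr0 s sr0.
split => // gs; have [F0 hF0] := regular_at gs (VU _ Vs).
have cs : c1 (s - t0) = cm_chart M j (gamma s) by rewrite /c1 subrKC.
have hV' : \forall y \near gamma s, [/\ vholo_at F0 y, F0 y != 0 & B y * F0 y = A y].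
  have n := extends_near hF0; have nVs := nVy _ Vs; have := near_nearM nVs; move: hF0.
  apply: filterS3 n => y hy [Uy vF F00 _] nVy'; have Vy := nbhs_singleton nVy'; split => //.
  apply: (eq_dense (p := fun y => B y * F0 y) (q := A)).
  - exact: vholo_cont (vholoM (vB y Vy) vF).
  - exact: vholo_cont (vA y Vy).
  move=> W nW; have n' : \forall z \near y, [/\ W z, V z & mero_dom (f a) z -> f a z = F0 z].
    by move: nW; apply: filterS3 nVy' hy => z Vz [_ _ _ e] Wz.
  have [z [[Wz Vz e] _ mz _]] := dense_pt Uy n'.
  by exists z => //; rewrite -e // BfA.
have sr' : nr (s - t0) < r by [].
have hF0' : \forall z \near c1 (s - t0), [/\ differentiable (F0 \o cm_inv M j) z, (F0 \o cm_inv M j) z != 0 &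
    (B \o cm_inv M j) z * (F0 \o cm_inv M j) z = (A \o cm_inv M j) z].
  rewrite cs; have n1 := inv_near_of ds hV'; have := inv_near ds; move: n1; apply: filterS2 => z [vF F00 e] [dz cz].
  by split => //; have := vF j dz; rewrite cz.
have [F hF] := hr (s - t0) sr' _ hF0'.
exists a, (F \o cm_chart M j).
have nF := chart_near_of jp hF; have nF2 := near_nearM nF.
have nVj : \forall y \near p, V y /\ cm_dom M j y by have := dom_near jp; apply: filterS2 nV.
have nVj2 := near_nearM nVj.
move: nVj2; apply: filterS3 nF nF2 => y [dF F00 _] n2 n3; have [Vy dy] := nbhs_singleton n3.
have vF : vholo_at (F \o cm_chart M j) y by apply: vholo_comp (chart_vholo dy) dF.
split; [exact: VU|exact: vF|exact: F00|].
move=> my; apply: (eq_dense (p := f a) (q := F \o cm_chart M j)).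
- exact: vholo_cont (f_vholo my).
- exact: vholo_cont.
move=> W nW; have n : nbhs y (fun y' => [/\ W y', mero_dom (f a) y' /\ V y' &
    [/\ differentiable F (cm_chart M j y'), F (cm_chart M j y') != 0 & (B \o cm_inv M j) (cm_chart M j y') * F (cm_chart M j y') = (A \o cm_inv M j) (cm_chart M j y')] /\ cm_dom M j y']).
  have n4 : \forall y' \near y, mero_dom (f a) y' /\ W y' by have := mero_near my; apply: filterS2 nW.
  by move: n4; apply: filterS3 n2 n3 => y' h [Vy' dy'] [my' Wy'].
move: n; rewrite nbhsE => -[Q [oQ Qy] QP].
have [||y' Qy' By'] := nzB Q oQ; [by move=> y' /QP [_ []]|by exists y|].
have [Wy' [my' Vy'] [[_ _ e] dy']] := QP _ Qy'.
exists y' => //; apply: (mulfI By'); rewrite BfA // /=.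
by move: e; rewrite /= cm_chartK.
Qed.

(** A regular point has regular neighbours, and by [regular_local] a point which is
    not regular has no regular neighbours on the curve. *)
Lemma regular_curve X Omega (gamma : C -> M) : g X -> open Omega -> connected Omega ->
  integral_curve X Omega gamma -> forall s s', Omega s -> Omega s' -> regular (gamma s) -> regular (gamma s').
Proof.
move=> gX oO cO hg; apply: (connected_ind (P := fun s => regular (gamma s)) cO) => t0 Ot0.
have gc := (hg t0 Ot0).1.1.
have [r r0 hr] := regular_local gX oO hg Ot0.
have [gt0|ngt0] := pselect (regular (gamma t0)); last first.
  by exists r => // t' ht; have [Ot h] := hr t' ht; split => //; split.
have /near_nr [r' r'0 hr'] : \forall t' \near t0, regular (gamma t') := gc _ (regular_near gt0).
exists (Num.min r r'); first by rewrite lt_min r0.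
move=> t'; rewrite lt_min => /andP[h1 h2]; have [Ot h] := hr t' h1; split => //.
by split => // _; exact: hr'.
Qed.

End Good.

(** * Orbits over regular points *)

Section Orbits.
Variable R : realType.
Local Notation C := (Cplx R).
Variables (E : normedModType C) (fE : fin_coord E) (M : cmanifold E) (D : divisor M) (L : divisor_bundle D).
Variables (g : set (vfield M)) (lambda : dv_index D -> vfield M -> M -> C).
Hypotheses (lg : lie_algebra g) (wg : is_weight g lambda).
Local Notation U := (@dv_open _ _ _ D).
Local Notation t := (@dv_trans _ _ _ D).
Local Notation pi := (@lb_proj _ _ _ _ _ _ L).
Local Notation u := (@lb_coord _ _ _ _ _ _ L).
Local Notation sec := (@lb_sec _ _ _ _ _ _ L).
Local Notation regular := (regular D).
Local Notation orbit := Defs.orbit.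
Local Notation ghat := (weight_lift L g lambda).
Implicit Types (a b : dv_index D) (x : M) (y : L) (c : C).

Definition cidx x : dv_index D := projT1 (cid (dv_cover D x)).

Lemma cidxP x : U (cidx x) x.
Proof. exact: (projT2 (cid (dv_cover D x))). Qed.

(** The point u_a = c f_a(x) of the fiber over [x], in any trivialization
    ([fsecE]). *)
Definition fsec c x : L := sec (cidx x) x (c * fval (cidx x) x).
(** The constant [c] for which [y] lies on the section [fsec c]. *)
Definition fcoef y : C := u (cidx (pi y)) y / fval (cidx (pi y)) (pi y).

Lemma fsec_pi c x : pi (fsec c x) = x.
Proof. exact: lb_sec_proj (cidxP x). Qed.

Lemma fsec_u c a x : regular x -> U a x -> u a (fsec c x) = c * fval a x.
Proof.
move=> gx ax; have ax' : U a (pi (fsec c x)) by rewrite fsec_pi.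
have cx' : U (cidx x) (pi (fsec c x)) by rewrite fsec_pi; exact: cidxP.
rewrite (lb_coord_trans (l := L) ax' cx') fsec_pi /fsec (lb_sec_coord _ _ (cidxP x)).
by rewrite (fval_trans gx ax (cidxP x)) mulrCA.
Qed.

Lemma fsecE c a x : regular x -> U a x -> fsec c x = sec a x (c * fval a x).
Proof.
move=> gx ax; have ax' : U a (pi (fsec c x)) by rewrite fsec_pi.
by rewrite -[LHS](lb_secK ax') fsec_pi fsec_u.
Qed.

Lemma fval_neq0 a x : regular x -> U a x -> fval a x != 0.
Proof. by move=> gx ax; have := regular_fval (regular_at gx ax) => /nbhs_singleton []. Qed.

Lemma fval_vholo a x : regular x -> U a x -> vholo_at (fval a) x.
Proof. by move=> gx ax; have := regular_fval (regular_at gx ax) => /nbhs_singleton []. Qed.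

Lemma fcoef_u a y : regular (pi y) -> U a (pi y) -> fcoef y * fval a (pi y) = u a y.
Proof.
move=> gy ay; have cy := cidxP (pi y).
rewrite (lb_coord_trans (l := L) ay cy) (fval_trans gy ay cy) /fcoef mulrCA divfK //.
exact: fval_neq0.
Qed.

Lemma fsec_fcoef y : regular (pi y) -> fsec (fcoef y) (pi y) = y.
Proof.
by move=> gy; rewrite /fsec (fcoef_u gy (cidxP _)) lb_secK //; exact: cidxP.
Qed.

Lemma fsec_param (F : normedModType C) (h : F -> M) z c : holo_param_at h z -> regular (h z) ->
  holo_param_at (fsec c \o h) z.
Proof.
move=> hp gz; have [hc hd] := hp; have az := cidxP (h z); set a := cidx (h z) in az.
have [j dj] := cm_cover (h z).
pose k w : E * C := (cm_chart M j (h w), c * fval a (h w)).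
have dk : differentiable k z.
  have dv := param_diff hp (fval_vholo gz az).
  exact: isd_ex (isd_pair (isd_of (hd j dj)) (isd_mul (isd_cst c z) (isd_of dv))).
have H : holo_param_at (lb_triv L a j \o k) z by apply: param_pre dk; exact: lb_triv_holo.
apply: (param_near _ H).
have n1 : \forall w \near z, cm_dom M j (h w) := hc _ (dom_near dj).
have n2 : \forall w \near z, U a (h w) := hc _ (U_near az).
have n3 : \forall w \near z, regular (h w) := hc _ (regular_near gz).
move: n1; apply: filterS3 n2 n3 => w aw gw dw.
by rewrite /= /lb_triv /k /= cm_chartK // (fsecE c gw aw).
Qed.

Lemma curve_diff (F G : normedModType C) (N : cmanifold F) (X : vfield N) Omega gamma (k : N -> G) s i : integral_curve X Omega gamma ->
  Omega s -> cm_dom N i (gamma s) -> vholo_at k (gamma s) ->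
  is_diff s (k \o gamma) ('d (k \o gamma) s) /\ 'd (k \o gamma) s 1 = along X k i (gamma s).
Proof.
move=> hg Os di hk; have [hp e] := hg s Os.
have H := param_comp hp di (hk i di).
split; first exact: isd_of (isd_ex H).
refine (etrans (isdE H 1) _); rewrite /along (e i di) //.
Qed.

(** The section [fsec c] is tangent to the lift, because X f_a = lambda_a(X) f_a. *)
Lemma lift_curve (V : vfield L) (X : vfield M) Omega gamma c : g X ->
  (forall y i, cm_dom L i y -> over_at V X (fun a => lambda a X) i y) ->
  integral_curve X Omega gamma -> (forall s, Omega s -> regular (gamma s)) ->
  integral_curve V Omega (fsec c \o gamma).
Proof.
move=> gX oV hg hgood s Os; have [hp e] := hg s Os; have gs := hgood s Os.
split; first exact: fsec_param.
move=> i di; set y := fsec c (gamma s) in di *.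
have py : pi y = gamma s by exact: fsec_pi.
have as_ := cidxP (gamma s); set a := cidx (gamma s) in as_.
have [j dj] := cm_cover (gamma s).
have vy : in_triv a j y by rewrite /in_triv py.
have [hc hd] := hp.
pose k w : E * C := (cm_chart M j (gamma w), c * fval a (gamma w)).
have ks : k s = tcoord a j y by rewrite /k /tcoord py (fsec_u c gs as_).
have [H1 e1] := curve_diff hg Os dj (fval_vholo gs as_).
have dk := isd_pair (isd_of (hd j dj)) (isd_mul (isd_cst c s) H1).
have dt : differentiable (cm_chart L i \o lb_triv L a j) (k s).
  by rewrite ks; have [_ h] := triv_param vy; apply: h; rewrite trivK.
have n1 : \forall w \near s, cm_dom M j (gamma w) := hc _ (dom_near dj).
have n2 : \forall w \near s, U a (gamma w) := hc _ (U_near as_).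
have n3 : \forall w \near s, regular (gamma w) := hc _ (regular_near gs).
have nE : \forall w \near s, (cm_chart L i \o lb_triv L a j) (k w) = (cm_chart L i \o (fsec c \o gamma)) w.
  move: n1; apply: filterS3 n2 n3 => w aw gw dw.
  by rewrite /= /lb_triv /k /= cm_chartK // (fsecE c gw aw).
refine (etrans (isdE (is_diff_near nE (isd_comp dk (isd_of dt))) 1) _).
have [_ h2] := triv_charE (V i y) (X j (pi y), lambda a X (pi y) * u a y) vy di.
rewrite (h2 (oV y i di a j vy)) ks; congr ('d _ _ _).
apply: injective_projections; first by rewrite /= py; exact: e.
rewrite /= py mulr0 addr0 (fsec_u c gs as_).
refine (etrans (congr1 (fun p => c * p) e1) _).
by rewrite (fval_along lg wg gX (regular_at gs as_) dj) mulrCA.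
Qed.

Lemma proj_curve (V : vfield L) (X : vfield M) h Omega gamma :
  (forall y i, cm_dom L i y -> over_at V X h i y) ->
  integral_curve V Omega gamma -> integral_curve X Omega (pi \o gamma).
Proof.
move=> oV hg s Os; have [hp e] := hg s Os; split.
  exact: (map_param (lb_proj_holo (l := L)) hp).
move=> j dj; have [i di] := cm_cover (gamma s).
have [_ e1] := curve_diff hg Os di (vholo_pi (chart_vholo dj)).
refine (etrans e1 _).
by rewrite (along_pi di (oV _ _ di) dj (chart_vholo dj)) along_id.
Qed.

Lemma fcoef_vholo y : regular (pi y) -> vholo_at fcoef y.
Proof.
move=> gy; have ay := cidxP (pi y); set a := cidx (pi y) in ay.
have H := vholoM (vholo_u ay) (vholoV (vholo_pi (fval_vholo gy ay)) (fval_neq0 gy ay)).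
apply: (vholo_near _ H).
have n1 := pi_near (U_near ay); have := pi_near (regular_near gy); move: n1; apply: filterS2 => y' ay' gy'.
by rewrite /= -(fcoef_u gy' ay') mulfK //; exact: fval_neq0.
Qed.

(** Both u_a and the pull-back of f_a are multiplied by lambda_a(X) along [V], so
    that their quotient is constant. *)
Lemma fcoef_along (V : vfield L) (X : vfield M) y i : g X ->
  (forall y i, cm_dom L i y -> over_at V X (fun a => lambda a X) i y) ->
  regular (pi y) -> cm_dom L i y -> along V fcoef i y = 0.
Proof.
move=> gX oV gy di; have ay := cidxP (pi y); set a := cidx (pi y) in ay.
have [j dj] := cm_cover (pi y).
have hv := fval_vholo gy ay; have v0 := fval_neq0 gy ay.
have n : \forall y' \near y, fcoef y' * (fval a \o pi) y' = u a y'.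
  have n1 := pi_near (U_near ay); have := pi_near (regular_near gy); move: n1; apply: filterS2 => y' ay' gy'.
  exact: fcoef_u.
have hc := fcoef_vholo gy; have hvp := vholo_pi hv.
have e := along_near V di (vholoM hc hvp) n.
rewrite (alongM V di hc hvp) (along_u di (oV y i di) ay) (along_pi di (oV y i di) dj hv) in e.
rewrite (fval_along lg wg gX (regular_at gy ay) dj) -(fcoef_u gy ay) /= in e.
apply: (mulfI v0); rewrite mulr0.
have alg (l k v p : C) : l * (k * v) = k * (l * v) + v * p -> v * p = 0.
  by move=> h; apply: (addrI (k * (l * v))); rewrite -h addr0 mulrCA.
exact: alg e.
Qed.

(** Integral curves of the lift project to integral curves below, which stay among
    regular points, and [fcoef] is constant along them. *)
Lemma orbit_down y y' : regular (pi y) -> orbit ghat y y' ->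
  [/\ regular (pi y'), orbit g (pi y) (pi y') & fcoef y' = fcoef y].
Proof.
move=> gy; elim=> [|V Omega gamma s s' gV oO cO hg Os Os' _ [gs os cs]].
  by split => //; exact: orbit_refl.
have [hV [X gX oV]] := (weight_liftP g lambda V).1 gV.
have hp := proj_curve oV hg.
have gall w : Omega w -> regular (pi (gamma w)) by move=> Ow; exact: (regular_curve fE lg wg gX oO cO hp Os Ow gs).
split; first exact: gall.
  exact: (orbit_step gX oO cO hp Os Os' os).
rewrite -cs; apply: (const_connected (q := fcoef \o gamma) oO cO _ Os Os') => w Ow.
have [i di] := cm_cover (gamma w).
have [H e] := curve_diff hg Ow di (fcoef_vholo (gall w Ow)).
split; first exact: isd_ex H.
by refine (etrans e _); exact: (fcoef_along gX oV (gall w Ow) di).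
Qed.

(** Integral curves lift to the section [fsec c] by [lift_curve]. *)
Lemma orbit_up c x x' : regular x -> orbit g x x' -> regular x' /\ orbit ghat (fsec c x) (fsec c x').
Proof.
move=> gx; elim=> [|X Omega gamma s s' gX oO cO hg Os Os' _ [gs os]].
  by split => //; exact: orbit_refl.
have gall w : Omega w -> regular (gamma w) by move=> Ow; exact: (regular_curve fE lg wg gX oO cO hg Os Ow gs).
split; first exact: gall.
have [V hV oV] := lift_exists fE L (g_holo lg gX) (fun a x => weight_vholo wg gX) (weight_cocycle lg wg gX).
have gV : ghat V by apply/weight_liftP; split => //; exists X.
have hl := lift_curve c gX oV hg gall.
exact: (orbit_step gV oO cO hl Os Os' os).
Qed.

Lemma orbit_bij y : regular (pi y) -> set_bij (orbit ghat y) (orbit g (pi y)) pi.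
Proof.
move=> gy; split.
- by move=> y' /= /(orbit_down gy) [].
- move=> y1 y2; rewrite !inE => /(orbit_down gy) [g1 _ c1] /(orbit_down gy) [g2 _ c2] e.
  by rewrite -(fsec_fcoef g1) -(fsec_fcoef g2) e c1 c2.
move=> x /= /(orbit_up (fcoef y) gy) [gx]; rewrite (fsec_fcoef gy) => ox.
by exists (fsec (fcoef y) x) => //; exact: fsec_pi.
Qed.

(** The projection is bijective on the orbit, with inverse [fsec c], where [c] is
    the value of [fcoef] on the orbit.  Both maps are holomorphic for the structures
    of the orbits, because these are initial submanifolds. *)
Lemma orbit_biholo y : regular (pi y) -> orbit_projects_biholomorphically g ghat y.
Proof.
move=> gy; split; first exact: orbit_bij.
move=> k' k N' N i' i [hi' inj' ri' _ ini'] [hi inj ri _ ini]; set c := fcoef y.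
have o' n' : orbit ghat y (i' n') by rewrite -ri'; exists n'.
have o n : orbit g (pi y) (i n) by rewrite -ri; exists n.
have [phi hphi] : {phi : N' -> N & forall n', i (phi n') = pi (i' n')}.
  apply: (@choice _ _ (fun n' n => i n = pi (i' n'))) => n'.
  have [_ on _] := orbit_down gy (o' n'); rewrite -ri in on.
  by case: on => n _ e; exists n.
have [psi hpsi] : {psi : N -> N' & forall n, i' (psi n) = fsec c (i n)}.
  apply: (@choice _ _ (fun n n' => i' n' = fsec c (i n))) => n.
  have [_] := orbit_up c gy (o n); rewrite (fsec_fcoef gy) -ri' => -[n' _ e].
  by exists n'.
have ephi : pi \o i' = i \o phi by apply/funext => n' /=; rewrite hphi.
have epsi : fsec c \o i = i' \o psi by apply/funext => n' /=; rewrite hpsi.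
have cphi : cancel phi psi.
  move=> n'; apply: inj'; rewrite hpsi hphi.
  have [gn _ cn] := orbit_down gy (o' n').
  by rewrite /c -cn fsec_fcoef.
exists phi => //; split.
  apply: ini; rewrite -ephi; exact: map_comp hi' (lb_proj_holo (l := L)).
exists psi; split => //.
  by move=> n; apply: inj; rewrite hphi hpsi fsec_pi.
apply: ini'; rewrite -epsi => x j dj.
apply: (fsec_param c (hi x j dj)); rewrite /= cm_chartK //.
by have [] := orbit_up c gy (o x).
Qed.

Lemma regular_open : open [set y : L | regular (pi y)].
Proof. by rewrite openE => y /= gy; apply: (pi_near (regular_near gy)). Qed.

(** Move within the trivialization at a fixed value of the fiber coordinate. *)
Lemma regular_dense_total : dense [set y : L | regular (pi y)].
Proof.
move=> Q [y Qy] oQ; have [a [j vy]] := in_triv_ex y.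
have [hc _] := triv_param vy.
have nQ : \forall z \near tcoord a j y, Q (lb_triv L a j z).
  by apply: hc; rewrite trivK //; apply: open_nbhs_nbhs.
have ck := differentiable_continuous (isd_ex (isd_pair (isd_id (cm_chart M j (pi y))) (isd_cst (u a y) (cm_chart M j (pi y))))).
have n1 : \forall w \near cm_chart M j (pi y), Q (lb_triv L a j (w, u a y)) := ck _ nQ.
have n2 := chart_near_of vy.2 n1.
have n : \forall x \near pi y, [/\ Q (lb_triv L a j (cm_chart M j x, u a y)), cm_dom M j x & U a x].
  by move: n2; apply: filterS3 (dom_near vy.2) (U_near vy.1).
have [x [Qx dx ax] gx] := regular_dense D n.
exists (lb_triv L a j (cm_chart M j x, u a y)); split => //.
by rewrite /= /lb_triv /= cm_chartK // lb_sec_proj.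
Qed.

End Orbits.

Unset Implicit Arguments.
Theorem theorem2 (R : realType) (n : nat) (M : cmanifold 'rV[Cplx R]_n)
    (g : set (vfield M)) (D : divisor M)
    (lambda : dv_index D -> vfield M -> M -> Cplx R) (L : divisor_bundle D) :
  lie_algebra g -> is_weight g lambda ->
  transversal_lift g (weight_lift L g lambda).
Proof.
move=> lg wg; have fE := fc_rV R n; split; first exact: is_lift_weight_lift.
exists [set y : L | regular D (lb_proj y)]; split.
- exact: regular_open.
- exact: regular_dense_total.
- by move=> y gy; exact: orbit_biholo.
Qed.
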